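(* Let $N\ge 1$ and $p>1$. Let $\varphi\in C^2(\mathbb{R}^N)$ be a nontrivial, bounded classical solution of $$\Delta\varphi-\frac{y}{2}\cdot\nabla\varphi+|\varphi|^{p-1}\varphi-\frac{1}{p-1}\varphi=0,\qquad y\in\mathbb{R}^N.$$ Then $$\varphi\notin L^{q^*}(\mathbb{R}^N),\qquad\text{where } q^*=\frac{N(p-1)}{2}.$$
   Context: Solutions are real-valued, and nontrivial means not identically zero. The exponent $q^*$ may be less than $1$; for any $q\in(0,\infty)$, $\varphi\in L^{q}(\mathbb{R}^N)$ means $\int_{\mathbb{R}^N}|\varphi|^{q}\,dy<\infty$. *)

(* Defs.v *)
(* MathComp-Analysis; R^N is 'rV[R]_N.  Its topology is that of the sup norm,
   which is the usual one; no statement below involves the norm of a point. *)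
From HB Require Import structures.
From mathcomp Require Import all_boot all_order all_algebra.
From mathcomp Require Import all_classical all_reals all_analysis.

Set Implicit Arguments.
Unset Strict Implicit.
Unset Printing Implicit Defensive.
Import Order.TTheory GRing.Theory Num.Theory.
Import numFieldNormedType.Exports.

Local Open Scope classical_set_scope.
Local Open Scope ring_scope.

Definition partial (R : realType) (N : nat) (i : 'I_N) (f : 'rV[R]_N -> R) :
    'rV[R]_N -> R :=
  fun y => 'D_(delta_mx 0 i) f y.

(* 'D_v f y is a total operator, so existence of the partial derivatives has
   to be required separately. *)
Fixpoint class_C (R : realType) (N k : nat) (f : 'rV[R]_N -> R) : Prop :=
  continuous f /\
  if k is k'.+1 then
    forall i : 'I_N, (forall y, derivable f y (delta_mx 0 i)) /\
                     class_C k' (partial i f)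
  else True.

Definition laplacian (R : realType) (N : nat) (f : 'rV[R]_N -> R) :
    'rV[R]_N -> R :=
  fun y => \sum_(i < N) partial i (partial i f) y.

(* y . grad f(y) *)
Definition dot_grad (R : realType) (N : nat) (f : 'rV[R]_N -> R) :
    'rV[R]_N -> R :=
  fun y => \sum_(i < N) y 0 i * partial i f y.

Definition tuple_cons (R : realType) (n : nat)
    (z : measurableTypeR R * n.-tuple (measurableTypeR R)) :
    n.+1.-tuple (measurableTypeR R) :=
  [tuple of z.1 :: z.2].

Lemma measurable_tuple_cons (R : realType) (n : nat) :
  measurable_fun setT (@tuple_cons R n).
Proof.
apply: (@measurable_cons _ _ _ _
  (fun z : measurableTypeR R * n.-tuple (measurableTypeR R) => z.1) n
  (fun z => z.2)); [exact: measurable_fst|exact: measurable_snd].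
Qed.

Definition lebesgue_cons (R : realType) (n : nat)
    (mu : {sigma_finite_measure set (n.-tuple (measurableTypeR R)) -> \bar R}) :
    set (n.+1.-tuple (measurableTypeR R)) -> \bar R :=
  pushforward (@lebesgue_measure R \x mu)%E (@tuple_cons R n).

Lemma lebesgue_cons0 (R : realType) (n : nat)
    (mu : {sigma_finite_measure set (n.-tuple (measurableTypeR R)) -> \bar R}) :
  lebesgue_cons mu set0 = 0%E.
Proof. by rewrite /lebesgue_cons /pushforward preimage_set0 measure0. Qed.

Lemma lebesgue_cons_ge0 (R : realType) (n : nat)
    (mu : {sigma_finite_measure set (n.-tuple (measurableTypeR R)) -> \bar R})
    (A : set (n.+1.-tuple (measurableTypeR R))) :
  (0 <= lebesgue_cons mu A)%E.
Proof. by rewrite /lebesgue_cons /pushforward;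
  exact: (@measure_ge0 _ _ _ (@lebesgue_measure R \x mu)%E).
Qed.

Lemma lebesgue_cons_sigma_additive (R : realType) (n : nat)
    (mu : {sigma_finite_measure set (n.-tuple (measurableTypeR R)) -> \bar R}) :
  semi_sigma_additive (lebesgue_cons mu).
Proof.
move=> F mF tF mUF; rewrite /lebesgue_cons /pushforward preimage_bigcup.
have mc := @measurable_tuple_cons R n.
apply: measure_semi_sigma_additive.
- by move=> i; rewrite -[X in measurable X]setTI; exact: mc.
- apply/trivIsetP => /= i j _ _ ij; rewrite -preimage_setI.
  by move/trivIsetP : tF => /(_ _ _ _ _ ij) ->//; rewrite preimage_set0.
- by rewrite -preimage_bigcup -[X in measurable X]setTI; exact: mc.
Qed.

HB.instance Definition _ (R : realType) (n : nat)
    (mu : {sigma_finite_measure set (n.-tuple (measurableTypeR R)) -> \bar R}) :=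
  isMeasure.Build _ _ _ (lebesgue_cons mu) (lebesgue_cons0 mu)
    (@lebesgue_cons_ge0 R n mu) (@lebesgue_cons_sigma_additive R n mu).

Lemma lebesgue_cons_sigma_finite (R : realType) (n : nat)
    (mu : {sigma_finite_measure set (n.-tuple (measurableTypeR R)) -> \bar R}) :
  sigma_finite setT (lebesgue_cons mu).
Proof.
have /sigma_finiteP[F [FT ndF Foo]] := sigma_finiteT (@lebesgue_measure R).
have /sigma_finiteP[G [GT ndG Goo]] := sigma_finiteT mu.
have FGT : [set: measurableTypeR R * n.-tuple (measurableTypeR R)] =
    \bigcup_k (F k `*` G k).
  apply/esym/seteqP; split => // -[x y] _.
  have [i _ Fx] : (\bigcup_i F i) x by rewrite -FT.
  have [j _ Gy] : (\bigcup_i G i) y by rewrite -GT.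
  exists (maxn i j) => //; split => /=.
    by move: (x) Fx; exact/subsetPset/ndF/leq_maxl.
  by move: (y) Gy; exact/subsetPset/ndG/leq_maxr.
pose uncons (t : n.+1.-tuple (measurableTypeR R)) :=
  (thead t, [tuple of behead t]) :
    measurableTypeR R * n.-tuple (measurableTypeR R).
have muncons : measurable_fun setT uncons.
  apply/measurable_fun_pair => /=; first exact: measurable_tnth.
  exact: measurable_behead.
have consK : cancel (@tuple_cons R n) uncons.
  by case=> a t; congr pair; apply/val_inj.
exists (fun k => uncons @^-1` (F k `*` G k)).
  by rewrite -preimage_bigcup -FGT preimage_setT.
move=> k; have [mFk Fkoo] := Foo k; have [mGk Gkoo] := Goo k; split.
  by rewrite -[X in measurable X]setTI; apply: muncons => //; exact: measurableX.
rewrite /lebesgue_cons /pushforward -comp_preimage.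
rewrite (_ : uncons \o _ = id); last by apply/funext => z /=; exact: consK.
by rewrite preimage_id product_measure1E// lte_mul_pinfty// ge0_fin_numE.
Qed.

HB.instance Definition _ (R : realType) (n : nat)
    (mu : {sigma_finite_measure set (n.-tuple (measurableTypeR R)) -> \bar R}) :=
  Measure_isSigmaFinite.Build _ _ _ (lebesgue_cons mu)
    (lebesgue_cons_sigma_finite mu).

(* N-dimensional Lebesgue measure, as the N-fold product of the
   one-dimensional one, on the product sigma-algebra of N.-tuple R. *)
Fixpoint lebesgueN (R : realType) (N : nat) :
    {sigma_finite_measure set (N.-tuple (measurableTypeR R)) -> \bar R} :=
  if N is n.+1 then lebesgue_cons (lebesgueN R n) else \d_[tuple].

Lemma lebesgueN_box (R : realType) (N : nat) (A : 'I_N -> set (measurableTypeR R)) :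
  (forall i, measurable (A i)) ->
  lebesgueN R N [set t | forall i, A i (tnth t i)] =
    (\prod_(i < N) lebesgue_measure (A i))%E.
Proof.
elim: N A => [|n IH] A mA /=.
  rewrite big_ord0 diracE mem_set//=; by case.
rewrite big_ord_recl -IH// -product_measure1E//.
  rewrite /lebesgue_cons /pushforward; congr product_measure1.
  apply/seteqP; split => -[a t] /=.
    move=> H; split; first by have := H ord0.
    by move=> i; have := H (lift ord0 i); rewrite tnthS.
  by move=> [Aa H] i; case: (unliftP ord0 i) => [j|] ->; rewrite ?tnthS.
have -> : [set t : n.-tuple (measurableTypeR R) |
    forall i, A (lift ord0 i) (tnth t i)] =
    \bigcap_(i in [set: 'I_n]) ((fun t => tnth t i) @^-1` A (lift ord0 i)).
  by apply/seteqP; split => t /= H i => [_|]; [exact: H|exact: (H i Logic.I)].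
apply: fin_bigcap_measurable => // i _.
by rewrite -[X in measurable X]setTI; exact: measurable_tnth.
Qed.

Definition tuple_row (R : realType) (N : nat) (t : N.-tuple R) : 'rV[R]_N :=
  \row_(i < N) tnth t i.

(* Only the finiteness of the integral, for any exponent q > 0: q may be less
   than 1, where there is no norm. *)
Definition in_Lq (R : realType) (N : nat) (q : R) (f : 'rV[R]_N -> R) : Prop :=
  (\int[lebesgueN R N]_t (`|f (tuple_row t)| `^ q)%:E < +oo)%E.

(* Main.v *)
(* Write a = 1/(p-1), z = |y|^2, D = y . grad phi, and suppose that phi is in
   L^q with q = N(p-1)/2.  The maximum principle for the centered difference
   phi(y + t e_i) - phi(y - t e_i), as a function of (y, t), bounds the gradient
   of phi; hence phi is Lipschitz and tends to 0 at infinity, and the barrier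
   C (z^-a - S/2 z^(-a-1)) improves this to |phi| = O(z^-a).

   Multiplying the equation by w(z) D and by W(z) phi and integrating by parts
   gives, for radial weights of compact support, the vanishing of the integral
   of a quadratic form in (D, phi).  Let u = sqrt(1 + dl z), m = 2a - N/2 and
   K = n - m.  The weight w = z^n (1 + u)^(-2K) behaves like z^n on a fixed ball
   when dl is small, but only like z^m at infinity, and for it the form is at
   least w K (1/8 - |phi|^(p-1)) phi^2 / u.  The errors made by cutting off at
   radius r vanish as r tends to infinity, because the decay of phi gives
   z^m phi^2 <= eta z^(-N/2) + C_eta |phi|^q for every eta > 0.

   Let z0 be the largest value of |y|^2 on the set {|phi| >= c}, for a small c.
   Beyond z0 the form is nonnegative, and phi does not vanish identically there,
   so that its integral over that region grows at least like z1^n for some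
   z1 > z0, while the region z <= z0 contributes only O(z0^n): a contradiction
   for large n. *)

Require Import Defs.
From HB Require Import structures.
From mathcomp Require Import all_boot all_order all_algebra.
From mathcomp Require Import all_classical all_reals all_analysis.
From mathcomp Require Import measurable_realfun ring lra.
Import Order.TTheory GRing.Theory Num.Theory.
Import numFieldNormedType.Exports.

Local Open Scope classical_set_scope.
Local Open Scope ring_scope.

Set Implicit Arguments.
Unset Strict Implicit.
Unset Printing Implicit Defensive.

(** * Directional derivatives *)

(** The exponent [q] is critical: since [a q = N/2], the decay [|phi| = O(z^-a)] only gives
    [|phi|^q = O(z^(-N/2))], which just fails to be integrable. The order [m = 2a - N/2] of the
    weight at infinity is the one for which [z^m phi^2] has this same borderline size: a shell of
    radius [r] and volume of order [r^N] then contributes O(1) to the cutoff error, and membership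
    in L^q turns this into o(1). A power [z^n] with [n > m] would leave errors that need not be
    bounded, while growth of order [m] alone cannot make [z >= z1] outweigh [z <= z0]. Hence an
    interpolating weight, with [dl] of order [1/n]: on a fixed ball [(1 + u)^(-2K)] then stays
    between [2^(-2K)] and a multiple of it independent of [n], and this common factor cancels when
    [z1^n] is compared with [z0^n].

    The form is controlled through the square of [D + s phi], where [s = 2a + K/u] tends to [2a],
    the value for which the square vanishes on the profile [z^-a]. Order of limits: [n], then [dl],
    then the cutoff radius to infinity, and only then [n] to infinity. *)

Lemma derD (R : realType) (V : normedModType R) (f g : V -> R) (x v : V)
    (df dg : R) : is_derive x v f df -> is_derive x v g dg ->
  is_derive x v (fun y => f y + g y) (df + dg).
Proof. exact: is_deriveD. Qed.

Lemma derN (R : realType) (V : normedModType R) (f : V -> R) (x v : V)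
    (df : R) : is_derive x v f df -> is_derive x v (fun y => - f y) (- df).
Proof. exact: is_deriveN. Qed.

Lemma derB (R : realType) (V : normedModType R) (f g : V -> R) (x v : V)
    (df dg : R) : is_derive x v f df -> is_derive x v g dg ->
  is_derive x v (fun y => f y - g y) (df - dg).
Proof. exact: is_deriveB. Qed.

Lemma derM (R : realType) (V : normedModType R) (f g : V -> R) (x v : V)
    (df dg : R) : is_derive x v f df -> is_derive x v g dg ->
  is_derive x v (fun y => f y * g y) (df * g x + f x * dg).
Proof.
move=> hf hg; apply: (is_derive_eq (@is_deriveM _ _ f g x v df dg hf hg)).
by rewrite addrC /GRing.scale /= (mulrC (g x)).
Qed.

Lemma derX (R : realType) (V : normedModType R) (f : V -> R) (n : nat) (x v : V)
    (df : R) : is_derive x v f df ->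
  is_derive x v (fun y => f y ^+ n) (n%:R * f x ^+ n.-1 * df).
Proof.
move=> hf; rewrite (_ : (fun y => _) = f ^+ n); last first.
  by apply/funext => y; rewrite fctE.
apply: (is_derive_eq (@is_deriveX _ _ f n x v df hf)).
by rewrite /GRing.scale /=.
Qed.

Lemma derC (R : realType) (V : normedModType R) (c : R) (x v : V) :
  is_derive x v (fun=> c) 0.
Proof. exact: is_derive_cst. Qed.

Lemma der_sum (R : realType) (V : normedModType R) (n : nat)
    (f : 'I_n -> V -> R) (df : 'I_n -> R) (x v : V) :
  (forall i, is_derive x v (f i) (df i)) ->
  is_derive x v (fun y => \sum_i f i y) (\sum_i df i).
Proof.
move=> h; rewrite (_ : (fun y => _) = \sum_i f i); last first.
  by apply/funext => y; rewrite fct_sumE.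
exact: is_derive_sum.
Qed.

Lemma der_val (R : realType) (V : normedModType R) (f : V -> R) (x v : V)
    (df df' : R) : is_derive x v f df -> df = df' -> is_derive x v f df'.
Proof. by move=> h <-. Qed.

(** Both sides have literally the same difference quotient. All calculus in several variables is
    reduced in this way to one variable, since only derivatives along coordinate directions are
    available. *)
Lemma is_derive_line (R : realType) (N : nat) (f : 'rV[R]_N -> R)
    (y v : 'rV[R]_N) (t df : R) :
  is_derive (y + t *: v) v f df <->
  is_derive t (1 : R) (fun s : R => f (y + s *: v)) df.
Proof.
have E : (fun h : R => h^-1 *: ((f \o shift (y + t *: v)) (h *: v) -
      f (y + t *: v))) =
    (fun h : R => h^-1 *: (((fun s : R => f (y + s *: v)) \o shift t)
      (h *: (1 : R)) - f (y + t *: v))).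
  apply/funext => h /=; congr (_ *: (f _ - _)).
  by rewrite /shift /= scalerDl addrCA /GRing.scale/= mulr1.
split => -[d1 d2]; split.
- by move: d1; rewrite /derivable E.
- by rewrite -d2 /derive E.
- by move: d1; rewrite /derivable E.
- by rewrite -d2 /derive E.
Qed.

Lemma is_derive_coord (R : realType) (N : nat) (i j : 'I_N) (y : 'rV[R]_N) :
  is_derive y (delta_mx 0 i) (fun x : 'rV[R]_N => x 0 j) ((i == j)%:R : R).
Proof.
rewrite {1}(_ : y = y + 0 *: delta_mx 0 i); last by rewrite scale0r addr0.
apply/is_derive_line.
rewrite (_ : (fun s : R => _) = (fun s => y 0 j + s * (i == j)%:R)); last first.
  by apply/funext => s; rewrite !mxE eqxx/= eq_sym.
by apply: der_val; rewrite /GRing.scale /=; ring.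
Qed.

Definition sqn (R : realType) (N : nat) (y : 'rV[R]_N) : R :=
  \sum_(i < N) y 0 i ^+ 2.

Lemma is_derive_sqn (R : realType) (N : nat) (i : 'I_N) (y : 'rV[R]_N) :
  is_derive y (delta_mx 0 i) (@sqn R N) (2 * y 0 i).
Proof.
apply: der_val.
  apply: der_sum => j; apply: derX; exact: is_derive_coord.
rewrite (bigD1 i)//= big1 ?addr0 => [|j ij].
  by rewrite eqxx /= mulr1 expr1.
by rewrite eq_sym (negbTE ij) mulr0.
Qed.

Lemma is_derive_radial (R : realType) (N : nat) (i : 'I_N) (y : 'rV[R]_N)
    (w : R -> R) (dw : R) :
  is_derive (sqn y) 1 w dw ->
  is_derive y (delta_mx 0 i) (fun x : 'rV[R]_N => w (sqn x)) (2 * y 0 i * dw).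
Proof.
move=> hw.
rewrite {1}(_ : y = y + 0 *: delta_mx 0 i); last by rewrite scale0r addr0.
apply/is_derive_line.
have := is_derive_sqn i (y + 0 *: delta_mx 0 i).
move/is_derive_line => hs.
have hw' : is_derive (sqn (y + 0 *: delta_mx 0 i)) 1 w dw.
  by rewrite scale0r addr0.
have := @is_derive1_comp _ w (fun s => sqn (y + s *: delta_mx 0 i)) 0 _ _ hw' hs.
by rewrite scale0r addr0 mulrC.
Qed.

Lemma near_coord (R : realType) (N : nat) (F : 'rV[R]_N -> R) (y : 'rV[R]_N)
    (e : R) : continuous F -> 0 < e ->
  exists2 d : R, 0 < d &
    forall x : 'rV[R]_N, (forall k, `|x 0 k - y 0 k| < d) -> `|F x - F y| < e.
Proof.
move=> cF e0.
have /cvgrPdist_lt/(_ _ e0)/nbhs_ballP[d /= d0 dP] := cF y.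
exists d => // x xy; rewrite distrC; apply: dP; split => // i j.
by rewrite (ord1 i) /ball /= distrC.
Qed.

Lemma der_continuous (R : realType) (f : R -> R) (x df : R) :
  is_derive x 1 f df -> {for x, continuous f}.
Proof. by move=> [h _]; exact/differentiable_continuous/derivable1_diffP. Qed.

Lemma MVT_line (R : realType) (N : nat) (f : 'rV[R]_N -> R) (v y : 'rV[R]_N)
    (df : 'rV[R]_N -> R) (h : R) :
  (forall x, is_derive x v f (df x)) -> 0 < h ->
  exists2 s, 0 < s < h & f (y + h *: v) - f y = df (y + s *: v) * h.
Proof.
move=> fd h0.
have gd (s : R) : is_derive s 1 (fun s : R => f (y + s *: v)) (df (y + s *: v)).
  by apply/is_derive_line; exact: fd.
have [|s] := @MVT R (fun s : R => f (y + s *: v)) (fun s : R => df (y + s *: v))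
    0 h h0 (fun s _ => gd s).
  by apply: continuous_subspaceT => s; exact: der_continuous (gd s).
rewrite in_itv /= scale0r addr0 subr0 => sh E.
by exists s.
Qed.

(** The second difference over a square of side [h] equals [h^2] times either mixed derivative, each
    at some point of the square, by two applications of the mean value theorem in either order.
    Continuity then closes the gap as [h] shrinks. *)
Lemma partialC (R : realType) (N : nat) (f : 'rV[R]_N -> R)
    (d1 : 'I_N -> 'rV[R]_N -> R) (d2 : 'I_N -> 'I_N -> 'rV[R]_N -> R) :
  (forall i y, is_derive y (delta_mx 0 i) f (d1 i y)) ->
  (forall i j y, is_derive y (delta_mx 0 i) (d1 j) (d2 i j y)) ->
  (forall i j, continuous (d2 i j)) ->
  forall i j y, d2 i j y = d2 j i y.
Proof.
move=> h1 h2 cd i j y.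
have key (k l : 'I_N) (h : R) : 0 < h -> exists s t, [/\ 0 < s < h, 0 < t < h &
    f (y + h *: delta_mx 0 k + h *: delta_mx 0 l) - f (y + h *: delta_mx 0 k) -
    f (y + h *: delta_mx 0 l) + f y =
    d2 l k (y + s *: delta_mx 0 k + t *: delta_mx 0 l) * h * h].
  move=> h0.
  pose ek : 'rV[R]_N := delta_mx 0 k; pose el : 'rV[R]_N := delta_mx 0 l.
  have gd x : is_derive x ek (fun x => f (x + h *: el) - f x)
      (d1 k (x + h *: el) - d1 k x).
    apply: derB.
    rewrite {1}(_ : x = x + 0 *: ek); last by rewrite scale0r addr0.
    apply/is_derive_line.
    rewrite (_ : (fun s => _) = (fun s => f (x + h *: el + s *: ek))); last first.
      by apply/funext => s; rewrite addrAC.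
    apply/is_derive_line; rewrite scale0r addr0; exact: h1.
  have [s sh E] := MVT_line y gd h0.
  have [t th E'] := MVT_line (y + s *: ek) (fun x => h2 l k x) h0.
  exists s, t; split => //.
  by rewrite -/ek -/el -E' -E; ring.
apply/eqP; rewrite -subr_eq0 -normr_eq0; apply/eqP/le_anti.
rewrite normr_ge0 andbT; apply/ler_addgt0Pr => e e0; rewrite add0r.
have e20 : 0 < e / 2 by lra.
have [d d0 dP] := near_coord y (cd i j) e20.
have [d' d'0 d'P] := near_coord y (cd j i) e20.
(* Half of the minimum, because both increments fall on the same coordinate when [i = j]. *)
pose h := Num.min d d' / 2.
have m0 : 0 < Num.min d d' by rewrite lt_min d0.
have h0 : 0 < h by rewrite divr_gt0.
have [s [t [sh th E]]] := key j i _ h0.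
have [s' [t' [sh' th' E']]] := key i j _ h0.
have small (a b : R) (k l : 'I_N) : 0 < a < h -> 0 < b < h -> forall m,
    `|(y + a *: delta_mx 0 k + b *: delta_mx 0 l) 0 m - y 0 m| < Num.min d d'.
  move=> /andP[a0 ah] /andP[b0 bh] m; rewrite !mxE eqxx /=.
  have -> : y 0 m + a * (m == k)%:R + b * (m == l)%:R - y 0 m =
    a * (m == k)%:R + b * (m == l)%:R by ring.
  have dh : Num.min d d' = h + h by rewrite /h -splitr.
  case: (m == k); case: (m == l); rewrite /= ?mulr1 ?mulr0 ?addr0 ?add0r ?normr0//;
    rewrite gtr0_norm; lra.
have F1 : d2 i j (y + s *: delta_mx 0 j + t *: delta_mx 0 i) =
          d2 j i (y + s' *: delta_mx 0 i + t' *: delta_mx 0 j).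
  apply: (@mulIf _ h); first by rewrite gt_eqF.
  apply: (@mulIf _ h); first by rewrite gt_eqF.
  rewrite -E -E' (addrAC y); ring.
have := dP _ (fun m => lt_le_trans (small _ _ j i sh th m) (_ : _ <= d)).
have := d'P _ (fun m => lt_le_trans (small _ _ i j sh' th' m) (_ : _ <= d')).
rewrite !ge_min !lexx orbT => /(_ isT) + /(_ isT).
rewrite F1 !ltr_norml ler_norml; lra.
Qed.

(** If [g2] were positive, [g1] would be positive just to the right of 0, and the mean value theorem
    would push [g] above [g 0]. Differentiability of [g1] is thus needed at 0 only. *)
Lemma max_second_test (R : realType) (g g1 : R -> R) (g2 e : R) : 0 < e ->
  (forall t : R, `|t| < e -> is_derive t 1 g (g1 t)) -> is_derive (0 : R) 1 g1 g2 ->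
  (forall t, `|t| < e -> g t <= g 0) -> g1 0 = 0 /\ g2 <= 0.
Proof.
move=> e0 gd g1d gmax.
have g10 : g1 0 = 0.
  have le : - e <= e by lra.
  have dd (t : R) : t \in `](- e), e[%R -> derivable g t 1.
    by rewrite in_itv /= -ltr_norml => /gd[].
  have z0 : 0 \in `](- e), e[%R by rewrite in_itv /= oppr_lt0 e0.
  have mx (t : R) : t \in `](- e), e[%R -> g t <= g 0.
    by rewrite in_itv /= => te; apply: gmax; rewrite ltr_norml.
  have [_ E] := derive1_at_max le dd z0 mx.
  have /gd[_ E'] : `|0 : R| < e by rewrite normr0.
  by rewrite -E' E.
split => //; rewrite leNgt; apply/negP => g20.
have [g1d1 g1d2] := g1d.
have /cvgrPdist_lt/(_ _ g20) : h^-1 *: ((g1 \o shift 0) (h *: (1 : R)) - g1 0) @[h --> 0^'] --> g2.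
  by rewrite -g1d2; exact: g1d1.
rewrite near_withinE => /nbhs_ballP[d /= d0 dP].
pose h := Num.min d e / 2.
have m0 : 0 < Num.min d e by rewrite lt_min d0.
have h0 : 0 < h by rewrite divr_gt0.
have hd : h < d /\ h < e.
  have : Num.min d e <= d by rewrite ge_min lexx.
  have : Num.min d e <= e by rewrite ge_min lexx orbT.
  by rewrite /h; lra.
have pos t : 0 < t < h -> 0 < g1 t.
  move=> /andP[t0 th].
  have td : t < d by lra.
  have tb : ball 0 d t by rewrite /ball /= sub0r normrN gtr0_norm.
  have tn : t != 0 by rewrite gt_eqF.
  have := dP t tb tn.
  rewrite /shift /= addr0 g10 subr0 /GRing.scale /= mulr1 ltr_norml => /andP[_].
  by rewrite ltrBlDr ltrDl pmulr_rgt0 ?invr_gt0.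
have gd' (s : R) : s \in `]0, h[%R -> is_derive s 1 g (g1 s).
  by rewrite in_itv /= => sh; apply: gd; rewrite ger0_norm; lra.
have [|s] := @MVT R g g1 0 h h0 gd'.
  apply: continuous_in_subspaceT => s.
  rewrite inE /= in_itv /= => sh; apply: (@der_continuous _ _ _ (g1 s)).
  by apply: gd; rewrite ger0_norm; lra.
rewrite in_itv /= => sh E.
have := gmax h; rewrite gtr0_norm// => /(_ hd.2).
have := pos _ sh => p1.
have : 0 < g1 s * (h - 0) by rewrite subr0 mulr_gt0.
by lra.
Qed.

(** * The gradient bound *)

(** The derivatives are carried as explicit functions, so that the symmetry [phi -> - phi] of the
    equation acts on them termwise. *)
Record profile (R : realType) (N : nat) (p : R) (phi : 'rV[R]_N -> R)
    (d1 : 'I_N -> 'rV[R]_N -> R) (d2 : 'I_N -> 'I_N -> 'rV[R]_N -> R) : Prop :=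
  Profile {
    profile_d1 : forall i y, is_derive y (delta_mx 0 i) phi (d1 i y);
    profile_d2 : forall i j y, is_derive y (delta_mx 0 i) (d1 j) (d2 i j y);
    profile_c0 : continuous phi;
    profile_c1 : forall i, continuous (d1 i);
    profile_c2 : forall i j, continuous (d2 i j);
    profile_eq : forall y, \sum_i d2 i i y - 2^-1 * \sum_i y 0 i * d1 i y
      + `|phi y| `^ (p - 1) * phi y - (p - 1)^-1 * phi y = 0 }.

(** The equation is odd; every one-sided estimate below becomes two-sided through this lemma. *)
Lemma profileN (R : realType) (N : nat) (p : R) (phi : 'rV[R]_N -> R)
    (d1 : 'I_N -> 'rV[R]_N -> R) (d2 : 'I_N -> 'I_N -> 'rV[R]_N -> R) :
  profile p phi d1 d2 ->
  profile p (fun y => - phi y) (fun i y => - d1 i y) (fun i j y => - d2 i j y).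
Proof.
move=> [h1 h2 c0 c1 c2 e]; split.
- by move=> i y; apply: derN.
- by move=> i j y; apply: derN.
- by move=> y; apply: continuousN; exact: c0.
- by move=> i y; apply: continuousN; exact: c1.
- by move=> i j y; apply: continuousN; exact: c2.
- move=> y; rewrite normrN sumrN.
  have -> : \sum_i y 0 i * - d1 i y = - \sum_i y 0 i * d1 i y.
    by rewrite -sumrN; apply: eq_bigr => i _; rewrite mulrN.
  rewrite -[RHS]oppr0 -[in RHS](e y); ring.
Qed.

Lemma der_comp (R : realType) (f g : R -> R) (x a b : R) :
  is_derive (g x) 1 f a -> is_derive x 1 g b ->
  is_derive x 1 (fun y => f (g y)) (a * b).
Proof. by move=> hf hg; have := @is_derive1_comp _ f g x a b hf hg. Qed.

(** * Continuity of explicit expressions; compact boxes *)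

Lemma contD (R : realType) (T : topologicalType) (f g : T -> R) :
  continuous f -> continuous g -> continuous (fun x => f x + g x).
Proof. by move=> cf cg x; apply: cvgD; [exact: cf|exact: cg]. Qed.

Lemma contN (R : realType) (T : topologicalType) (f : T -> R) :
  continuous f -> continuous (fun x => - f x).
Proof. by move=> cf x; apply: cvgN; exact: cf. Qed.

Lemma contB (R : realType) (T : topologicalType) (f g : T -> R) :
  continuous f -> continuous g -> continuous (fun x => f x - g x).
Proof. by move=> cf cg; apply: contD => //; exact: contN. Qed.

Lemma contM (R : realType) (T : topologicalType) (f g : T -> R) :
  continuous f -> continuous g -> continuous (fun x => f x * g x).
Proof. by move=> cf cg x; apply: cvgM; [exact: cf|exact: cg]. Qed.

Lemma contC (R : realType) (T : topologicalType) (c : R) :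
  continuous (fun _ : T => c).
Proof. by move=> x; exact: cvg_cst. Qed.

Lemma contX (R : realType) (T : topologicalType) (f : T -> R) (n : nat) :
  continuous f -> continuous (fun x => f x ^+ n).
Proof.
move=> cf; elim: n => [|n IH]; first exact: contC.
rewrite (_ : (fun x => _) = (fun x => f x * f x ^+ n)); first exact: contM.
by apply/funext => x; rewrite exprS.
Qed.

Lemma contS (R : realType) (T : topologicalType) (n : nat) (f : 'I_n -> T -> R) :
  (forall i, continuous (f i)) -> continuous (fun x => \sum_i f i x).
Proof.
move=> cf; rewrite (_ : (fun x => _) = \sum_i f i); last first.
  by apply/funext => x; rewrite fct_sumE.
elim/big_ind : _ => //; first exact: contC.
by move=> g h cg ch; exact: contD.
Qed.

Lemma cont_comp (T U V : topologicalType) (f : T -> U) (g : U -> V) :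
  continuous f -> continuous g -> continuous (fun x => g (f x)).
Proof. by move=> cf cg x; apply: continuous_comp; [exact: cf|exact: cg]. Qed.

Lemma continuous_entry (R : realType) (N : nat) (j : 'I_N) :
  continuous (fun x : 'rV[R]_N => x 0 j).
Proof. exact: coord_continuous. Qed.

Lemma continuous_sqn (R : realType) (N : nat) : continuous (@sqn R N).
Proof. by apply: contS => i; apply/contX/continuous_entry. Qed.

Lemma sqn_ge_coord (R : realType) (N : nat) (y : 'rV[R]_N) (i : 'I_N) :
  y 0 i ^+ 2 <= sqn y.
Proof.
by rewrite /sqn (bigD1 i)//= lerDl sumr_ge0// => j _; rewrite sqr_ge0.
Qed.

Lemma sqn_ge0 (R : realType) (N : nat) (y : 'rV[R]_N) : 0 <= sqn y.
Proof. by rewrite sumr_ge0// => j _; rewrite sqr_ge0. Qed.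

Lemma box_compact (R : realType) (N : nat) (r : R) :
  compact [set y : 'rV[R]_N | forall i, `|y 0 i| <= r].
Proof.
have -> : [set y : 'rV[R]_N | forall i, `|y 0 i| <= r] =
    [set y | forall i, `[- r, r]%classic (y ord0 i)].
  by apply/seteqP; split => y /= h i; have := h i; rewrite in_itv /= ler_norml.
by apply: (@rV_compact R N (fun=> `[- r, r]%classic)) => i; exact: segment_compact.
Qed.

Lemma der_line (R : realType) (N : nat) (f : 'rV[R]_N -> R) (y v : 'rV[R]_N)
    (t df : R) : is_derive (y + t *: v) v f df ->
  is_derive t (1 : R) (fun s : R => f (y + s *: v)) df.
Proof. by move/is_derive_line. Qed.

(* Adding [- de * sqn y] makes the maximum over [y] attained; only pure second
   derivatives occur in the second derivative test. *)
Lemma centered_difference_le (R : realType) (N : nat) (p M : R)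
    (phi : 'rV[R]_N -> R) (d1 : 'I_N -> 'rV[R]_N -> R)
    (d2 : 'I_N -> 'I_N -> 'rV[R]_N -> R) :
  profile p phi d1 d2 -> (forall y, `|phi y| <= M) ->
  1 < p -> exists A : R, forall (i : 'I_N) (y : 'rV[R]_N) (t : R), 0 <= t <= 1 ->
    phi (y + t *: delta_mx 0 i) - phi (y - t *: delta_mx 0 i) <= A * t.
Proof.
move=> prf phiM p1.
have [h1 h2 c0 c1 c2 e] := prf.
have M0 : 0 <= M by exact: le_trans (phiM 0).
pose a := (p - 1)^-1.
pose f (x : R) := `|x| `^ (p - 1) * x - a * x.
have [Cf Cf0 fC] : exists2 C : R, 0 <= C & forall y, `|f (phi y)| <= C.
  exists (M `^ (p - 1) * M + `|a| * M).
    by rewrite addr_ge0// mulr_ge0// powR_ge0.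
  move=> y; apply: (le_trans (ler_normB _ _)); rewrite !normrM.
  apply: lerD; last by rewrite ler_wpM2l.
  apply: ler_pM => //; rewrite ger0_norm ?powR_ge0//.
  by apply: ge0_ler_powR; rewrite ?nnegrE ?normr_ge0//; lra.
(* At an interior maximum the concavity [- 2 * B] of [Psi] must beat the oscillation [2 * Cf] of the
   zeroth-order terms and the perturbation [2 * de * N <= 2]. The choice of [A] makes [Psi]
   nondecreasing on [0, 1] and at least [2 * M] at 1, which keeps the maximum away from [t = 1] and
   gives the drift its sign. *)
pose B : R := Cf + 2.
pose A := 2 * M + 2 * B.
exists A => i y0 t0 t01; rewrite leNgt; apply/negP => hA.
pose ei : 'rV[R]_N := delta_mx 0 i.
pose u (y : 'rV[R]_N) (t : R) := phi (y + t *: ei) - phi (y - t *: ei).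
pose Psi (t : R) := A * t - B * t ^+ 2.
pose e0 := u y0 t0 - Psi t0.
have e00 : 0 < e0.
  rewrite /e0 /Psi /u -/ei; have : 0 <= B * t0 ^+ 2.
    by rewrite mulr_ge0 ?sqr_ge0// /B; lra.
  by move: hA; rewrite -/ei; lra.
pose de : R := Num.min 1 e0 / (sqn y0 + N%:R + 1).
have s0 := sqn_ge0 y0.
have N0 : 0 <= N%:R :> R by [].
have de0 : 0 < de by rewrite divr_gt0 ?lt_min ?ltr01 ?e00//; lra.
have deE : de * (sqn y0 + N%:R + 1) = Num.min 1 e0 by rewrite divfK// gt_eqF//; lra.
have de1 : de * (sqn y0 + N%:R + 1) <= 1 by rewrite deE ge_min lexx.
have de2 : de * (sqn y0 + N%:R + 1) <= e0 by rewrite deE ge_min lexx orbT.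
pose H (z : 'rV[R]_N * R) := u z.1 z.2 - Psi z.2 - de * sqn z.1.
have H0 : 0 < H (y0, t0).
  rewrite /H /= -/e0; nra.
have uM (y : 'rV[R]_N) (t : R) : u y t <= 2 * M.
  have := phiM (y + t *: ei); have := phiM (y - t *: ei).
  by rewrite /u !ler_norml; lra.
have A0 : 0 <= A by rewrite /A /B; lra.
have Psi0 (t : R) : 0 <= t <= 1 -> 0 <= Psi t.
  move=> /andP[t1 t2].
  rewrite (_ : Psi t = 2 * (M * t) + B * (t * (2 - t))); last first.
    by rewrite /Psi /A; ring.
  by apply: addr_ge0; apply: mulr_ge0 => //; [exact: mulr_ge0|rewrite /B; clear -Cf0; lra|apply: mulr_ge0 => //; clear -t2; lra].
pose rho := 2 * M / de + 1.
have rho1 : 1 <= rho by rewrite lerDr divr_ge0//; [lra|exact: ltW].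
have rhoM : 2 * M < de * rho ^+ 2.
  have : de * rho = 2 * M + de by rewrite /rho mulrDr mulr1 mulrCA divff ?mulr1// gt_eqF.
  have : 0 <= de * (rho * (rho - 1)) by apply: mulr_ge0; [exact: ltW|apply: mulr_ge0; lra].
  by lra.
pose K := [set y : 'rV[R]_N | forall i, `|y 0 i| <= rho] `*` `[0 : R, 1]%classic.
have inK (y : 'rV[R]_N) (t : R) : 0 <= t <= 1 -> 0 < H (y, t) -> K (y, t).
  move=> t1 Hp; split => /=; last by rewrite in_itv.
  move=> j; rewrite leNgt; apply/negP => hj.
  have : rho ^+ 2 < y 0 j ^+ 2 by rewrite -(real_normK (num_real (y 0 j))) ltr_pXn2r// ?nnegrE//; lra.
  have := sqn_ge_coord y j => s1 s2.
  have s3 : rho ^+ 2 < sqn y by lra.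
  have : de * rho ^+ 2 < de * sqn y by rewrite ltr_pM2l.
  have := uM y t; have := Psi0 t t1; move: Hp; rewrite /H /=; clear -rhoM; lra.
have cK : compact K by apply: compact_setX; [exact: box_compact|exact: segment_compact].
have cline (c : R) : continuous (fun z : 'rV[R]_N * R => phi (z.1 + (c * z.2) *: ei)).
  apply: (cont_comp (f := fun z : 'rV[R]_N * R => z.1 + (c * z.2) *: ei)) => //.
  move=> z; apply: cvgD; first exact: cvg_fst.
  apply: cvgZ; last exact: cvg_cst.
  by apply: cvgM; [exact: cvg_cst|exact: cvg_snd].
have csnd : continuous (fun z : 'rV[R]_N * R => z.2) by move=> z; exact: cvg_snd.
have cH : continuous H.
  rewrite (_ : H = fun z => phi (z.1 + (1 * z.2) *: ei) - phi (z.1 + (-1 * z.2) *: ei)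
      - (A * z.2 - B * z.2 ^+ 2) - de * sqn z.1); last first.
    by apply/funext => z; rewrite /H /u /Psi mul1r mulN1r scaleNr.
  apply: contB; last first.
    apply: contM; first exact: contC.
    apply: (cont_comp (f := fst)); last exact: continuous_sqn.
    by move=> z; exact: cvg_fst.
  apply: contB; first by apply: contB; exact: cline.
  by apply: contB; apply: contM; rewrite //; [exact: contC|exact: contC|exact: contX].
have K0 : K !=set0 by exists (y0, t0); exact: inK.
have [[ys ts] /set_mem Ks Hmax] := compact_EVT_max K0 cK (continuous_subspaceT cH).
have Hs (y : 'rV[R]_N) (t : R) : 0 <= t <= 1 -> H (y, t) <= H (ys, ts).
  move=> t1; have [Hp|Hn] := ltP 0 (H (y, t)).
    by apply: Hmax; rewrite inE; exact: inK.
  apply: (le_trans Hn); apply/ltW/(lt_le_trans H0); apply: Hmax.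
  by rewrite inE; exact: inK.
have Hsp : 0 < H (ys, ts) by apply: (lt_le_trans H0); exact: Hs.
have [_ /=] := Ks; rewrite in_itv /= => ts1.
have ts0 : ts != 0.
  apply/eqP => E; move: Hsp; rewrite E /H /u /Psi /= scale0r addr0 subr0.
  by have := mulr_ge0 (ltW de0) (sqn_ge0 ys); lra.
have tsn1 : ts != 1.
  apply/eqP => E; move: Hsp; rewrite E /H /=.
  have := mulr_ge0 (ltW de0) (sqn_ge0 ys); have := uM ys 1; rewrite /Psi /A /B; lra.
have {ts0 tsn1} ts01 : 0 < ts < 1 by move/andP: ts1 => [l1 l2]; rewrite !lt_neqAle eq_sym ts0 tsn1 l1 l2.
pose yp : 'rV[R]_N := ys + ts *: ei; pose ym : 'rV[R]_N := ys - ts *: ei.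
have testy (j : 'I_N) : d1 j yp - d1 j ym = 2 * de * ys 0 j /\
    d2 j j yp - d2 j j ym <= 2 * de.
  pose ej : 'rV[R]_N := delta_mx 0 j.
  pose g (s : R) := phi (yp + s *: ej) - phi (ym + s *: ej) - Psi ts
    - de * sqn (ys + s *: ej).
  pose g1 (s : R) := d1 j (yp + s *: ej) - d1 j (ym + s *: ej) - 0
    - (0 * sqn (ys + s *: ej) + de * (2 * (ys + s *: ej) 0 j)).
  have gE s : g s = H (ys + s *: ej, ts).
    by rewrite /g /H /u /= /yp /ym (addrAC ys (ts *: ei)) (addrAC ys (- (ts *: ei))).
  have gd (s : R) : is_derive s 1 g (g1 s).
    apply: derB.
      apply: derB; try exact: derC.
      by apply: derB; apply: der_line; exact: h1.
    apply: derM; try exact: derC.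
    by apply: der_line; exact: is_derive_sqn.
  have gd' : is_derive (0 : R) 1 g1 (d2 j j yp - d2 j j ym - 0 - (de * 2)).
    rewrite /g1.
    apply: derB.
      apply: derB; try exact: derC.
      by apply: derB; apply: der_line; rewrite scale0r addr0; exact: h2.
    rewrite (_ : (fun s => _) = (fun s : R => de * (2 * (ys 0 j + s)))); last first.
      by apply/funext => s; rewrite mul0r add0r !mxE !eqxx mulr1.
    by apply: der_val; rewrite /GRing.scale /=; ring.
  have [|E1 E2] := @max_second_test R g g1 _ 1 ltr01 (fun s _ => gd s) gd'.
    by move=> s _; rewrite !gE scale0r addr0; exact: Hs.
  move: E1; rewrite /g1 !scale0r !addr0 => E1.
  by clear -E1 E2; split; lra.
(* Moving [t] along [ei] yields the same difference of second derivatives as moving [y], but with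
   the strict concavity of [Psi] on the right. This estimate replaces [testy] for the index [i]. *)
have testt : d1 i yp + d1 i ym = A - 2 * B * ts /\
    d2 i i yp - d2 i i ym <= - 2 * B.
  pose g (s : R) := phi (yp + s *: ei) - phi (ym + (- s) *: ei)
    - Psi (ts + s) - de * sqn ys.
  pose g1 (s : R) := d1 i (yp + s *: ei) - d1 i (ym + (- s) *: ei) * (- 1)
    - (A - 2 * B * (ts + s)) - 0.
  have gE s : g s = H (ys, ts + s).
    rewrite /g /H /u /=.
    have -> : ys + (ts + s) *: ei = yp + s *: ei by rewrite /yp scalerDl addrA.
    have -> // : ys - (ts + s) *: ei = ym + (- s) *: ei.
    by rewrite /ym scalerDl opprD addrA scaleNr.
  have dline (h dh : 'rV[R]_N -> R) (y : 'rV[R]_N) (s : R) :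
      (forall y, is_derive y ei h (dh y)) ->
      is_derive s (1 : R) (fun s : R => h (y + (- s) *: ei)) (dh (y + (- s) *: ei) * (- 1)).
    move=> fd; apply: (@der_comp _ (fun s => h (y + s *: ei))).
    by apply: der_line; exact: fd.
  have gd (s : R) : is_derive s 1 g (g1 s).
    apply: derB; try exact: derC.
    apply: derB.
      by apply: derB; first [exact: dline | apply: der_line; exact: h1].
    by apply: der_val; rewrite /GRing.scale /=; ring.
  have gd' : is_derive (0 : R) 1 g1 (d2 i i yp - d2 i i ym * (- 1) * (- 1) + 2 * B).
    apply: (@der_val _ _ _ _ _ (d2 i i yp - (d2 i i ym * (- 1) * (- 1) + d1 i ym * 0)
       - (- (2 * B)) - 0)); last by ring.
    apply: derB; try exact: derC.
    apply: derB.
      apply: derB; first by apply: der_line; rewrite scale0r addr0; exact: h2.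
      apply: (@der_val _ _ _ _ _ (d2 i i (ym + (- 0) *: ei) * (- 1) * (- 1) +
        d1 i (ym + (- 0) *: ei) * 0)); last by rewrite oppr0 scale0r addr0.
      by apply: derM; apply: dline => z; exact: h2.
    by apply: der_val; rewrite /GRing.scale /=; ring.
  have e1 : 0 < Num.min ts (1 - ts) by rewrite lt_min; clear -ts01; lra.
  have [|E1 E2] := @max_second_test R g g1 _ _ e1 (fun s _ => gd s) gd'.
    move=> s; rewrite lt_min !ltr_norml => s1; rewrite !gE addr0; apply: Hs; clear -s1; lra.
  move: E1; rewrite /g1 oppr0 !scale0r !addr0 => E1.
  by clear -E1 E2; split; lra.
have L : \sum_j d2 j j yp - \sum_j d2 j j ym <= 2 * de * N%:R - 2 * B.
  rewrite -sumrB (bigD1 i)//=.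
  have : \sum_(j < N | j != i) (d2 j j yp - d2 j j ym) <= 2 * de * N%:R.
    apply: (@le_trans _ _ (\sum_(j < N | j != i) 2 * de)).
      by apply: ler_sum => j _; have [] := testy j.
    apply: (@le_trans _ _ (\sum_(j < N) 2 * de)).
      by rewrite [leRHS](bigD1 i)//= lerDr mulr_ge0// ltW.
    by rewrite sumr_const card_ord mulr_natr.
  by have [_] := testt; clear; lra.
(* The difference of the drift terms is explicit at the maximum and nonnegative. The unbounded
   coefficient [y] therefore does no harm: the drift reinforces the contradiction. *)
have D : \sum_j yp 0 j * d1 j yp - \sum_j ym 0 j * d1 j ym =
    2 * de * sqn ys + ts * (A - 2 * B * ts).
  have [<- _] := testt.
  have -> : 2 * de * sqn ys = \sum_j ys 0 j * (d1 j yp - d1 j ym).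
    rewrite /sqn mulr_sumr; apply: eq_bigr => j _; have [-> _] := testy j; ring.
  have -> : ts * (d1 i yp + d1 i ym) = \sum_j (ts * (j == i)%:R) * (d1 j yp + d1 j ym).
    rewrite (bigD1 i)//= eqxx mulr1 big1 ?addr0// => j /negbTE ->.
    by rewrite mulr0 mul0r.
  rewrite -big_split -sumrB /=; apply: eq_bigr => j _.
  by rewrite !mxE eqxx /=; ring.
have := e yp; have := e ym.
have := fC yp; have := fC ym.
rewrite !ler_norml /f -/a => f1 f2 e1 e2.
have D0 : 0 <= 2 * de * sqn ys + ts * (A - 2 * B * ts).
  apply: addr_ge0; first by rewrite mulr_ge0 ?sqn_ge0// mulr_ge0// ltW.
  have /andP[l0 l1] := ts01.
  apply: mulr_ge0; first exact: ltW.
  have : 0 <= B * (1 - ts) by apply: mulr_ge0; rewrite /B; [clear -Cf0|clear -l1]; lra.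
  by rewrite /A; clear -M0; lra.
have : de * N%:R <= 1 by have := mulr_ge0 (ltW de0) s0; clear -de1 de0; lra.
rewrite /B in L; clear -L D D0 f1 f2 e1 e2; lra.
Qed.

(** * The divergence theorem *)

Lemma measurable_tuple_box (R : realType) (N : nat)
    (A : 'I_N -> set (measurableTypeR R)) : (forall i, measurable (A i)) ->
  measurable [set t : N.-tuple (measurableTypeR R) | forall i, A i (tnth t i)].
Proof.
move=> mA.
have -> : [set t : N.-tuple (measurableTypeR R) | forall i, A i (tnth t i)] =
    \bigcap_(i in [set: 'I_N]) ((fun t => tnth t i) @^-1` A i).
  by apply/seteqP; split => t /= H i => [_|]; [exact: H|exact: (H i Logic.I)].
apply: fin_bigcap_measurable => // i _.
by rewrite -[X in measurable X]setTI; exact: measurable_tnth.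
Qed.

(** Tuples carry the product sigma-algebra, so open sets have to be shown measurable: a superlevel
    set of [f] is the countable union of the cubes with rational centre and radius [1/(k+1)] on
    which [f > r]. *)
Lemma measurable_continuous_row (R : realType) (N : nat) (f : 'rV[R]_N -> R) :
  continuous f ->
  measurable_fun setT (fun t : N.-tuple (measurableTypeR R) => f (tuple_row t)).
Proof.
move=> cf; apply: (measurability _ (RGenOInfty.measurableE R)) => _ [_ [r ->] <-].
rewrite setTI.
pose Q (c : 'rV[rat]_N * nat) (x : 'rV[R]_N) :=
  forall i, `|x 0 i - ratr (c.1 0 i)| < c.2.+1%:R^-1.
pose good (c : 'rV[rat]_N * nat) := forall x, Q c x -> r < f x.
rewrite (_ : _ @^-1` _ = \bigcup_(c : 'rV[rat]_N * nat)
    [set t : N.-tuple (measurableTypeR R) | good c /\ Q c (tuple_row t)]); last first.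
  apply/seteqP; split => [t|t [c _ [gc Qc]]] /=; rewrite in_itv /= andbT; last exact: gc.
  move=> rf.
  have rf0 : 0 < f (tuple_row t) - r by rewrite subr_gt0.
  have [d d0 dP] := near_coord (tuple_row t) cf rf0.
  have d20 : 0 < d / 2 by rewrite divr_gt0.
  have [k kd] : exists k : nat, k.+1%:R^-1 < d / 2.
    by have [k] := ltr_add_invr d20; rewrite add0r => ?; exists k.
  have k0 : 0 < k.+1%:R^-1 :> R by rewrite invr_gt0.
  have /choice[q qP] : forall i, exists c : rat,
      `|tuple_row t 0 i - ratr c| < k.+1%:R^-1.
    move=> i.
    have [|c] := @rat_in_itvoo R (tuple_row t 0 i - k.+1%:R^-1) (tuple_row t 0 i + k.+1%:R^-1).
      by rewrite ltrBlDr -addrA ltrDl addr_gt0.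
    by rewrite in_itv /= => cP; exists c; rewrite ltr_distlC.
  exists (\row_i q i, k) => //=; split => [x|i]; rewrite /Q /= ?mxE//.
    move=> xQ; have : `|f x - f (tuple_row t)| < f (tuple_row t) - r.
      apply: dP => i; have := xQ i; have := qP i.
      rewrite /= mxE; move: kd; move: (k.+1%:R^-1) => e kd.
      rewrite !ltr_norml => /andP[q1 q2] /andP[x1 x2]; apply/andP; split; lra.
    by rewrite ltr_norml; lra.
  by have := qP i; rewrite mxE.
apply: countable_bigcupT_measurable => // c.
have [gc|gc] := pselect (good c); last first.
  rewrite [X in measurable X](_ : _ = set0)//; by apply/seteqP; split => t //= -[].
rewrite [X in measurable X](_ : _ = [set t : N.-tuple (measurableTypeR R) | forall i,
    [set x : R | `|x - ratr (c.1 0 i)| < c.2.+1%:R^-1] (tnth t i)]); last first.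
  apply/seteqP; split => t /=.
    by move=> [_ Qt] i; have := Qt i; rewrite mxE.
  by move=> Qt; split => // i; rewrite mxE; exact: Qt.
apply: (@measurable_tuple_box R N
  (fun i => [set x : R | `|x - ratr (c.1 0 i)| < c.2.+1%:R^-1])) => i.
rewrite [X in measurable X](_ : _ = `](ratr (c.1 0 i) - c.2.+1%:R^-1), (ratr (c.1 0 i) + c.2.+1%:R^-1)[%classic).
  exact: measurable_itv.
by apply/seteqP; split => x /=; rewrite in_itv /= ltr_distl.
Qed.

Lemma lebesgueN_cube (R : realType) (N : nat) (a b : 'I_N -> R) :
  (forall i, a i <= b i) ->
  lebesgueN R N [set t | forall i, a i <= tnth t i <= b i] =
    (\prod_(i < N) (b i - a i))%:E.
Proof.
move=> ab.
have -> : [set t : N.-tuple (measurableTypeR R) | forall i, a i <= tnth t i <= b i] =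
    [set t | forall i, `[a i, b i]%classic (tnth t i)].
  by apply/seteqP; split => t /= h i; have := h i; rewrite in_itv.
rewrite (lebesgueN_box (A := fun i => `[a i, b i]%classic)) => [|i]; last first.
  exact: measurable_itv.
rewrite -prodEFin; apply: eq_bigr => i _; rewrite lebesgue_measure_itv /= lte_fin.
by case: ltgtP (ab i) => // -> _; rewrite subrr.
Qed.

Definition cube (R : realType) (N : nat) (r : R) : set (N.-tuple (measurableTypeR R)) :=
  [set t | forall i, `|tnth t i| <= r].

Lemma measurable_cube (R : realType) (N : nat) (r : R) : measurable (@cube R N r).
Proof.
apply: (@measurable_tuple_box R N (fun=> [set x : R | `|x| <= r])) => i.
rewrite [X in measurable X](_ : _ = `[- r, r]%classic); first exact: measurable_itv.
by apply/seteqP; split => x /=; rewrite in_itv /= ler_norml.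
Qed.

Lemma lebesgueN_cubeE (R : realType) (N : nat) (r : R) : 0 <= r ->
  lebesgueN R N (@cube R N r) = ((2 * r) ^+ N)%:E.
Proof.
move=> r0; rewrite (_ : @cube R N r = [set t | forall i, - r <= tnth t i <= r]).
  rewrite (lebesgueN_cube (a := fun=> - r) (b := fun=> r)) => [|i]; last lra.
  by rewrite prodr_const card_ord; congr ((_ ^+ _)%:E); ring.
by apply/seteqP; split => t /= h i; have := h i; rewrite ler_norml.
Qed.

Lemma cube_integrable (R : realType) (N : nat) (c r : R)
    (G : N.-tuple (measurableTypeR R) -> R) :
  measurable_fun setT G -> (forall t, `|G t| <= c) ->
  (forall t, ~ cube r t -> G t = 0) ->
  (lebesgueN R N).-integrable setT (EFin \o G).
Proof.
move=> mG Gc G0.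
have c0 : 0 <= c by apply: le_trans (Gc [tuple of nseq N 0]).
have -> : EFin \o G = (EFin \o G) \_ (@cube R N r).
  apply/funext => t; rewrite patchE; case: ifPn => //.
  by rewrite notin_setE => /G0 /= ->.
apply/(integrable_mkcond _ (@measurable_cube R N r)).
apply: measurable_bounded_integrable.
- exact: measurable_cube.
- apply: (@le_lt_trans _ _ (lebesgueN R N (@cube R N `|r|))).
    apply: le_measure; rewrite ?inE; try exact: measurable_cube.
    by move=> t rt i; apply: le_trans (rt i) (ler_norm _).
  by rewrite /= lebesgueN_cubeE// ltry.
- exact: measurable_funTS.
- exists c; split; first exact: num_real.
  by move=> x cx t _ /=; apply: le_trans (Gc t) (ltW cx).
Qed.

Definition tuple_set (R : realType) (n : nat) (t : n.-tuple (measurableTypeR R))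
    (i : 'I_n) (x : R) : n.-tuple (measurableTypeR R) :=
  [tuple (if j == i then x else tnth t j) | j < n].

(** Splits off one factor of the product measure. Integrability is delivered together with the
    equality because Fubini's theorem asks for it. *)
Lemma integral_lebesgue_cons (R : realType) (n : nat) (c r : R)
    (G : n.+1.-tuple (measurableTypeR R) -> R) :
  measurable_fun setT G -> (forall t, `|G t| <= c) ->
  (forall t, ~ cube r t -> G t = 0) ->
  (lebesgue_measure \x lebesgueN R n)%E.-integrable setT
    (fun z => (G (tuple_cons z))%:E) /\
  (\int[lebesgueN R n.+1]_t (G t)%:E =
   \int[(lebesgue_measure \x lebesgueN R n)%E]_z (G (tuple_cons z))%:E)%E.
Proof.
move=> mG Gc G0.
have mc := @measurable_tuple_cons R n.
have mC : measurable (@tuple_cons R n @^-1` (@cube R n.+1 r)).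
  by rewrite -[X in measurable X]setTI; apply: mc => //; exact: measurable_cube.
have I : (lebesgue_measure \x lebesgueN R n)%E.-integrable setT
    (fun z => (G (tuple_cons z))%:E).
  have -> : (fun z => (G (tuple_cons z))%:E) =
      (EFin \o (G \o @tuple_cons R n)) \_ (@tuple_cons R n @^-1` (@cube R n.+1 r)).
    apply/funext => z; rewrite patchE; case: ifPn => //.
    by rewrite notin_setE /= => /G0 /= ->.
  apply/(integrable_mkcond _ mC).
  apply: measurable_bounded_integrable => //.
  - apply: (@le_lt_trans _ _ (lebesgueN R n.+1 (@cube R n.+1 `|r|))).
      apply: (@le_trans _ _ (lebesgueN R n.+1 (@cube R n.+1 r))) => //.
      apply: le_measure; rewrite ?inE; try exact: measurable_cube.
      by move=> t rt i; apply: le_trans (rt i) (ler_norm _).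
    by rewrite lebesgueN_cubeE// ltry.
  - by apply: measurable_funTS; exact: measurableT_comp.
  - exists c; split; first exact: num_real.
    by move=> x cx t _ /=; apply: le_trans (Gc _) (ltW cx).
split => //.
have /measurable_EFinP mEG := mG.
exact: (@integral_pushforward _ _ _ _ R _ mc (lebesgue_measure \x lebesgueN R n)%E setT _ mEG I measurableT).
Qed.

(** Fubini in the order suited to the position of [i]: if [i] is the head coordinate it is
    integrated first; otherwise the head is frozen and the induction hypothesis applies to the
    tail. *)
Lemma integral_lebesgueN_line0 (R : realType) (n : nat) (i : 'I_n) (c r : R)
    (G : n.-tuple (measurableTypeR R) -> R) :
  measurable_fun setT G -> (forall t, `|G t| <= c) ->
  (forall t, ~ cube r t -> G t = 0) ->
  (forall t, \int[lebesgue_measure]_x (G (tuple_set t i x))%:E = 0)%E ->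
  (\int[lebesgueN R n]_t (G t)%:E = 0)%E.
Proof.
elim: n i G => [[]//|n IH] i G mG Gc G0 Gl.
have [I ->] := integral_lebesgue_cons mG Gc G0.
have mGc : measurable_fun setT (G \o @tuple_cons R n).
  by apply: measurableT_comp => //; exact: measurable_tuple_cons.
case: (unliftP ord0 i) => [j|] iE.
- rewrite -(integral12_prod_meas1 I) /fubini_F.
  apply: integral0_eq => x _.
  apply: (IH j (fun t => G (tuple_cons (x, t)))).
  + exact: (measurableT_comp mGc (measurable_pair1 _)).
  + by move=> t; exact: Gc.
  + move=> t ct; apply: G0 => cG; apply: ct => k.
    by have := cG (lift ord0 k); rewrite tnthS.
  + move=> t; rewrite -[RHS](Gl (tuple_cons (x, t))); apply: eq_integral => s _.
    congr (G _)%:E; apply: eq_from_tnth => k; rewrite iE tnth_mktuple.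
    case: (unliftP ord0 k) => [l ->|->]; last by rewrite !tnth0.
    by rewrite !tnthS tnth_mktuple (inj_eq lift_inj).
- rewrite -(integral21_prod_meas1 I) /fubini_G.
  apply: integral0_eq => t _.
  rewrite -[RHS](Gl (tuple_cons (0, t))); apply: eq_integral => s _.
  congr (G _)%:E; apply: eq_from_tnth => k; rewrite iE tnth_mktuple.
  case: (unliftP ord0 k) => [l ->|->]; last by rewrite !tnth0 eqxx.
  by rewrite !tnthS eq_sym (negbTE (neq_lift _ _)).
Qed.

Lemma integral_derive_compact (R : realType) (F G : R -> R) (r : R) :
  (forall x : R, is_derive x 1 F (G x)) -> continuous G ->
  (forall x, r < `|x| -> F x = 0 /\ G x = 0) ->
  (\int[lebesgue_measure]_x (G x)%:E = 0)%E.
Proof.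
move=> FG cG F0.
pose s : R := `|r| + 1.
have rs : r < s by rewrite /s; have := ler_norm r; lra.
have s0 : 0 < s by rewrite /s; have := normr_ge0 r; lra.
have -> : (\int[lebesgue_measure]_x (G x)%:E =
    \int[lebesgue_measure]_(x in `[(- s)%R, s]) (G x)%:E)%E.
  rewrite [RHS]integral_mkcond; apply: eq_integral => x _.
  rewrite patchE; case: ifPn => //; rewrite notin_setE /= in_itv /= -ler_norml.
  by move/negP; rewrite -ltNge => sx; have [_ ->] := F0 x (lt_trans rs sx).
rewrite (@continuous_FTC2 _ G F).
- have [-> _] : F s = 0 /\ G s = 0 by apply: F0; rewrite gtr0_norm.
  have [-> _] : F (- s) = 0 /\ G (- s) = 0 by apply: F0; rewrite normrN gtr0_norm.
  by rewrite sube0.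
- lra.
- exact: continuous_subspaceT.
- split.
  + by move=> x _.
  + by apply: cvg_at_right_filter; exact: der_continuous (FG _).
  + by apply: cvg_at_left_filter; exact: der_continuous (FG _).
- by move=> x _; rewrite derive1E; have [_ ->] := FG x.
Qed.

Definition csupp (R : realType) (N : nat) (r : R) (f : 'rV[R]_N -> R) : Prop :=
  continuous f /\ forall y, r ^+ 2 < sqn y -> f y = 0.

Lemma sqn_gt (R : realType) (N : nat) (r : R) (y : 'rV[R]_N) (i : 'I_N) :
  0 <= r -> r < `|y 0 i| -> r ^+ 2 < sqn y.
Proof.
move=> r0 ry; apply: lt_le_trans (sqn_ge_coord y i).
by rewrite -(real_normK (num_real (y 0 i))) ltr_pXn2r// nnegrE.
Qed.

Lemma csupp_bounded (R : realType) (N : nat) (r : R) (f : 'rV[R]_N -> R) :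
  0 <= r -> csupp r f -> exists c : R, forall y, `|f y| <= c.
Proof.
move=> r0 [cf f0].
pose B := [set y : 'rV[R]_N | forall i, `|y 0 i| <= r].
have B0 : B !=set0 by exists 0 => i; rewrite mxE normr0.
have cB : compact B by exact: box_compact.
have cn : continuous (fun y => `|f y|) by apply: (cont_comp cf); exact: norm_continuous.
have [c _ cP] := compact_EVT_max B0 cB (continuous_subspaceT cn).
exists `|f c| => y; have [By|nBy] := pselect (B y); first by apply: cP; rewrite inE.
have /existsNP[i /negP] := nBy; rewrite -ltNge => ri.
by rewrite f0 ?normr0// (sqn_gt r0 ri).
Qed.

Lemma csupp_row0 (R : realType) (N : nat) (r : R) (f : 'rV[R]_N -> R)
    (t : N.-tuple (measurableTypeR R)) :
  0 <= r -> csupp r f -> ~ cube r t -> f (tuple_row t) = 0.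
Proof.
move=> r0 [cf f0] /existsNP[i /negP]; rewrite -ltNge => ri.
by apply: f0; apply: (@sqn_gt _ _ _ _ i) => //; rewrite mxE.
Qed.

Lemma csupp_integrable (R : realType) (N : nat) (r : R) (f : 'rV[R]_N -> R) :
  0 <= r -> csupp r f ->
  (lebesgueN R N).-integrable setT (fun t => (f (tuple_row t))%:E).
Proof.
move=> r0 cf; have [c fc] := csupp_bounded r0 cf.
apply: (@cube_integrable R N c r (fun t => f (tuple_row t))).
- exact: measurable_continuous_row cf.1.
- by move=> t; exact: fc.
- by move=> t; exact: csupp_row0.
Qed.

Lemma integral_partial_csupp (R : realType) (N : nat) (r : R) (i : 'I_N)
    (F G : 'rV[R]_N -> R) : 0 <= r -> csupp r F -> csupp r G ->
  (forall y, is_derive y (delta_mx 0 i) F (G y)) ->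
  (\int[lebesgueN R N]_t (G (tuple_row t))%:E = 0)%E.
Proof.
move=> r0 cF cG FG; have [c Gc] := csupp_bounded r0 cG.
apply: (@integral_lebesgueN_line0 R N i c r (fun t => G (tuple_row t))).
- exact: measurable_continuous_row cG.1.
- by move=> t; exact: Gc.
- by move=> t; exact: csupp_row0.
move=> t; pose ei : 'rV[R]_N := delta_mx 0 i.
pose y0 := tuple_row t - tnth t i *: ei.
have E x : tuple_row (tuple_set t i x) = y0 + x *: ei.
  apply/rowP => j; rewrite !mxE tnth_mktuple /=.
  by case: eqVneq => [->|_]; rewrite /= ?mulr1 ?mulr0; ring.
have y0i x : (y0 + x *: ei) 0 i = x by rewrite !mxE !eqxx /=; ring.
under eq_integral do rewrite E.
apply: (@integral_derive_compact R (fun x => F (y0 + x *: ei))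
    (fun x => G (y0 + x *: ei)) r).
- by move=> x; apply: der_line; exact: FG.
- apply: (cont_comp (f := fun x : R => y0 + x *: ei)); last exact: cG.1.
  move=> x; apply: cvgD; first exact: cvg_cst.
  by apply: cvgZ; [exact: cvg_id|exact: cvg_cst].
- move=> x rx.
  have s : r ^+ 2 < sqn (y0 + x *: ei) by apply: (@sqn_gt _ _ _ _ i) => //; rewrite y0i.
  by rewrite (cF.2 _ s) (cG.2 _ s).
Qed.

Lemma integral_div_csupp (R : realType) (N : nat) (r : R)
    (F G : 'I_N -> 'rV[R]_N -> R) : 0 <= r ->
  (forall i, csupp r (F i)) -> (forall i, csupp r (G i)) ->
  (forall i y, is_derive y (delta_mx 0 i) (F i) (G i y)) ->
  (\int[lebesgueN R N]_t (\sum_i G i (tuple_row t))%:E = 0)%E.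
Proof.
move=> r0 cF cG FG.
under eq_integral do rewrite -sumEFin.
rewrite integral_sum//=.
  by apply: big1 => i _; exact: (integral_partial_csupp r0 (cF i) (cG i) (FG i)).
by move=> i; exact: csupp_integrable r0 (cG i).
Qed.

(** * Vanishing at infinity *)

Lemma dominated_integral_lt (d : measure_display) (T : measurableType d)
    (R : realType) (mu : {measure set T -> \bar R}) (g : T -> R)
    (f : nat -> T -> R) (e : R) :
  measurable_fun setT g -> (\int[mu]_x (g x)%:E < +oo)%E ->
  (forall n, measurable_fun setT (f n)) ->
  (forall n x, 0 <= f n x <= g x) ->
  (forall x, f n x @[n --> \oo] --> (0 : R)) -> 0 < e ->
  exists k, forall n, (k <= n)%N -> (\int[mu]_x (f n x)%:E < e%:E)%E.
Proof.
move=> mg ig mf fg f0 e0.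
have Ig : mu.-integrable setT (EFin \o g).
  apply/integrableP; split; first exact/measurable_EFinP.
  apply: le_lt_trans ig; rewrite le_eqVlt; apply/orP; left; apply/eqP.
  apply: eq_integral => x _ /=; rewrite ger0_norm//.
  by have /andP[h1 h2] := fg 0%N x; exact: le_trans h1 h2.
have [] := @dominated_convergence _ T R mu setT measurableT
    (fun n x => (f n x)%:E) (cst 0%E) (EFin \o g) _ _ _ Ig _.
- by move=> n; exact/measurable_EFinP.
- by [].
- by apply: aeW => x _; apply: cvg_EFin; [exact: nearW|exact: f0].
- apply: aeW => x n _ /=; rewrite lee_fin ger0_norm; first by have /andP[] := fg n x.
  by have /andP[] := fg n x.
rewrite integral0 => _ _ /fine_cvgP[_]; move/cvgrPdist_lt => /(_ _ e0).
move=> [k _ kP]; exists k => n kn.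
have := kP n kn; rewrite /= sub0r normrN.
have fn : (\int[mu]_x (f n x)%:E)%E \is a fin_num.
  rewrite ge0_fin_numE; last by apply: integral_ge0 => x _; rewrite lee_fin; have /andP[] := fg n x.
  apply: le_lt_trans ig; apply: ge0_le_integral => //.
  - by move=> x _; rewrite lee_fin; have /andP[] := fg n x.
  - exact/measurable_EFinP.
  - exact/measurable_EFinP.
  - by move=> x _; rewrite lee_fin; have /andP[] := fg n x.
by move=> /(le_lt_trans (ler_norm _)); rewrite -lte_fin fineK.
Qed.

Lemma integral_scale_indic (d : measure_display) (T : measurableType d)
    (R : realType) (mu : {measure set T -> \bar R}) (k : R) (A : set T) :
  0 <= k -> measurable A -> (\int[mu]_t (k * \1_A t)%:E = k%:E * mu A)%E.
Proof.
move=> k0 mA; under eq_integral do rewrite EFinM.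
rewrite ge0_integralZl_EFin//.
- by rewrite integral_indic// setIT.
- by apply/measurable_EFinP; exact: measurable_indic.
Qed.

(** A derivative larger than [A / 2] at [y] stays so nearby by continuity, and the mean value
    theorem on a short centered segment contradicts [centered_difference_le]. The other sign follows
    by oddness. *)
Lemma profile_gradient_bounded (R : realType) (N : nat) (p M : R)
    (phi : 'rV[R]_N -> R) (d1 : 'I_N -> 'rV[R]_N -> R)
    (d2 : 'I_N -> 'I_N -> 'rV[R]_N -> R) :
  profile p phi d1 d2 -> (forall y, `|phi y| <= M) -> 1 < p ->
  exists2 L : R, 0 <= L & forall i y, `|d1 i y| <= L.
Proof.
have key (psi : 'rV[R]_N -> R) (e1 : 'I_N -> 'rV[R]_N -> R)
    (e2 : 'I_N -> 'I_N -> 'rV[R]_N -> R) :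
    profile p psi e1 e2 -> (forall y, `|psi y| <= M) -> 1 < p ->
    exists A : R, forall i y, e1 i y <= A.
  move=> prf psiM p1; have [A AP] := centered_difference_le prf psiM p1.
  have [h1 _ _ c1 _ _] := prf.
  exists (A / 2) => i y; rewrite leNgt; apply/negP => ltA.
  have e0 : 0 < e1 i y - A / 2 by rewrite subr_gt0.
  have [d d0 dP] := near_coord y (c1 i) e0.
  pose t := Num.min (d / 2) 1.
  have t0 : 0 < t by rewrite lt_min ltr01 andbT; lra.
  have t1 : t <= 1 by rewrite ge_min lexx orbT.
  have td : t <= d / 2 by rewrite ge_min lexx.
  pose ei : 'rV[R]_N := delta_mx 0 i.
  have h0 : 0 < 2 * t by lra.
  have [s sh E] := MVT_line (y - t *: ei) (h1 i) h0.
  have := AP i y t; rewrite -/ei (_ : 0 <= t <= 1); last by apply/andP; split; lra.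
  move=> /(_ isT).
  have -> : y + t *: ei = y - t *: ei + (2 * t) *: ei.
    by rewrite -addrA -scaleNr -scalerDl; congr (_ + _ *: _); ring.
  rewrite E => le1.
  have : `|e1 i (y - t *: ei + s *: ei) - e1 i y| < e1 i y - A / 2.
    apply: dP => k; rewrite !mxE eqxx /=.
    have -> : y 0 k - t * (k == i)%:R + s * (k == i)%:R - y 0 k = (s - t) * (k == i)%:R by ring.
    by case: (k == i); rewrite ?mulr1 ?mulr0 ?normr0// ltr_norml; lra.
  rewrite ltr_norml => /andP[lt1 _].
  have : A / 2 * (2 * t) < e1 i (y - t *: ei + s *: ei) * (2 * t).
    by rewrite ltr_pM2r//; lra.
  by lra.
move=> prf phiM p1.
have [A AP] := key _ _ _ prf phiM p1.
have [|B BP] := key _ _ _ (profileN prf) _ p1; first by move=> y; rewrite normrN.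
exists (`|A| + `|B|); first by rewrite addr_ge0.
move=> i y; have := AP i y; have := BP i y; have := ler_norm A; have := ler_norm B.
have := normr_ge0 A; have := normr_ge0 B; rewrite ler_norml; lra.
Qed.

(** Coordinates are changed one at a time, through the points [h k], because only partial
    derivatives are at hand; hence the sum of coordinate distances. *)
Lemma partial_lipschitz (R : realType) (N : nat) (L : R) (f : 'rV[R]_N -> R)
    (d1 : 'I_N -> 'rV[R]_N -> R) :
  (forall i y, is_derive y (delta_mx 0 i) f (d1 i y)) ->
  (forall i y, `|d1 i y| <= L) ->
  forall x y, `|f x - f y| <= L * \sum_i `|x 0 i - y 0 i|.
Proof.
move=> fd dL x y.
have line (i : 'I_N) (z : 'rV[R]_N) (t : R) :
    `|f (z + t *: delta_mx 0 i) - f z| <= L * `|t|.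
  pose ei : 'rV[R]_N := delta_mx 0 i.
  have pos (w : 'rV[R]_N) (h : R) : 0 < h -> `|f (w + h *: ei) - f w| <= L * h.
    move=> h0; have [s sh ->] := MVT_line w (fd i) h0.
    by rewrite normrM (gtr0_norm h0) ler_pM2r.
  have [t0|t0|->] := ltgtP t 0; last by rewrite scale0r addr0 subrr !normr0 mulr0.
    rewrite distrC (ltr0_norm t0).
    have := pos (z + t *: ei) (- t); rewrite oppr_gt0 => /(_ t0).
    by rewrite -addrA -scalerDl subrr scale0r addr0.
  by rewrite (gtr0_norm t0); exact: pos.
pose h (k : nat) : 'rV[R]_N := \row_i (if (i < k)%N then x 0 i else y 0 i).
have key k : (k <= N)%N ->
    `|f (h k) - f y| <= L * \sum_(i < N | (i < k)%N) `|x 0 i - y 0 i|.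
  elim: k => [_|k IH kN].
    rewrite (_ : h 0%N = y); last by apply/rowP => i; rewrite mxE ltn0.
    by rewrite subrr normr0 big1 ?mulr0.
  pose i := Ordinal kN.
  have hS : h k.+1 = h k + (x 0 i - y 0 i) *: delta_mx 0 i.
    apply/rowP => j; rewrite !mxE eqxx /= ltnS leq_eqVlt.
    have -> : (j == i) = (j == k :> nat) by [].
    case: eqVneq => [jk|_] /=; last by rewrite mulr0 addr0.
    have -> : j = i by apply/val_inj.
    by rewrite ltnn mulr1 addrC subrK.
  rewrite (bigD1 i)//= mulrDr [leRHS]addrC.
  rewrite (_ : f (h k.+1) - f y = (f (h k) - f y) + (f (h k.+1) - f (h k))); last by ring.
  apply: le_trans (ler_normD _ _) _; apply: lerD.
    apply: le_trans (IH (ltnW kN)) _; rewrite le_eqVlt; apply/orP; left; apply/eqP.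
    congr (_ * _); apply: eq_bigl => j.
    by rewrite ltnS -val_eqE /= andbC ltn_neqAle.
  by rewrite hS; exact: line.
have hN : h N = x by apply/rowP => i; rewrite mxE ltn_ord.
have := key N (leqnn _); rewrite hN => /le_trans; apply.
by rewrite le_eqVlt; apply/orP; left; apply/eqP; congr (_ * _); apply: eq_bigl => i; rewrite ltn_ord.
Qed.

Lemma measurable_abs_powR (d : measure_display) (T : measurableType d)
    (R : realType) (q : R) (f : T -> R) :
  measurable_fun setT f -> measurable_fun setT (fun t => `|f t| `^ q).
Proof.
move=> mf.
exact: (measurableT_comp (measurable_powR q)
  (measurableT_comp (@normr_measurable R setT) mf)).
Qed.

Lemma in_Lq_tail (R : realType) (N : nat) (q e : R) (f : 'rV[R]_N -> R) :
  continuous f -> in_Lq q f -> 0 < e ->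
  exists k : nat, (\int[lebesgueN R N]_t
    (`|f (tuple_row t)| `^ q * \1_(~` cube k%:R) t)%:E < e%:E)%E.
Proof.
move=> cf Lf e0.
have mf : measurable_fun setT
    (fun t : N.-tuple (measurableTypeR R) => `|f (tuple_row t)| `^ q).
  by apply: measurable_abs_powR; exact: measurable_continuous_row.
have [||||k kP] := @dominated_integral_lt _ _ R (lebesgueN R N)
    (fun t => `|f (tuple_row t)| `^ q)
    (fun k t => `|f (tuple_row t)| `^ q * \1_(~` @cube R N k%:R) t) e mf Lf.
- move=> k; apply: measurable_funM => //; apply: measurable_indic.
  by apply: measurableC; exact: measurable_cube.
- move=> k t; rewrite indicE; case: (t \in _); rewrite ?mulr1 ?mulr0 ?lexx powR_ge0//.
- move=> t.
  have [K KP] : exists K : nat, forall i, `|tnth t i| <= K%:R.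
    exists (\sum_(i < N) (Num.truncn `|tnth t i|).+1)%N => i.
    rewrite (bigD1 i)//= natrD; apply: (le_trans (ltW (truncnS_gt _))).
    by rewrite lerDl.
  apply: cvg_near_cst; exists K => // k /= Kk.
  rewrite indicE memNset ?mulr0// => nc; apply: nc => i.
  by apply: le_trans (KP i) _; rewrite ler_nat.
- by [].
by exists k; exact: kP.
Qed.

(** A value above [e] at a remote point persists, by the Lipschitz bound, as a value above [e / 2]
    on a cube of fixed size. That cube would carry the fixed amount [kap] of an integral whose tails
    are arbitrarily small. *)
Lemma in_Lq_vanishing (R : realType) (N : nat) (q L e : R) (f : 'rV[R]_N -> R) :
  0 < q -> continuous f ->
  (forall x y, `|f x - f y| <= L * \sum_i `|x 0 i - y 0 i|) ->
  in_Lq q f -> 0 < e -> exists r : R, forall y, r <= sqn y -> `|f y| <= e.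
Proof.
move=> q0 cf Lip Lf e0.
pose L' : R := `|L| + 1.
have L'0 : 0 < L' by rewrite /L'; have := normr_ge0 L; lra.
pose d := Num.min 1 (e / (2 * L' * (N%:R + 1))).
have N0 : 0 <= N%:R :> R by [].
have dd0 : 0 < 2 * L' * (N%:R + 1) by apply: mulr_gt0; lra.
have d0 : 0 < d by rewrite lt_min ltr01 divr_gt0.
have dP : L' * (N%:R * d) <= e / 2.
  have : d <= e / (2 * L' * (N%:R + 1)) by rewrite ge_min lexx orbT.
  rewrite ler_pdivlMr// => h.
  have : 0 <= L' * d by rewrite mulr_ge0// ltW.
  by lra.
have d1 : d <= 1 by rewrite ge_min lexx.
have near_le (x y : 'rV[R]_N) : (forall i, `|x 0 i - y 0 i| <= d) -> `|f y| - e / 2 <= `|f x|.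
  move=> xy; have : `|f x - f y| <= e / 2.
    apply: le_trans (Lip x y) _; apply: le_trans dP.
    have sd : \sum_i `|x 0 i - y 0 i| <= N%:R * d.
      apply: (@le_trans _ _ (\sum_(i < N) d)); first exact: ler_sum.
      by rewrite sumr_const card_ord mulr_natl.
    apply: (@le_trans _ _ (L' * \sum_i `|x 0 i - y 0 i|)).
      apply: ler_wpM2r; first by apply: sumr_ge0.
      by rewrite /L'; have := ler_norm L; lra.
    by rewrite ler_pM2l.
  have := lerB_dist (f y) (f x); rewrite (distrC (f y)) => h1 h2.
  by lra.
pose kap := (e / 2) `^ q * (2 * d) ^+ N.
have kap0 : 0 < kap by rewrite mulr_gt0 ?powR_gt0 ?exprn_gt0//; lra.
have [k kP] := in_Lq_tail cf Lf kap0.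
exists (N%:R * (k%:R + 1 + 1) ^+ 2 + 1) => y ry; rewrite leNgt; apply/negP => fy.
(* One coordinate beyond [k + 1] suffices: since [d <= 1], the whole cube of half-side [d] around
   [y] then lies outside [cube k]. *)
have [i ki] : exists i : 'I_N, k%:R + 1 < `|y 0 i|.
  apply: contrapT => /forallNP h.
  have : sqn y <= N%:R * (k%:R + 1 + 1) ^+ 2.
    apply: (@le_trans _ _ (\sum_(i < N) (k%:R + 1 + 1) ^+ 2)).
      apply: ler_sum => i _; rewrite -(real_normK (num_real (y 0 i))).
      have /negP := h i; rewrite -leNgt => hi.
      have k0 : 0 <= k%:R :> R by [].
      by rewrite lerXn2r ?nnegrE//; lra.
    by rewrite sumr_const card_ord mulr_natl.
  by lra.
pose C := [set t : N.-tuple (measurableTypeR R) | forall j, y 0 j - d <= tnth t j <= y 0 j + d].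
have mC : measurable C.
  apply: (@measurable_tuple_box R N (fun j => [set x : R | y 0 j - d <= x <= y 0 j + d])) => j.
  rewrite [X in measurable X](_ : _ = `[y 0 j - d, y 0 j + d]%classic); first exact: measurable_itv.
  by apply/seteqP; split => x /=; rewrite in_itv.
have vC : lebesgueN R N C = ((2 * d) ^+ N)%:E.
  rewrite (@lebesgueN_cube R N (fun j => y 0 j - d) (fun j => y 0 j + d)); last first.
    by move=> j; lra.
  rewrite (eq_bigr (fun=> 2 * d)) => [|j _]; last by ring.
  by rewrite prodr_const card_ord.
have : (kap%:E <= \int[lebesgueN R N]_t
    (`|f (tuple_row t)| `^ q * \1_(~` cube k%:R) t)%:E)%E.
  have -> : (kap%:E = \int[lebesgueN R N]_t ((e / 2) `^ q * \1_C t)%:E)%E.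
    rewrite integral_scale_indic ?powR_ge0// /kap EFinM.
    by congr (_ * _)%E; exact/esym.
  apply: ge0_le_integral => //.
  - by move=> t _; rewrite lee_fin mulr_ge0 ?powR_ge0.
  - by apply/measurable_EFinP; apply: measurable_funM => //; exact: measurable_indic.
  - apply/measurable_EFinP; apply: measurable_funM.
      by apply: measurable_abs_powR; exact: measurable_continuous_row.
    by apply: measurable_indic; apply: measurableC; exact: measurable_cube.
  - move=> t _; rewrite lee_fin !indicE.
    have [tC|tC] := boolP (t \in C); last by rewrite mulr0 mulr_ge0 ?powR_ge0.
    move: tC; rewrite inE => tC.
    rewrite mem_set; last first.
      move=> /(_ i); have := tC i; move: ki; rewrite !ler_norml => k1 k2 k3.
      move: k1; rewrite ltNge => /negP; apply; rewrite ler_norml; lra.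
    have h : `|f y| - e / 2 <= `|f (tuple_row t)|.
      by apply: near_le => j; have := tC j; rewrite mxE ler_norml; lra.
    by rewrite !mulr1; apply: ge0_ler_powR; rewrite ?nnegrE//; lra.
by move=> /le_lt_trans/(_ kP); rewrite ltxx.
Qed.

(** * Decay at infinity *)

Lemma powR_sub1 (R : realType) (x s : R) : 0 < x -> x `^ (s - 1) = x `^ s / x.
Proof.
move=> x0; rewrite powRD; last by rewrite (gt_eqF x0) implybT.
by rewrite powR_inv1// ltW.
Qed.

Lemma powR_mulr_sub (R : realType) (x p : R) : 0 <= x -> 1 < p ->
  x `^ (p - 1) * x = x `^ p.
Proof.
move=> x0 p1; have [->|xn0] := eqVneq x 0.
  by rewrite mulr0 powR0// gt_eqF//; lra.
by rewrite powR_sub1 ?lt_def ?xn0// divfK.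
Qed.

Lemma der_powR (R : realType) (s x : R) : 0 < x ->
  is_derive x 1 (fun y => y `^ s) (s * x `^ (s - 1)).
Proof. exact: is_derive1_powR. Qed.

Lemma powR_mulr_lip (R : realType) (p b x e : R) : 1 < p ->
  0 < b -> b <= x -> x <= e ->
  x `^ (p - 1) * x - b `^ (p - 1) * b <= p * e `^ (p - 1) * (x - b).
Proof.
move=> p1 b0 bx xe.
rewrite !powR_mulr_sub//; try lra.
have fd (y : R) : y \in `]b, x[%R -> is_derive y 1 (fun y => y `^ p) (p * y `^ (p - 1)).
  by rewrite in_itv /= => /andP[by1 _]; apply: der_powR; lra.
have fc : {within `[b, x], continuous (fun y : R => y `^ p)}.
  apply: continuous_in_subspaceT => y; rewrite inE /= in_itv /= => /andP[by1 _].
  by apply: (@der_continuous _ _ _ (p * y `^ (p - 1))); apply: der_powR; lra.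
have [c] := MVT_segment bx fd fc.
rewrite in_itv /= => /andP[bc cx] ->.
apply: ler_wpM2r; first lra.
rewrite ler_pM2l; last lra.
by apply: ge0_ler_powR; rewrite ?nnegrE; lra.
Qed.

(** On functions [b] of [z], drift and linear term act as [- z b' - a b], which annihilates [z^-a].
    The correction makes this equal to [- C (S/2) z^(-a-1)], a strictly negative term that absorbs
    both the Laplacian and the nonlinearity. *)
Definition barrier (R : realType) (a S C z : R) : R := C * (z `^ (- a) - S / 2 * z `^ (- a - 1)).

Definition barrier1 (R : realType) (a S C z : R) : R :=
  C * (- a * z `^ (- a - 1) - S / 2 * ((- a - 1) * z `^ (- a - 1 - 1))).

Definition barrier2 (R : realType) (a S C z : R) : R :=
  C * (- a * ((- a - 1) * z `^ (- a - 1 - 1)) -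
  S / 2 * ((- a - 1) * ((- a - 1 - 1) * z `^ (- a - 1 - 1 - 1)))).

Lemma der_barrier (R : realType) (a S C z : R) :
  0 < z -> is_derive z 1 (barrier a S C) (barrier1 a S C z).
Proof.
move=> z0; apply: (@der_val _ _ _ _ _ (0 * (z `^ (- a) - S / 2 * z `^ (- a - 1)) +
  C * (- a * z `^ (- a - 1) - (0 * z `^ (- a - 1) + S / 2 * ((- a - 1) * z `^ (- a - 1 - 1))))));
  last by rewrite /barrier1; ring.
have := der_powR (- a) z0; have := der_powR (- a - 1) z0 => q1 q2.
apply: derM; try exact: derC.
apply: derB => //; apply: derM; exact: derC.
Qed.

Lemma der_barrier1 (R : realType) (a S C z : R) :
  0 < z -> is_derive z 1 (barrier1 a S C) (barrier2 a S C z).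
Proof.
move=> z0; have q1 := der_powR (- a - 1) z0; have q2 := der_powR (- a - 1 - 1) z0.
apply: (@der_val _ _ _ _ _ (0 * (- a * z `^ (- a - 1) - S / 2 * ((- a - 1) * z `^ (- a - 1 - 1))) +
  C * ((0 * z `^ (- a - 1) + - a * ((- a - 1) * z `^ (- a - 1 - 1))) -
   (0 * ((- a - 1) * z `^ (- a - 1 - 1)) + S / 2 * (0 * z `^ (- a - 1 - 1) +
      (- a - 1) * ((- a - 1 - 1) * z `^ (- a - 1 - 1 - 1)))))));
  last by rewrite /barrier2; ring.
apply: derM; try exact: derC.
apply: derB; apply: derM; try exact: derC => //.
by apply: derM; try exact: derC.
Qed.

Lemma barrier_le (R : realType) (a S C z : R) : 0 < C -> 0 <= S ->
  barrier a S C z <= C * z `^ (- a).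
Proof.
move=> C0 S0.
by rewrite /barrier ler_pM2l// lerBlDr lerDl mulr_ge0 ?powR_ge0//; lra.
Qed.

Lemma barrier_gt0 (R : realType) (a S C z : R) : 0 < C -> 0 < S -> S <= z ->
  0 < barrier a S C z.
Proof.
move=> C0 S0 Sz; rewrite /barrier mulr_gt0//.
have z0 : 0 < z by lra.
rewrite powR_sub1// subr_gt0.
rewrite (_ : S / 2 * (z `^ (- a) / z) = z `^ (- a) * (S / (2 * z))); last by field; lra.
rewrite gtr_pMr ?powR_gt0// ltr_pdivrMr; lra.
Qed.

(** The normalization [C = E S^a] makes the barrier on [z = S] equal to the bound [E / 2] that the
    solution satisfies there. *)
Lemma barrier_boundary (R : realType) (a S E : R) : 0 < S ->
  barrier a S (E * S `^ a) S = E / 2.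
Proof.
move=> S0.
have q : S `^ a * S `^ (- a) = 1.
  by rewrite -powRD ?subrr ?powRr0// (gt_eqF S0) implybT.
rewrite /barrier powR_sub1//.
rewrite (_ : E * S `^ a * _ = E * (S `^ a * S `^ (- a)) / 2); last by field; lra.
by rewrite q mulr1.
Qed.

(** At a contact point the derivatives are those of the barrier, but the zeroth-order terms are
    taken at the value [x] of the solution. Since [p * eta <= a], replacing [x] by the smaller
    barrier value can only increase them. Of the gain [C (S/2) z^(-a-1)], one half pays for the
    nonlinearity and the other, as [S] is large, for the second-order terms. *)
Lemma barrier_strict (R : realType) (p a E S C n eta x z : R) :
  1 < p -> 0 < a -> a * (p - 1) = 1 -> 0 < E -> 0 < S -> C = E * S `^ a ->
  0 <= n -> S <= z -> 0 < eta ->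
  eta <= 1 / 4 -> p * eta <= a -> E `^ (p - 1) = eta ->
  1 + 16 * a * (a + 1) + 4 * n * (a + 1) <= S ->
  barrier a S C z < x -> x <= E / 2 ->
  2 * n * barrier1 a S C z + 4 * z * barrier2 a S C z - z * barrier1 a S C z
    + x `^ (p - 1) * x - a * x < 0.
Proof.
move=> p1 a0 ap E0 S0 CE n0 Sz eta0 eta1 eta2 EE Sn Bx xE.
have C0 : 0 < C by rewrite CE mulr_gt0// powR_gt0.
have B0 := barrier_gt0 a C0 S0 Sz; have BC := barrier_le a z C0 (ltW S0).
have z0 : 0 < z by lra.
have zn0 : z != 0 by rewrite gt_eqF.
pose be := z `^ (- a).
have be0 : 0 < be by rewrite powR_gt0.
have pw1 : z `^ (- a - 1) = be / z by rewrite powR_sub1.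
have pw2 : z `^ (- a - 1 - 1) = be / z / z by rewrite powR_sub1// pw1.
have pw3 : z `^ (- a - 1 - 1 - 1) = be / z / z / z by rewrite powR_sub1// pw2.
pose ka := be / z.
have ka0 : 0 < ka by rewrite divr_gt0.
have bez : be = ka * z by rewrite /ka divfK.
have kz0 : 0 < ka / z by rewrite divr_gt0.
have Ska : S * (ka / z) <= ka.
  have -> : S * (ka / z) = S / z * ka by ring.
  by rewrite ger_pMl// ler_pdivrMr// mul1r.
have Cka : 0 < C * ka by rewrite mulr_gt0.
have E1 : z * barrier1 a S C z = - a * barrier a S C z + C * (S / 2) * ka.
  by rewrite /barrier1 /barrier pw1 pw2 -/ka -/be bez; clear -zn0; field.
have E2 : 2 * n * barrier1 a S C z <= C * ka * (n * (a + 1)).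
  have -> : 2 * n * barrier1 a S C z = C * n * (S * (ka / z) * (a + 1)) - 2 * (C * ka * (n * a)).
    by rewrite /barrier1 pw1 pw2 -/ka; clear -zn0; field.
  have h3 : 0 <= C * ka * (n * a).
    by apply: mulr_ge0; [exact: ltW|apply: mulr_ge0 => //; exact: ltW].
  have h4 : C * n * (S * (ka / z) * (a + 1)) <= C * n * (ka * (a + 1)).
    apply: ler_wpM2l; first by rewrite mulr_ge0// ltW.
    by apply: ler_wpM2r => //; clear -a0; lra.
  by clear -h3 h4; lra.
have E3 : z * barrier2 a S C z <= C * ka * (a * (a + 1)).
  have -> : z * barrier2 a S C z = C * ka * (a * (a + 1)) - C * (S * (ka / z)) * ((a + 1) * (a + 2)) / 2.
    by rewrite /barrier2 pw2 pw3 -/ka; clear -zn0; field.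
  have h : 0 <= C * (S * (ka / z)) * ((a + 1) * (a + 2)).
    apply: mulr_ge0; last by apply: mulr_ge0; clear -a0; lra.
    by apply: mulr_ge0; [exact: ltW|apply: mulr_ge0; exact: ltW].
  by clear -h; lra.
have E4 : eta * S * C * ka <= C * ka * (S / 4).
  rewrite (_ : eta * S * C * ka = C * ka * (eta * S)); last by ring.
  apply: ler_wpM2l; first exact: ltW.
  by have h := ler_wpM2r (ltW S0) eta1; clear -h; lra.
have E5 : 0 < C * ka * (S / 4 - 4 * (a * (a + 1)) - n * (a + 1)).
  by apply: mulr_gt0 => //; clear -Sn; lra.
have lip : x `^ (p - 1) * x - barrier a S C z `^ (p - 1) * barrier a S C z <= a * (x - barrier a S C z).
  have h0 : 0 < E / 2 by clear -E0; lra.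
  apply: le_trans (powR_mulr_lip p1 B0 (ltW Bx) xE) _.
  apply: ler_wpM2r; first by rewrite subr_ge0 ltW.
  apply: le_trans eta2; rewrite ler_pM2l; last by clear -p1; lra.
  rewrite -EE; apply: ge0_ler_powR; rewrite ?nnegrE; clear -p1 E0; lra.
have Cbe : (C * be) `^ (p - 1) = eta * (S / z).
  rewrite CE !powRM ?powR_ge0 ?mulr_ge0 ?powR_ge0 ?(ltW E0)//.
  rewrite EE /be -!powRrM ap mulNr ap powRr1 ?(ltW S0)// powR_inv1 ?(ltW z0)//.
  by rewrite mulrA.
have Bp : barrier a S C z `^ (p - 1) * barrier a S C z <= eta * S * C * ka.
  have q : barrier a S C z `^ (p - 1) <= eta * (S / z).
    rewrite -Cbe; apply: ge0_ler_powR; rewrite ?nnegrE //.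
    - by clear -p1; lra.
    - exact: ltW.
    - by rewrite mulr_ge0// ltW.
  apply: (@le_trans _ _ (eta * (S / z) * (C * be))).
    by apply: ler_pM => //; rewrite ?powR_ge0// ltW.
  by rewrite /ka le_eqVlt; apply/orP; left; apply/eqP; clear; ring.
clear -E1 E2 E3 E4 E5 lip Bp; lra.
Qed.

(** Comparison with the barrier: a positive value of [phi - B] would lead to an interior maximum on
    a compact shell, where the first and second derivative tests in each coordinate turn the
    equation into the inequality excluded by [barrier_strict]. *)
Lemma profile_decay_upper (R : realType) (N : nat) (p : R)
    (phi : 'rV[R]_N -> R) (d1 : 'I_N -> 'rV[R]_N -> R)
    (d2 : 'I_N -> 'I_N -> 'rV[R]_N -> R) : 1 < p ->
  profile p phi d1 d2 ->
  (forall e : R, 0 < e -> exists r : R, forall y, r <= sqn y -> `|phi y| <= e) ->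
  exists C S : R, [/\ 0 < C, 1 <= S & forall y, S <= sqn y ->
    phi y <= C * sqn y `^ (- (p - 1)^-1)].
Proof.
move=> p1 prf van; have [h1 h2 c0 _ _ eqn] := prf.
pose a := (p - 1)^-1.
have a0 : 0 < a by rewrite invr_gt0; lra.
have ap : a * (p - 1) = 1 by rewrite /a mulVf// gt_eqF//; lra.
pose eta := Num.min (1 / 4) (a / p).
have ap0 : 0 < a / p by rewrite divr_gt0//; lra.
have eta0 : 0 < eta by rewrite lt_min ap0 andbT; lra.
have eta1 : eta <= 1 / 4 by rewrite ge_min lexx.
have eta2 : p * eta <= a.
  have : eta <= a / p by rewrite ge_min lexx orbT.
  by rewrite ler_pdivlMr; lra.
pose E := eta `^ a.
have E0 : 0 < E by rewrite powR_gt0.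
have EE : E `^ (p - 1) = eta by rewrite -powRrM ap powRr1// ltW.
pose e := E / 2.
have e0 : 0 < e by rewrite /e; lra.
have ee : e `^ (p - 1) <= eta.
  by rewrite -EE; apply: ge0_ler_powR; rewrite ?nnegrE /e; lra.
have [r0 r0P] := van _ e0.
have N0 : 0 <= N%:R :> R by [].
pose S : R := Num.max r0 (1 + 16 * a * (a + 1) + 4 * N%:R * (a + 1)).
have S1 : 1 + 16 * a * (a + 1) + 4 * N%:R * (a + 1) <= S by rewrite le_max lexx orbT.
have SP (y : 'rV[R]_N) : S <= sqn y -> `|phi y| <= e.
  by move=> Sy; apply: r0P; apply: le_trans Sy; rewrite le_max lexx.
have Na0 : 0 <= N%:R * (a + 1) by rewrite mulr_ge0//; lra.
have aa0 : 0 <= a * (a + 1) by rewrite mulr_ge0//; lra.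
have S1' : 1 <= S by lra.
have S0 : 0 < S by lra.
pose C := E * S `^ a.
have C0 : 0 < C by rewrite mulr_gt0// powR_gt0.
have CE : C = E * S `^ a by [].
pose B := barrier a S C; pose B1 := barrier1 a S C; pose B2 := barrier2 a S C.
have dB (z : R) : 0 < z -> is_derive z 1 B (B1 z) by exact: der_barrier.
have dB1 (z : R) : 0 < z -> is_derive z 1 B1 (B2 z) by exact: der_barrier1.
exists C, S; split => // y2 Sy2.
have z20 : 0 < sqn y2 by exact: lt_le_trans Sy2.
suff : phi y2 <= B (sqn y2).
  by move=> /le_trans; apply; exact: barrier_le (ltW S0).
rewrite leNgt; apply/negP => gt2.
pose d := phi y2 - B (sqn y2).
have d0 : 0 < d by rewrite subr_gt0.
(* Beyond [r2] the solution is at most [d / 2], so it cannot exceed the positive barrier by [d]; the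
   maximum stays away from the outer rim [S3]. *)
have d20 : 0 < d / 2 by lra.
have [r2 r2P] := van _ d20.
pose S3 : R := Num.max r2 (sqn y2) + 1.
have S3r : r2 + 1 <= S3 by rewrite lerD2r le_max lexx.
have S3y : sqn y2 + 1 <= S3 by rewrite lerD2r le_max lexx orbT.
pose K := [set y : 'rV[R]_N | forall i, `|y 0 i| <= S3] `&`
  (@sqn R N @^-1` `[S, S3]%classic).
have inK (y : 'rV[R]_N) : S <= sqn y <= S3 -> K y.
  move=> ys; split => /=; last by rewrite in_itv.
  move=> i; rewrite leNgt; apply/negP => iS.
  have S30 : 0 <= S3 by clear -S3y z20; lra.
  have := sqn_gt S30 iS; have : S3 <= S3 ^+ 2 by rewrite expr2 ler_peMl//; clear -S3y S0 Sy2 S1'; lra.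
  by clear -ys; lra.
have cK : compact K.
  apply: compact_closedI; first exact: box_compact.
  apply: closed_comp; last exact: itv_closed.
  by move=> y _; exact: continuous_sqn.
pose H (y : 'rV[R]_N) := phi y - B (sqn y).
have Kz y : K y -> S <= sqn y <= S3 by move=> [_ /=]; rewrite in_itv.
have cH : {within K, continuous H}.
  apply: continuous_in_subspaceT => y /set_mem/Kz/andP[Sy _].
  have cB : {for y, continuous (fun y : 'rV[R]_N => B (sqn y))}.
    apply: continuous_comp; first exact: continuous_sqn.
    by apply: (@der_continuous _ _ _ (B1 (sqn y))); apply: dB; exact: lt_le_trans Sy.
  exact: (cvgB (c0 y) cB).
have y2S3 : S <= sqn y2 <= S3 by rewrite Sy2; clear -S3y; lra.
have K0 : K !=set0 by exists y2; exact: inK.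
have [ys /set_mem Ks Hmax] := compact_EVT_max K0 cK cH.
have Hd : d <= H ys by apply: Hmax; rewrite inE; exact: inK.
set z := sqn ys in Hd *.
have /andP[Sz zS3] : S <= z <= S3 by exact: Kz.
have z0 : 0 < z by exact: lt_le_trans Sz.
have B0 : 0 < B z by exact: barrier_gt0.
have phiB : B z + d <= phi ys by move: Hd; rewrite /H -/z; clear; lra.
have zr2 : z < r2.
  rewrite ltNge; apply/negP => /r2P; have := ler_norm (phi ys); clear -phiB B0 d0; lra.
have phie : phi ys <= e by have := ler_norm (phi ys); have := SP ys Sz; clear; lra.
have zS : S < z.
  rewrite lt_neqAle Sz andbT; apply/eqP => zE.
  have : B S = E / 2 by exact: barrier_boundary.
  by rewrite [in B S]zE; rewrite /e in phie; clear -phie phiB d0; lra.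
pose tol : R := Num.min (z - S) 1.
have tol0 : 0 < tol by rewrite lt_min ltr01 subr_gt0 zS.
have [et et0 etP] := near_coord ys (@continuous_sqn R N) tol0.
have linez (j : 'I_N) (s : R) : `|s| < et -> S < sqn (ys + s *: delta_mx 0 j) <= S3.
  move=> set1.
  have : `|sqn (ys + s *: delta_mx 0 j) - sqn ys| < tol.
    apply: etP => k; rewrite !mxE eqxx /= (addrC (ys 0 k)) addrK.
    by case: (k == j); rewrite ?mulr1 ?mulr0 ?normr0.
  rewrite lt_min !ltr_norml -/z; clear -zr2 S3r; lra.
have test (j : 'I_N) : d1 j ys = 2 * ys 0 j * B1 z /\
    d2 j j ys <= 2 * B1 z + 4 * ys 0 j ^+ 2 * B2 z.
  pose ej : 'rV[R]_N := delta_mx 0 j.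
  pose g (s : R) := H (ys + s *: ej).
  pose g1 (s : R) := d1 j (ys + s *: ej) -
     2 * (ys + s *: ej) 0 j * B1 (sqn (ys + s *: ej)).
  have gd (s : R) : `|s| < et -> is_derive s 1 g (g1 s).
    move=> set1; have /andP[lz _] := linez j s set1.
    have z1 : 0 < sqn (ys + s *: ej) by exact: lt_trans lz.
    have q1 := der_line (h1 j (ys + s *: ej)).
    have q2 := der_line (is_derive_radial j (dB _ z1)).
    exact: (derB q1 q2).
  have gd' : is_derive (0 : R) 1 g1 (d2 j j ys -
      ((0 * ys 0 j + 2 * 1) * B1 z + 2 * ys 0 j * (2 * ys 0 j * B2 z))).
    have rad : is_derive (0 : R) 1 (fun s : R => B1 (sqn (ys + s *: ej))) (2 * ys 0 j * B2 z).
      apply: (@der_line _ _ (fun y => B1 (sqn y))); rewrite scale0r addr0.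
      by apply: is_derive_radial; exact: dB1.
    have lin : is_derive (0 : R) 1 (fun s : R => (ys + s *: ej) 0 j) 1.
      apply: (@der_line _ _ (fun y : 'rV[R]_N => y 0 j)).
      by apply: (der_val (is_derive_coord j j _)); rewrite eqxx.
    have d2l : is_derive (0 : R) 1 (fun s : R => d1 j (ys + s *: ej)) (d2 j j ys).
      by apply: der_line; rewrite scale0r addr0; exact: h2.
    have lin2 : is_derive (0 : R) 1 (fun s : R => 2 * (ys + s *: ej) 0 j) (0 * ys 0 j + 2 * 1).
      apply: (der_val (derM (derC 2 (0:R) 1) lin)); by rewrite scale0r addr0.
    have pr := derM lin2 rad.
    rewrite /= scale0r addr0 -/z in pr.
    exact: (derB d2l pr).
  have [|E1 E2] := @max_second_test R g g1 _ et et0 gd gd'.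
    move=> s set1; rewrite /g scale0r addr0; apply: Hmax; rewrite inE.
    by apply: inK; have /andP[l1 ->] := linez j s set1; rewrite (ltW l1).
  move: E1; rewrite /g1 !scale0r !addr0 -/z => E1.
  by clear -E1 E2; split; lra.
have L : \sum_j d2 j j ys <= 2 * N%:R * B1 z + 4 * z * B2 z.
  apply: (@le_trans _ _ (\sum_j (2 * B1 z + 4 * ys 0 j ^+ 2 * B2 z))).
    by apply: ler_sum => j _; have [] := test j.
  rewrite big_split /= sumr_const card_ord -mulr_suml -mulr_sumr -mulr_natr.
  by rewrite -/(sqn ys) -/z; clear; lra.
have D : \sum_j ys 0 j * d1 j ys = 2 * z * B1 z.
  rewrite /z /sqn mulr_sumr mulr_suml; apply: eq_bigr => j _.
  have [-> _] := test j; ring.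
have := eqn ys; rewrite D ger0_norm; last by clear -phiB B0 d0; lra.
rewrite -/a => eq1.
have bx : B z < phi ys by clear -phiB d0; lra.
have := barrier_strict p1 a0 ap E0 S0 CE N0 Sz eta0 eta1 eta2 EE S1 bx phie.
by rewrite -/B1 -/B2; clear -eq1 L; lra.
Qed.

Lemma profile_decay (R : realType) (N : nat) (p M : R)
    (phi : 'rV[R]_N -> R) (d1 : 'I_N -> 'rV[R]_N -> R)
    (d2 : 'I_N -> 'I_N -> 'rV[R]_N -> R) : 1 < p ->
  profile p phi d1 d2 -> (forall y, `|phi y| <= M) ->
  (forall e : R, 0 < e -> exists r : R, forall y, r <= sqn y -> `|phi y| <= e) ->
  exists2 C : R, 0 < C & forall y, 1 <= sqn y ->
    `|phi y| * sqn y `^ (p - 1)^-1 <= C.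
Proof.
move=> p1 prf phiM van.
have [C [S [C0 S1 CP]]] := profile_decay_upper p1 prf van.
have [|C' [S' [C'0 S'1 CP']]] := profile_decay_upper p1 (profileN prf).
  by move=> e e0; have [r rP] := van e e0; exists r => y ry; rewrite normrN rP.
pose a := (p - 1)^-1.
have a0 : 0 <= a by rewrite invr_ge0; lra.
have M0 : 0 <= M by exact: le_trans (phiM 0).
pose S2 := Num.max S S'.
have SS2 : S <= S2 by rewrite le_max lexx.
have S'S2 : S' <= S2 by rewrite le_max lexx orbT.
exists (C + C' + M * S2 `^ a).
  by have := mulr_ge0 M0 (powR_ge0 S2 a); lra.
move=> y y1; have y0 : 0 < sqn y by lra.
rewrite -/a.
have [yS|Sy] := leP (sqn y) S2.
  have : `|phi y| * sqn y `^ a <= M * S2 `^ a.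
    apply: ler_pM => //; rewrite ?powR_ge0//.
    by apply: ge0_ler_powR; rewrite ?nnegrE; lra.
  by lra.
have : `|phi y| <= (C + C') * sqn y `^ (- a).
  have u1 : phi y <= C * sqn y `^ (- a) by apply: CP; lra.
  have u2 : - phi y <= C' * sqn y `^ (- a) by apply: CP'; lra.
  have := powR_ge0 (sqn y) (- a) => w0.
  have := mulr_ge0 (ltW C0) w0; have := mulr_ge0 (ltW C'0) w0.
  rewrite ler_norml mulrDl; lra.
move=> /(ler_wpM2r (powR_ge0 (sqn y) a)).
rewrite -mulrA -powRD; last by rewrite (gt_eqF y0) implybT.
rewrite addNr powRr0 mulr1 => u.
by have := mulr_ge0 M0 (powR_ge0 S2 a); lra.
Qed.

(** * The weighted identity *)

(** The exponent exceeds 1, so the derivative also exists at 0, where it is computed from the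
    difference quotient. Negative arguments follow by evenness. *)
Lemma der_abs_powR (R : realType) (p x : R) : 1 < p ->
  is_derive x 1 (fun y => `|y| `^ (p + 1)) ((p + 1) * (`|x| `^ (p - 1) * x)).
Proof.
move=> p1.
have pos (y : R) : 0 < y -> is_derive y 1 (fun y => `|y| `^ (p + 1))
    ((p + 1) * (`|y| `^ (p - 1) * y)).
  move=> y0; rewrite gtr0_norm// powR_mulr_sub ?ltW//.
  apply: (@near_eq_is_derive _ _ _ (fun y => y `^ (p + 1))).
  - near=> t; rewrite gtr0_norm//; near: t; exact: lt_nbhsr.
  - have := der_powR (p + 1) y0; by rewrite addrK.
have [x0|x0|->] := ltgtP x 0; last 2 first.
- exact: pos.
- rewrite mulr0 mulr0.
  suff q : h^-1 *: (((fun y : R => `|y| `^ (p + 1)) \o shift 0) (h *: (1 : R))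
      - `|0 : R| `^ (p + 1)) @[h --> 0^'] --> (0 : R).
    by split; [apply/cvg_ex; exists 0|exact: cvg_lim].
  apply/cvgrPdist_le => /= e e0; rewrite near_withinE; apply/nbhs_ballP.
  exists (Num.min e 1) => /=; first by rewrite lt_min e0 ltr01.
  move=> h; rewrite /ball /= sub0r normrN lt_min => /andP[he h1] hn0.
  rewrite sub0r normrN /shift /= addr0 [h *: _]mulr1 normr0 powR0 ?subr0; last first.
    by rewrite gt_eqF//; lra.
  rewrite normrM normfV ger0_norm ?powR_ge0//.
  have h0 : 0 < `|h| by rewrite normr_gt0.
  rewrite -(powR_mulr_sub (p := p + 1)) ?(ltW h0)//; last lra.
  rewrite addrK mulrA -[`|h|^-1 * _]mulrC -mulrA mulVf ?gt_eqF// mulr1.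
  apply: le_trans (ltW he); apply: ge1r_powR; last exact: ltW.
  by rewrite h0 ltW.
- have x0' : 0 < - x by rewrite oppr_gt0.
  have := der_comp (g := fun y : R => - y) (pos _ x0') (derN (is_derive_id x 1)).
  rewrite (_ : (fun y : R => `|- y| `^ (p + 1)) = fun y => `|y| `^ (p + 1)); last first.
    by apply/funext => y; rewrite normrN.
  by rewrite normrN; congr is_derive; ring.
Unshelve. all: end_near.
Qed.

(** The derivative at [z = 0] is two-sided, so the chain rule for [w (sqn y)] applies at the origin
    as well. *)
Definition radial_C1 (R : realType) (w w1 : R -> R) : Prop :=
  forall z : R, 0 <= z -> is_derive z 1 w (w1 z) /\ {for z, continuous w1}.

Lemma continuous_radial (R : realType) (N : nat) (w : R -> R) :
  (forall z, 0 <= z -> {for z, continuous w}) ->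
  continuous (fun y : 'rV[R]_N => w (sqn y)).
Proof.
move=> cw y; apply: continuous_comp; first exact: continuous_sqn.
by apply: cw; exact: sqn_ge0.
Qed.

Lemma radial_C1_continuous (R : realType) (N : nat) (w w1 : R -> R) :
  radial_C1 w w1 -> continuous (fun y : 'rV[R]_N => w (sqn y)) /\
    continuous (fun y : 'rV[R]_N => w1 (sqn y)).
Proof.
move=> h; split; apply: continuous_radial => z z0; have [hd hc] := h z z0 => //.
exact: der_continuous hd.
Qed.

Section fields.
Variables (R : realType) (N : nat) (p : R) (phi : 'rV[R]_N -> R)
  (d1 : 'I_N -> 'rV[R]_N -> R) (d2 : 'I_N -> 'I_N -> 'rV[R]_N -> R)
  (w w1 W W1 V V1 : R -> R).

Definition dotg (y : 'rV[R]_N) : R := \sum_j y 0 j * d1 j y.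
Definition grad2 (y : 'rV[R]_N) : R := \sum_j d1 j y ^+ 2.
(** An antiderivative of [force], in terms of which the equation reads: the Laplacian of [phi]
    equals [dotg / 2 + force phi]. *)
Definition potential (x : R) : R :=
  (p - 1)^-1 / 2 * x ^+ 2 - (p + 1)^-1 * `|x| `^ (p + 1).
Definition force (x : R) : R := (p - 1)^-1 * x - `|x| `^ (p - 1) * x.

(* The first two terms of [field] come from the multiplier [w * dotg], the third
   from [W * phi]; the last one is a free null Lagrangian. *)
Definition field (i : 'I_N) (y : 'rV[R]_N) : R :=
  w (sqn y) * (d1 i y * dotg y - 2^-1 * (y 0 i * grad2 y))
  - y 0 i * w (sqn y) * potential (phi y)
  + W (sqn y) * (phi y * d1 i y) + V (sqn y) * (y 0 i * phi y ^+ 2).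

Definition d_dotg (i : 'I_N) (y : 'rV[R]_N) : R :=
  \sum_j ((i == j)%:R * d1 j y + y 0 j * d2 i j y).
Definition d_grad2 (i : 'I_N) (y : 'rV[R]_N) : R :=
  \sum_j (2%:R * d1 j y ^+ 1 * d2 i j y).

Definition d_field (i : 'I_N) (y : 'rV[R]_N) : R :=
  2 * y 0 i * w1 (sqn y) * (d1 i y * dotg y - 2^-1 * (y 0 i * grad2 y))
  + w (sqn y) * (d2 i i y * dotg y + d1 i y * d_dotg i y
      - 2^-1 * (grad2 y + y 0 i * d_grad2 i y))
  - ((w (sqn y) + y 0 i * (2 * y 0 i * w1 (sqn y))) * potential (phi y)
     + y 0 i * w (sqn y) * (force (phi y) * d1 i y))
  + (2 * y 0 i * W1 (sqn y) * (phi y * d1 i y)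
     + W (sqn y) * (d1 i y ^+ 2 + phi y * d2 i i y))
  + (2 * y 0 i * V1 (sqn y) * (y 0 i * phi y ^+ 2)
     + V (sqn y) * (phi y ^+ 2 + y 0 i * (2 * phi y * d1 i y))).

(** The divergence of [field] once the Laplacian has been eliminated by the equation. The absence of
    [grad2] reflects the relation imposed on [W] in [sum_d_field]. *)
Definition quadratic_form (y : 'rV[R]_N) : R :=
  (w (sqn y) / 2 + 2 * w1 (sqn y)) * dotg y ^+ 2
  + (W (sqn y) / 2 + 2 * V (sqn y) + 2 * W1 (sqn y)) * (phi y * dotg y)
  + (- (p - 1)^-1 * w (sqn y) + N%:R * V (sqn y) + 2 * sqn y * V1 (sqn y)) * phi y ^+ 2
  + (2 * (sqn y * w1 (sqn y) + N%:R / 2 * w (sqn y)) / (p + 1) - W (sqn y))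
    * (`|phi y| `^ (p - 1) * phi y ^+ 2).
End fields.

Lemma der_potential (R : realType) (p x : R) : 1 < p ->
  is_derive x 1 (potential p) (force p x).
Proof.
move=> p1; have q := der_abs_powR x p1.
apply: (@der_val _ _ _ _ _ (0 * x ^+ 2 + (p - 1)^-1 / 2 * (2%:R * x ^+ 1 * 1)
   - (0 * `|x| `^ (p + 1) + (p + 1)^-1 * ((p + 1) * (`|x| `^ (p - 1) * x))))).
  apply: derB; apply: derM; try exact: derC => //.
  by apply: (@derX _ _ id); exact: is_derive_id.
by rewrite /force; field; apply/andP; split; lra.
Qed.

Lemma der_fields (R : realType) (N : nat) (p : R) (phi : 'rV[R]_N -> R)
  (d1 : 'I_N -> 'rV[R]_N -> R) (d2 : 'I_N -> 'I_N -> 'rV[R]_N -> R)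
  (w w1 W W1 V V1 : R -> R) (i : 'I_N) (y : 'rV[R]_N) :
  1 < p -> profile p phi d1 d2 ->
  radial_C1 w w1 -> radial_C1 W W1 -> radial_C1 V V1 ->
  is_derive y (delta_mx 0 i) (field p phi d1 w W V i)
    (d_field p phi d1 d2 w w1 W W1 V V1 i y).
Proof.
move=> p1 prf hw hW hV; have [h1 h2 c0 c1 c2 eqn] := prf.
have zy := sqn_ge0 y.
have qw := is_derive_radial i (hw _ zy).1.
have qW := is_derive_radial i (hW _ zy).1.
have qV := is_derive_radial i (hV _ zy).1.
have qy j := is_derive_coord i j y.
have qD : is_derive y (delta_mx 0 i) (dotg d1) (d_dotg d1 d2 i y).
  apply: der_sum => j; exact: (derM (qy j) (h2 i j y)).
have qS : is_derive y (delta_mx 0 i) (grad2 d1) (d_grad2 d1 d2 i y).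
  apply: der_sum => j; exact: (derX 2 (h2 i j y)).
have qp : is_derive y (delta_mx 0 i) (fun y => potential p (phi y)) (force p (phi y) * d1 i y).
  rewrite {1}(_ : y = y + 0 *: delta_mx 0 i); last by rewrite scale0r addr0.
  apply/is_derive_line.
  apply: (der_comp (g := fun s : R => phi (y + s *: delta_mx 0 i))).
    by rewrite scale0r addr0; exact: der_potential.
  by apply: der_line; rewrite scale0r addr0.
have q2 := derX 2 (h1 i y).
have t1 := derM qw (derB (derM (h2 i i y) qD) (derM (derC (2^-1) y (delta_mx 0 i)) (derM (qy i) qS))).
have t2 := derM (derM (qy i) qw) qp.
have t3 := derM qW (derM (h1 i y) (h2 i i y)).
have t4 := derM qV (derM (qy i) q2).
apply: (der_val (derD (derD (derB t1 t2) t3) t4)).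
rewrite /d_field eqxx /=; ring.
Qed.

(** A Pohozaev computation. The Hessian terms reduce to the single sum [Q], which the gradient of
    [dotg] and that of [grad2] produce with opposite signs, thanks to the symmetry of [d2]. What is
    left of [grad2] has the coefficient [W - z w' - (N/2 - 1) w], which vanishes by hypothesis. *)
Lemma sum_d_field (R : realType) (N : nat) (p : R) (phi : 'rV[R]_N -> R)
  (d1 : 'I_N -> 'rV[R]_N -> R) (d2 : 'I_N -> 'I_N -> 'rV[R]_N -> R)
  (w w1 W W1 V V1 : R -> R) (y : 'rV[R]_N) :
  1 < p -> profile p phi d1 d2 ->
  W (sqn y) = sqn y * w1 (sqn y) + (N%:R / 2 - 1) * w (sqn y) ->
  \sum_i d_field p phi d1 d2 w w1 W W1 V V1 i y =
  quadratic_form p phi d1 w w1 W W1 V V1 y.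
Proof.
move=> p1 prf WE; have [h1 h2 c0 c1 c2 eqn] := prf.
pose Q := \sum_i \sum_j d1 i y * (y 0 j * d2 i j y).
have Ddot : \sum_i d1 i y * d_dotg d1 d2 i y = grad2 d1 y + Q.
  rewrite /grad2 /Q -big_split /=; apply: eq_bigr => i _.
  rewrite /d_dotg big_split /= mulrDr -mulr_sumr; congr (_ + _).
  rewrite (bigD1 i)//= eqxx mul1r big1 ?addr0// => j /negbTE ij.
  by rewrite eq_sym ij mul0r.
have Dgrad : \sum_i y 0 i * d_grad2 d1 d2 i y = 2 * Q.
  rewrite /Q exchange_big mulr_sumr /=; apply: eq_bigr => i _.
  rewrite /d_grad2 !mulr_sumr; apply: eq_bigr => j _.
  by rewrite (partialC h1 h2 c2 i j) expr1; ring.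
have eqL : \sum_i d2 i i y = 2^-1 * dotg d1 y + force p (phi y).
  by have := eqn y; rewrite /force /dotg; lra.
have yd : \sum_i y 0 i * d1 i y = dotg d1 y by [].
have yy : \sum_i y 0 i ^+ 2 = sqn y by [].
have dd : \sum_i d1 i y ^+ 2 = grad2 d1 y by [].
have cc : \sum_(i < N) (1 : R) = N%:R by rewrite sumr_const card_ord.
have [D DE] : exists D, D = dotg d1 y by eexists.
have [S SE] : exists S, S = grad2 d1 y by eexists.
rewrite -DE in yd eqL; rewrite -SE in Ddot dd.
set z := sqn y in WE yy *; set f := phi y in eqL *.
transitivity (2 * w1 z * D * \sum_i y 0 i * d1 i y - w1 z * S * \sum_i y 0 i ^+ 2
  + w z * D * \sum_i d2 i i y + w z * \sum_i d1 i y * d_dotg d1 d2 i y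
  - w z / 2 * S * \sum_(i < N) 1 - w z / 2 * \sum_i y 0 i * d_grad2 d1 d2 i y
  - w z * potential p f * \sum_(i < N) 1 - 2 * w1 z * potential p f * \sum_i y 0 i ^+ 2
  - w z * force p f * \sum_i y 0 i * d1 i y
  + 2 * W1 z * f * \sum_i y 0 i * d1 i y + W z * \sum_i d1 i y ^+ 2
  + W z * f * \sum_i d2 i i y
  + 2 * V1 z * f ^+ 2 * \sum_i y 0 i ^+ 2 + V z * f ^+ 2 * \sum_(i < N) 1
  + 2 * V z * f * \sum_i y 0 i * d1 i y).
  rewrite !mulr_sumr -!sumrN -!big_split /=; apply: eq_bigr => i _.
  by rewrite /d_field -DE -SE -/z -/f; field.
rewrite yd yy dd cc Ddot Dgrad eqL /quadratic_form -DE -/z -/f WE.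
have -> : potential p f = (p - 1)^-1 / 2 * f ^+ 2 - (p + 1)^-1 * (`|f| `^ (p - 1) * f ^+ 2).
  congr (_ - _ * _).
  have -> : `|f| `^ (p - 1) * f ^+ 2 = `|f| `^ (p - 1) * `|f| * `|f|.
    by rewrite -(real_normK (num_real f)) expr2 mulrA.
  rewrite powR_mulr_sub// -(powR_mulr_sub (p := p + 1))// ?addrK//.
  by rewrite ltr_pwDr//; lra.
by rewrite /force; field; apply/andP; split; lra.
Qed.

Lemma weighted_identity (R : realType) (N : nat) (p r : R) (phi : 'rV[R]_N -> R)
  (d1 : 'I_N -> 'rV[R]_N -> R) (d2 : 'I_N -> 'I_N -> 'rV[R]_N -> R)
  (w w1 W W1 V V1 : R -> R) :
  1 < p -> 0 <= r -> profile p phi d1 d2 ->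
  radial_C1 w w1 -> radial_C1 W W1 -> radial_C1 V V1 ->
  (forall z, W z = z * w1 z + (N%:R / 2 - 1) * w z) ->
  (forall z, r ^+ 2 < z -> [/\ w z = 0, w1 z = 0, W1 z = 0, V z = 0 & V1 z = 0]) ->
  csupp r (quadratic_form p phi d1 w w1 W W1 V V1) /\
  (\int[lebesgueN R N]_t
    (quadratic_form p phi d1 w w1 W W1 V V1 (tuple_row t))%:E = 0)%E.
Proof.
move=> p1 r0 prf hw hW hV WE sup; have [h1 h2 c0 c1 c2 eqn] := prf.
have [cw cw1] := radial_C1_continuous N hw.
have [cW cW1] := radial_C1_continuous N hW.
have [cV cV1] := radial_C1_continuous N hV.
have cpot : continuous (fun y => potential p (phi y)).
  apply: (@cont_comp _ _ _ phi (potential p) c0) => x.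
  exact: (der_continuous (der_potential x p1)).
have ce (j : 'I_N) := @continuous_entry R N j.
have cdot : continuous (dotg d1) by exact: (contS (fun j => contM (ce j) (c1 j))).
have cgr : continuous (grad2 d1).
  apply: (contS (f := fun j y => d1 j y ^+ 2)) => j; exact: (contX (c1 j)).
(* Continuity of the force is read off the equation, which expresses it through the continuous
   derivatives. *)
have cfor : continuous (fun y => force p (phi y)).
  rewrite (_ : (fun y => _) = fun y => \sum_i d2 i i y - 2^-1 * dotg d1 y).
    exact: (contB (contS (fun i => c2 i i)) (contM (contC (c := 2^-1)) cdot)).
  by apply/funext => y; have := eqn y; rewrite /force /dotg; lra.
have cddot i : continuous (d_dotg d1 d2 i).
  exact: (contS (fun j => contD (contM (contC (c := (i == j)%:R)) (c1 j))
    (contM (ce j) (c2 i j)))).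
have cdgr i : continuous (d_grad2 d1 d2 i).
  exact: (contS (fun j => contM (contM (contC (c := 2%:R)) (contX (c1 j))) (c2 i j))).
have W0 z : r ^+ 2 < z -> W z = 0.
  by move=> /sup[w0 w10 _ _ _]; rewrite WE w0 w10 !mulr0 addr0.
have cF i : csupp r (field p phi d1 w W V i).
  split.
    exact: (contD (contD (contB
      (contM cw (contB (contM (c1 i) cdot) (contM (contC (c := 2^-1)) (contM (ce i) cgr))))
      (contM (contM (ce i) cw) cpot)) (contM cW (contM c0 (c1 i))))
      (contM cV (contM (ce i) (contX c0)))).
  move=> y ry; have [w0 _ _ V0 _] := sup _ ry.
  by rewrite /field w0 V0 W0//; ring.
have cG i : csupp r (d_field p phi d1 d2 w w1 W W1 V V1 i).
  have c2y := contM (contC (c := 2)) (ce i).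
  split.
    exact: (contD (contD (contB (contD
      (contM (contM c2y cw1)
        (contB (contM (c1 i) cdot) (contM (contC (c := 2^-1)) (contM (ce i) cgr))))
      (contM cw (contB (contD (contM (c2 i i) cdot) (contM (c1 i) (cddot i)))
        (contM (contC (c := 2^-1)) (contD cgr (contM (ce i) (cdgr i)))))))
      (contD (contM (contD cw (contM (ce i) (contM c2y cw1))) cpot)
        (contM (contM (ce i) cw) (contM cfor (c1 i)))))
      (contD (contM (contM c2y cW1) (contM c0 (c1 i)))
        (contM cW (contD (contX (c1 i)) (contM c0 (c2 i i))))))
      (contD (contM (contM c2y cV1) (contM (ce i) (contX c0)))
        (contM cV (contD (contX c0) (contM (ce i) (contM (contM (contC (c := 2)) c0) (c1 i))))))).
  move=> y ry; have [w0 w10 W10 V0 V10] := sup _ ry.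
  by rewrite /d_field w0 V0 W0// w10 W10 V10; ring.
have E : quadratic_form p phi d1 w w1 W W1 V V1 =
    fun y => \sum_i d_field p phi d1 d2 w w1 W W1 V V1 i y.
  by apply/funext => y; rewrite (sum_d_field _ _ _ p1 prf).
split.
  rewrite E; split; first by apply: contS => i; exact: (cG i).1.
  by move=> y ry; apply: big1 => i _; exact: (cG i).2.
rewrite E; apply: (integral_div_csupp r0 cF cG) => i y.
exact: der_fields.
Qed.

(** * The weights *)

(** An exponent of at least two smooths the kink of the truncation, and the derivative is again a
    truncated power. *)
Lemma der_maxX (R : realType) (k : nat) (x : R) :
  is_derive x 1 (fun y => Num.max 0 y ^+ k.+2) (k.+2%:R * Num.max 0 x ^+ k.+1).
Proof.
have [x0|[x0|->]] : x < 0 \/ 0 < x \/ x = 0 by case: (ltgtP x 0); auto.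
- rewrite (max_l (ltW x0)) expr0n mulr0.
  apply: (@near_eq_is_derive _ _ _ (fun=> 0)); try exact: derC.
  near=> t; rewrite max_l ?expr0n//; apply/ltW; near: t; exact: lt_nbhsl.
- rewrite (max_r (ltW x0)).
  apply: (@near_eq_is_derive _ _ _ (fun y : R => y ^+ k.+2)).
    near=> t; rewrite max_r//; apply/ltW; near: t; exact: lt_nbhsr.
  by apply: (der_val (derX k.+2 (is_derive_id x 1))); rewrite mulr1.
- rewrite (max_l (lexx 0)) expr0n mulr0.
  suff q : h^-1 *: (((fun y : R => Num.max 0 y ^+ k.+2) \o shift 0) (h *: (1 : R))
      - Num.max 0 0 ^+ k.+2) @[h --> 0^'] --> (0 : R).
    by split; [apply/cvg_ex; exists 0|exact: cvg_lim].
  apply/cvgrPdist_le => /= e e0; rewrite near_withinE; apply/nbhs_ballP.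
  exists (Num.min e 1) => /=; first by rewrite lt_min e0 ltr01.
  move=> h; rewrite /ball /= sub0r normrN lt_min => /andP[he h1] hn0.
  rewrite sub0r normrN /shift /= addr0 [h *: _]mulr1 (max_l (lexx 0)) expr0n subr0.
  rewrite normrM normfV normrX.
  have h0 : 0 < `|h| by rewrite normr_gt0.
  have mh : `|Num.max 0 h| <= `|h|.
    by rewrite /Num.max; case: ifP => // _; rewrite normr0.
  rewrite mulrC ler_pdivrMr//.
  apply: (@le_trans _ _ (`|h| ^+ k.+2)); first by rewrite lerXn2r ?nnegrE.
  rewrite exprSr ler_pM2r// exprS; apply: (@le_trans _ _ (`|h| * 1)); last by rewrite mulr1 ltW.
  by rewrite ler_pM2l// exprn_ile1// ltW.
Unshelve. all: end_near.
Qed.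

(* The family [wr], [ws], [wtau], [wP] below is stable under [z d/dz], so that
   all derivatives of the weights stay explicit. *)
Definition euler (R : realType) (f g : R -> R) : Prop :=
  forall z : R, 0 <= z -> exists2 d, is_derive z 1 f d & z * d = g z.

Lemma eulerD (R : realType) (f g f' g' : R -> R) : euler f f' -> euler g g' ->
  euler (fun z => f z + g z) (fun z => f' z + g' z).
Proof.
move=> hf hg z z0; have [d fd <-] := hf z z0; have [e ge <-] := hg z z0.
by exists (d + e); [exact: derD|ring].
Qed.

Lemma eulerM (R : realType) (f g f' g' : R -> R) : euler f f' -> euler g g' ->
  euler (fun z => f z * g z) (fun z => f' z * g z + f z * g' z).
Proof.
move=> hf hg z z0; have [d fd <-] := hf z z0; have [e ge <-] := hg z z0.
by exists (d * g z + f z * e); [exact: derM|ring].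
Qed.

Lemma eulerC (R : realType) (c : R) : euler (fun=> c) (fun=> 0).
Proof. by move=> z z0; exists 0; [exact: derC|rewrite mulr0]. Qed.

Lemma euler_eq (R : realType) (f g h : R -> R) : euler f g ->
  (forall z, 0 <= z -> g z = h z) -> euler f h.
Proof.
by move=> hf gh z z0; have [d fd dg] := hf z z0; exists d => //; rewrite dg gh.
Qed.

(* With [u = sqrt (1 + dl z)]: [wr = 1/u], [wv = (1 + u)^(-2K)], and [wm] is
   [z w'/w] for [w = wA 0].  The cutoff is [wP 0 = max(0, 1 - wtau)^k] with
   [wtau = rho z^j].  The suffix 1 (resp. 2) marks the first (resp. second)
   application of [z d/dz].  [weightW = z w' + (N/2 - 1) w] is what makes the
   gradient term of the quadratic form vanish, and [weightV] completes the
   square in the multiple [wP 0] of the form. *)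
Section weights.
Variables (R : realType) (N : nat) (a dl K rho : R) (n j k : nat).

Definition wr (z : R) : R := (Num.sqrt (1 + dl * z))^-1.
Definition wv (z : R) : R := (1 + Num.sqrt (1 + dl * z)) `^ (- (2 * K)).
Definition wA (l : nat) (z : R) : R := z ^+ (n - l) * wv z.
Definition wtau (z : R) : R := rho * z ^+ j.
Definition wP (c : nat) (z : R) : R := Num.max 0 (1 - wtau z) ^+ (k - c).
Definition ws (z : R) : R := 2 * a + K * wr z.
Definition wm (z : R) : R := ws z - N%:R / 2.
Definition we1 (z : R) : R := - (K / 2) * (wr z * (1 - wr z ^+ 2)).
Definition we2 (z : R) : R :=
  K / 4 * (wr z * (1 - wr z ^+ 2) * (1 - 3 * wr z ^+ 2)).
Definition wkj : R := k%:R * j%:R.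
(** Every derivative of the cutoff carries a factor [wtau], which is kept outside [wF], [wF1] and
    [wF2]: it is the factor that makes the cutoff errors small on fixed balls. *)
Definition wF (z : R) : R := - wkj * wP 1 z.
Definition wF1 (z : R) : R := - (wkj * (ws z - 1 + j%:R)) * wP 1 z
  + wkj * ((k%:R - 1) * j%:R) * (wtau z * wP 2 z).
Definition wF2 (z : R) : R :=
  - (wkj * (2 * we1 z + (ws z - 1 + j%:R) * j%:R)) * wP 1 z
  + wkj * ((k%:R - 1) * j%:R) * (ws z - 1 + 3 * j%:R) * (wtau z * wP 2 z)
  - wkj * ((k%:R - 1) * j%:R) * ((k%:R - 2) * j%:R) * (wtau z ^+ 2 * wP 3 z).
Definition wf (z : R) : R := (ws z - 1) * wP 0 z + wtau z * wF z.
Definition wf1 (z : R) : R := we1 z * wP 0 z + wtau z * wF1 z.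
Definition wf2 (z : R) : R := we2 z * wP 0 z + wtau z * wF2 z.
Definition wg (z : R) : R := wm z * wf z + wf1 z.
Definition wg1 (z : R) : R := we1 z * wf z + wm z * wf1 z + wf2 z.
(** [wh] and [wl] are dictated by the coefficient of [phi * D] in the form, [W/2 + 2V + 2W']: it
    becomes [wP 0] times [wA 0 * s + 4 m (s - 1) * wA 1], the cross terms of the two squares in
    [quadratic_form_weight]. *)
Definition wh (z : R) : R := ws z / 2 * wP 0 z - wf z / 4.
Definition wh1 (z : R) : R :=
  (we1 z * wP 0 z + ws z * (wtau z * wF z)) / 2 - wf1 z / 4.
Definition wl (z : R) : R := 2 * wm z * (ws z - 1) * wP 0 z - wg z.
Definition wl1 (z : R) : R :=
  2 * (we1 z * (ws z - 1) + wm z * we1 z) * wP 0 z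
  + 2 * wm z * (ws z - 1) * (wtau z * wF z) - wg1 z.

Definition weight (z : R) : R := wA 0 z * wP 0 z.
Definition weight1 (z : R) : R := wA 1 z * (wm z * wP 0 z + wtau z * wF z).
Definition weightW (z : R) : R := wA 0 z * wf z.
Definition weightW1 (z : R) : R := wA 1 z * wg z.
Definition weightV (z : R) : R := wA 0 z * wh z + wA 1 z * wl z.
Definition weightV1 (z : R) : R := wA 1 z * (wm z * wh z + wh1 z)
  + wA 2 z * ((wm z - 1) * wl z + wl1 z).
End weights.

Lemma wu_gt0 (R : realType) (dl z : R) : 0 < dl -> 0 <= z -> 0 < 1 + dl * z.
Proof. by move=> d0 z0; rewrite ltr_pwDl// mulr_ge0// ltW. Qed.

Lemma wr_gt0 (R : realType) (dl z : R) : 0 < dl -> 0 <= z -> 0 < wr dl z.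
Proof. by move=> d0 z0; rewrite invr_gt0 sqrtr_gt0; exact: wu_gt0. Qed.

Lemma wr_rel (R : realType) (dl z : R) : 0 < dl -> 0 <= z ->
  dl * z * wr dl z ^+ 2 = 1 - wr dl z ^+ 2.
Proof.
move=> d0 z0; have u0 := wu_gt0 d0 z0.
rewrite /wr exprVn sqr_sqrtr ?ltW//.
by field; rewrite gt_eqF.
Qed.

Lemma der_wu (R : realType) (dl z : R) : 0 < dl -> 0 <= z ->
  is_derive z 1 (fun z => Num.sqrt (1 + dl * z)) (dl / 2 * wr dl z).
Proof.
move=> d0 z0; have u0 := wu_gt0 d0 z0.
have lin : is_derive z 1 (fun z => 1 + dl * z) (0 + (0 * z + dl * 1)).
  exact: (derD (derC 1 z 1) (derM (derC dl z 1) (is_derive_id z 1))).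
apply: (der_val (der_comp (g := fun z => 1 + dl * z) (is_derive1_sqrt u0) lin)).
have s0 : Num.sqrt (1 + dl * z) != 0 by rewrite gt_eqF// sqrtr_gt0.
by rewrite /wr; field.
Qed.

Lemma euler_wr (R : realType) (dl : R) : 0 < dl ->
  euler (wr dl) (fun z => - (wr dl z * (1 - wr dl z ^+ 2)) / 2).
Proof.
move=> d0 z z0; have u0 := wu_gt0 d0 z0.
have s0 : 0 < Num.sqrt (1 + dl * z) by rewrite sqrtr_gt0.
exists (- (Num.sqrt (1 + dl * z)) ^- 2 * (dl / 2 * wr dl z)).
  apply: (der_val (@is_deriveV _ (fun z => Num.sqrt (1 + dl * z)) z _ 1 (lt0r_neq0 s0) (der_wu d0 z0))).
  by [].
rewrite -(wr_rel d0 z0) /wr exprVn; ring.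
Qed.

Lemma euler_ws (R : realType) (a dl K : R) : 0 < dl ->
  euler (ws a dl K) (we1 dl K).
Proof.
move=> d0; apply: (euler_eq (eulerD (eulerC (2 * a)) (eulerM (eulerC K) (euler_wr d0)))).
by move=> z z0; rewrite /we1; field.
Qed.

Lemma euler_wm (R : realType) (N : nat) (a dl K : R) : 0 < dl ->
  euler (wm N a dl K) (we1 dl K).
Proof.
move=> d0; apply: (euler_eq (eulerD (euler_ws a K d0) (eulerC (- (N%:R / 2))))).
by move=> z z0; rewrite addr0.
Qed.

Lemma euler_we1 (R : realType) (dl K : R) : 0 < dl ->
  euler (we1 dl K) (we2 dl K).
Proof.
move=> d0; have q := euler_wr d0.
have q2 : euler (fun z => 1 - wr dl z ^+ 2)
    (fun z => wr dl z ^+ 2 * (1 - wr dl z ^+ 2)).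
  have := eulerD (eulerC 1) (eulerM (eulerC (-1)) (eulerM q q)).
  rewrite (_ : (fun z => 1 + -1 * (wr dl z * wr dl z)) = fun z => 1 - wr dl z ^+ 2).
    by move=> h; apply: (euler_eq h) => z z0; field.
  by apply/funext => z; rewrite mulN1r expr2.
apply: (euler_eq (eulerM (eulerC (- (K / 2))) (eulerM q q2))).
by move=> z z0; rewrite /we2 /=; field.
Qed.

Lemma euler_wtau (R : realType) (rho : R) (j : nat) :
  euler (wtau rho j) (fun z => j%:R * wtau rho j z).
Proof.
move=> z z0; exists (rho * (j%:R * z ^+ j.-1 * 1)).
  apply: (der_val (derM (derC rho z 1) (derX j (is_derive_id z 1)))).
  by rewrite mul0r add0r.
rewrite /wtau; case: j => [|j] /=; first by rewrite !mul0r !mulr0.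
by rewrite exprS; ring.
Qed.

Lemma euler_wP (R : realType) (rho : R) (j k c : nat) : (c.+2 <= k)%N ->
  euler (wP rho j k c)
    (fun z => - ((k%:R - c%:R) * j%:R) * (wtau rho j z * wP rho j k c.+1 z)).
Proof.
move=> ck z z0; have [d hd dE] := euler_wtau rho j z0.
have [l kE] : exists l, k = (c + l.+2)%N.
  by exists (k - c.+2)%N; rewrite -addSnnS -addSnnS subnKC.
have lin : is_derive z 1 (fun z => 1 - wtau rho j z) (0 - d).
  exact: (derB (derC 1 z 1) hd).
exists (l.+2%:R * Num.max 0 (1 - wtau rho j z) ^+ l.+1 * (0 - d)).
  rewrite /wP kE addKn.
  exact: (der_comp (g := fun z => 1 - wtau rho j z) (der_maxX l _) lin).
rewrite /wP kE (_ : (c + l.+2 - c.+1 = l.+1)%N); last by rewrite subnS addKn.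
rewrite (natrD _ c) (addrC c%:R) addrK.
rewrite (_ : z * _ = - (l.+2%:R * (z * d)) * Num.max 0 (1 - wtau rho j z) ^+ l.+1); last by ring.
by rewrite dE; ring.
Qed.

(** With [dl z = u^2 - 1], the logarithmic derivative [z w'/w] of [z^n (1 + u)^(-2K)] is
    [n - K (u - 1)/u], and the relation between [K] and [n] turns this into [wm]. It falls from [n]
    at the origin to [2a - N/2] at infinity. *)
Lemma der_wA (R : realType) (N : nat) (a dl K : R) (n l : nat) (z : R) :
  0 < dl -> 0 <= z -> (l < n)%N -> K = n%:R - (2 * a - N%:R / 2) ->
  is_derive z 1 (wA dl K n l)
    (wA dl K n l.+1 z * (wm N a dl K z - l%:R)).
Proof.
move=> d0 z0 ln KE; have u0 := wu_gt0 d0 z0.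
have s0 : 0 < Num.sqrt (1 + dl * z) by rewrite sqrtr_gt0.
have s1 : 0 < 1 + Num.sqrt (1 + dl * z) by rewrite addr_gt0.
have dv : is_derive z 1 (wv dl K)
    (- (2 * K) * (1 + Num.sqrt (1 + dl * z)) `^ (- (2 * K) - 1) * (0 + dl / 2 * wr dl z)).
  apply: (der_comp (f := fun x => x `^ (- (2 * K))) (g := fun z => 1 + Num.sqrt (1 + dl * z)) (der_powR _ s1)).
  exact: (derD (derC 1 z 1) (der_wu d0 z0)).
have [q nE] : exists q, n = (l + q.+1)%N.
  by exists (n - l.+1)%N; rewrite -addSnnS subnKC.
apply: (der_val (derM (derX (n - l) (is_derive_id z 1)) dv)).
rewrite powR_sub1// -/(wv dl K z) /wA nE addKn.
rewrite (_ : (l + q.+1 - l.+1 = q)%N); last by rewrite subnS addKn.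
rewrite /= mulr1 /wm /ws KE nE natrD.
have := wr_rel d0 z0; rewrite /wr; set u := Num.sqrt _ in s0 s1 *.
move=> rel.
have un0 : u != 0 by rewrite gt_eqF.
have u1n0 : 1 + u != 0 by rewrite gt_eqF.
have dz : dl * z = u ^+ 2 - 1.
  by rewrite /u sqr_sqrtr ?ltW//; ring.
rewrite exprS.
rewrite (_ : z * z ^+ q * _ = z ^+ q * (- (K * (dl * z) / u / (1 + u)) * wv dl K z)); last first.
  rewrite KE nE natrD; field; by apply/andP; split.
rewrite dz KE nE natrD; field; by apply/andP; split.
Qed.

(** One power of [z] is taken from [wA l] to turn the derivative of [f] into [g]; hence the index
    [l.+1], and no division by [z] at the origin. *)
Lemma der_wA_euler (R : realType) (N : nat) (a dl K : R) (n l : nat)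
    (f g : R -> R) (z : R) :
  0 < dl -> 0 <= z -> (l < n)%N -> K = n%:R - (2 * a - N%:R / 2) -> euler f g ->
  is_derive z 1 (fun z => wA dl K n l z * f z)
    (wA dl K n l.+1 z * ((wm N a dl K z - l%:R) * f z + g z)).
Proof.
move=> d0 z0 ln KE fg; have [d fd dE] := fg z z0.
apply: (der_val (derM (der_wA d0 z0 ln KE) fd)).
have AE : wA dl K n l z = wA dl K n l.+1 z * z.
  by rewrite /wA subnS -[in LHS](prednK (n := n - l)) ?subn_gt0// exprSr; ring.
by rewrite -dE AE; ring.
Qed.

(** Much weaker than its name: one derivative on the closed half-line, just enough to yield
    continuity without writing that derivative out. *)
Definition smooth (R : realType) (f : R -> R) : Prop := exists g, euler f g.

Lemma smD (R : realType) (f g : R -> R) : smooth f -> smooth g ->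
  smooth (fun z => f z + g z).
Proof. by move=> [f' h] [g' h']; eexists; exact: eulerD h h'. Qed.

Lemma smM (R : realType) (f g : R -> R) : smooth f -> smooth g ->
  smooth (fun z => f z * g z).
Proof. by move=> [f' h] [g' h']; eexists; exact: eulerM h h'. Qed.

Lemma smC (R : realType) (c : R) : smooth (fun=> c).
Proof. by eexists; exact: eulerC. Qed.

Lemma smN (R : realType) (f : R -> R) : smooth f -> smooth (fun z => - f z).
Proof.
move=> /(smM (smC (-1))) h; rewrite (_ : (fun z => _) = fun z => -1 * f z)//.
by apply/funext => z; rewrite mulN1r.
Qed.

Lemma smB (R : realType) (f g : R -> R) : smooth f -> smooth g ->
  smooth (fun z => f z - g z).
Proof. by move=> hf /smN hg; exact: smD. Qed.

Lemma smX2 (R : realType) (f : R -> R) : smooth f -> smooth (fun z => f z ^+ 2).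
Proof. by move=> hf; exact: smM. Qed.

Lemma der_wA_smooth_continuous (R : realType) (N : nat) (a dl K : R) (n l : nat)
    (f : R -> R) (z : R) :
  0 < dl -> 0 <= z -> (l < n)%N -> K = n%:R - (2 * a - N%:R / 2) -> smooth f ->
  {for z, continuous (fun z => wA dl K n l z * f z)}.
Proof.
by move=> d0 z0 ln KE [g fg]; exact: der_continuous (der_wA_euler d0 z0 ln KE fg).
Qed.

Section weights_C1.
Variables (R : realType) (N : nat) (a dl K rho : R) (n j k : nat).
Hypotheses (d0 : 0 < dl) (KE : K = n%:R - (2 * a - N%:R / 2))
  (n4 : (4 <= n)%N) (k5 : (5 <= k)%N).

Let sr : smooth (wr dl). Proof. by eexists; exact: euler_wr. Qed.
Let ss : smooth (ws a dl K). Proof. by eexists; exact: euler_ws. Qed.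
Let sm_ : smooth (wm N a dl K). Proof. by eexists; exact: euler_wm. Qed.
Let se1 : smooth (we1 dl K). Proof. by eexists; exact: euler_we1. Qed.
Let se2 : smooth (we2 dl K).
Proof.
exact: (smM (smC (K / 4)) (smM (smM sr (smB (smC 1) (smX2 sr)))
  (smB (smC 1) (smM (smC 3) (smX2 sr))))).
Qed.
Let st : smooth (wtau rho j). Proof. by eexists; exact: euler_wtau. Qed.
(** The bound [5 <= k] comes from here: [weightV1] contains [wP 3], whose exponent [k - 3] must be
    at least two. *)
Let sP c : (c <= 3)%N -> smooth (wP rho j k c).
Proof.
move=> c3; eexists; apply: euler_wP; exact: leq_trans k5.
Qed.

Lemma euler_wF : euler (fun z => wtau rho j z * wF rho j k z)
  (fun z => wtau rho j z * (j%:R * wF rho j k z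
    + wkj R j k * ((k%:R - 1) * j%:R) * (wtau rho j z * wP rho j k 2 z))).
Proof.
have h1 : (1.+2 <= k)%N by exact: leq_trans k5.
apply: (euler_eq (eulerM (euler_wtau rho j)
  (eulerM (eulerC (- wkj R j k)) (euler_wP rho j h1)))).
by move=> z z0; rewrite /wF; ring.
Qed.

Let eP0 : euler (wP rho j k 0) (fun z => wtau rho j z * wF rho j k z).
Proof.
have h0 : (0.+2 <= k)%N by exact: leq_trans k5.
apply: (euler_eq (euler_wP rho j h0)) => z z0.
by rewrite /wF /wkj; ring.
Qed.

Lemma euler_wf : euler (wf a dl K rho j k) (wf1 a dl K rho j k).
Proof.
have hs := eulerD (euler_ws a K d0) (eulerC (-1)).
apply: (euler_eq (eulerD (eulerM hs eP0) euler_wF)) => z z0.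
by rewrite /wf1 /wF1 /wF; ring.
Qed.

Lemma euler_wf1 : euler (wf1 a dl K rho j k) (wf2 a dl K rho j k).
Proof.
have h1 : (1.+2 <= k)%N by exact: leq_trans k5.
have h2 : (2.+2 <= k)%N by exact: leq_trans k5.
have hs := eulerD (euler_ws a K d0) (eulerC (-1 + j%:R)).
have et := euler_wtau rho j.
have hF1 := eulerD
  (eulerM (eulerM (eulerC (- wkj R j k)) hs) (euler_wP rho j h1))
  (eulerM (eulerC (wkj R j k * ((k%:R - 1) * j%:R))) (eulerM et (euler_wP rho j h2))).
have := eulerD (eulerM (euler_we1 K d0) eP0) (eulerM et hF1).
rewrite (_ : (fun z => _) = wf1 a dl K rho j k); last first.
  by apply/funext => z; rewrite /wf1 /wF1; ring.
move=> h; apply: (euler_eq h) => z z0.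
by rewrite /wf2 /wF2 /wF; ring.
Qed.

Lemma euler_wg : euler (wg N a dl K rho j k) (wg1 N a dl K rho j k).
Proof.
apply: (euler_eq (eulerD (eulerM (euler_wm N a K d0) euler_wf) euler_wf1)) => z z0.
by rewrite /wg1; ring.
Qed.

Lemma euler_wh : euler (wh a dl K rho j k) (wh1 a dl K rho j k).
Proof.
have := eulerD (eulerM (eulerM (euler_ws a K d0) (eulerC 2^-1)) eP0)
  (eulerM (eulerC (- 4^-1)) euler_wf).
rewrite (_ : (fun z => _) = wh a dl K rho j k); last first.
  by apply/funext => z; rewrite /wh; ring.
move=> h; apply: (euler_eq h) => z z0.
by rewrite /wh1; ring.
Qed.

Lemma euler_wl : euler (wl N a dl K rho j k) (wl1 N a dl K rho j k).
Proof.
have hm := euler_wm N a K d0.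
have hs := eulerD (euler_ws a K d0) (eulerC (-1)).
have := eulerD (eulerM (eulerM (eulerM (eulerC 2) hm) hs) eP0)
  (eulerM (eulerC (-1)) euler_wg).
rewrite (_ : (fun z => _) = wl N a dl K rho j k); last first.
  by apply/funext => z; rewrite /wl; ring.
move=> h; apply: (euler_eq h) => z z0.
by rewrite /wl1; ring.
Qed.

Let sP0 : smooth (wP rho j k 0). Proof. exact: sP. Qed.
Let sF : smooth (wF rho j k). Proof. exact: (smM (smC _) (sP (isT : (1 <= 3)%N))). Qed.
Let sf : smooth (wf a dl K rho j k). Proof. by eexists; exact: euler_wf. Qed.
Let sf1 : smooth (wf1 a dl K rho j k). Proof. by eexists; exact: euler_wf1. Qed.
Let sg : smooth (wg N a dl K rho j k). Proof. by eexists; exact: euler_wg. Qed.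
Let sh : smooth (wh a dl K rho j k). Proof. by eexists; exact: euler_wh. Qed.
Let sl : smooth (wl N a dl K rho j k). Proof. by eexists; exact: euler_wl. Qed.

Let sf2 : smooth (wf2 a dl K rho j k).
Proof.
have s1 := smD (smB ss (smC 1)) (smC j%:R).
have sF2 : smooth (wF2 a dl K rho j k).
  exact: (smB (smD
   (smM (smN (smM (smC (wkj R j k)) (smD (smM (smC 2) se1) (smM s1 (smC j%:R)))))
     (sP (isT : (1 <= 3)%N)))
   (smM (smM (smC (wkj R j k * ((k%:R - 1) * j%:R))) (smD (smB ss (smC 1)) (smC (3 * j%:R))))
     (smM st (sP (isT : (2 <= 3)%N)))))
   (smM (smC (wkj R j k * ((k%:R - 1) * j%:R) * ((k%:R - 2) * j%:R)))
     (smM (smX2 st) (sP (isT : (3 <= 3)%N))))).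
exact: (smD (smM se2 sP0) (smM st sF2)).
Qed.

Let sg1 : smooth (wg1 N a dl K rho j k).
Proof. exact: (smD (smD (smM se1 sf) (smM sm_ sf1)) sf2). Qed.

Lemma weight_C1 : radial_C1 (weight dl K rho n j k) (weight1 N a dl K rho n j k).
Proof.
have n1 : (0 < n)%N by exact: leq_trans n4.
have n2 : (1 < n)%N by exact: leq_trans n4.
move=> z z0; split.
  apply: (der_val (der_wA_euler d0 z0 n1 KE eP0)).
  by rewrite /weight1 subr0.
apply: (der_wA_smooth_continuous d0 z0 n2 KE).
exact: (smD (smM sm_ sP0) (smM st sF)).
Qed.

Lemma weightW_C1 : radial_C1 (weightW a dl K rho n j k) (weightW1 N a dl K rho n j k).
Proof.
have n1 : (0 < n)%N by exact: leq_trans n4.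
have n2 : (1 < n)%N by exact: leq_trans n4.
move=> z z0; split; last exact: (der_wA_smooth_continuous d0 z0 n2 KE sg).
apply: (der_val (der_wA_euler d0 z0 n1 KE euler_wf)).
by rewrite /weightW1 subr0.
Qed.

Lemma weightV_C1 : radial_C1 (weightV N a dl K rho n j k) (weightV1 N a dl K rho n j k).
Proof.
have n1 : (0 < n)%N by exact: leq_trans n4.
have n2 : (1 < n)%N by exact: leq_trans n4.
have n3 : (2 < n)%N by exact: leq_trans n4.
have sm1 := smB sm_ (smC 1).
have sh1 : smooth (wh1 a dl K rho j k).
  exact: (smB (smM (smD (smM se1 sP0) (smM ss (smM st sF))) (smC 2^-1)) (smM sf1 (smC 4^-1))).
have s2m := smM (smC 2) sm_.
have ss1 := smB ss (smC 1).
have sl1 : smooth (wl1 N a dl K rho j k).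
  exact: (smB (smD (smM (smM (smC 2) (smD (smM se1 ss1) (smM sm_ se1))) sP0)
    (smM (smM s2m ss1) (smM st sF))) sg1).
move=> z z0; split.
  apply: (der_val (derD (der_wA_euler d0 z0 n1 KE euler_wh)
    (der_wA_euler d0 z0 n2 KE euler_wl))).
  by rewrite /weightV1 subr0.
apply: cvgD.
  exact: (der_wA_smooth_continuous d0 z0 n2 KE (smD (smM sm_ sh) sh1)).
exact: (der_wA_smooth_continuous d0 z0 n3 KE (smD (smM sm1 sl) sl1)).
Qed.
End weights_C1.

Lemma wA_step (R : realType) (dl K : R) (n l : nat) (z : R) : (l < n)%N ->
  wA dl K n l z = z * wA dl K n l.+1 z.
Proof.
move=> ln; rewrite /wA subnS -[in LHS](prednK (n := n - l)) ?subn_gt0// exprS.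
by rewrite mulrA.
Qed.

Lemma weightW_eq (R : realType) (N : nat) (a dl K rho : R) (n j k : nat) (z : R) :
  (0 < n)%N -> weightW a dl K rho n j k z =
    z * weight1 N a dl K rho n j k z + (N%:R / 2 - 1) * weight dl K rho n j k z.
Proof.
move=> n0; rewrite /weightW /weight1 /weight (wA_step dl K z n0) /wf /wm; ring.
Qed.

Lemma wP_eq0 (R : realType) (rho : R) (j k c : nat) (z : R) :
  (c < k)%N -> 1 < wtau rho j z -> wP rho j k c z = 0.
Proof.
move=> ck t1; rewrite /wP max_l ?subr_le0 ?ltW// expr0n.
by rewrite subn_eq0 leqNgt ck.
Qed.

Lemma weights_eq0 (R : realType) (N : nat) (a dl K rho : R) (n j k : nat) (z : R) :
  (5 <= k)%N -> 1 < wtau rho j z ->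
  [/\ weight dl K rho n j k z = 0, weight1 N a dl K rho n j k z = 0,
      weightW1 N a dl K rho n j k z = 0, weightV N a dl K rho n j k z = 0 &
      weightV1 N a dl K rho n j k z = 0].
Proof.
move=> k5 t1.
have P c : (c <= 3)%N -> wP rho j k c z = 0.
  by move=> c3; apply: wP_eq0 => //; apply: leq_trans k5; exact: leq_trans c3 _.
have P0 := P 0%N isT; have P1 := P 1%N isT; have P2 := P 2%N isT; have P3 := P 3%N isT.
have F0 : wF rho j k z = 0 by rewrite /wF P1 mulr0.
have F1 : wF1 a dl K rho j k z = 0 by rewrite /wF1 P1 P2 !mulr0 addr0.
have F2 : wF2 a dl K rho j k z = 0 by rewrite /wF2 P1 P2 P3 !mulr0 addr0 subr0.
have f0 : wf a dl K rho j k z = 0 by rewrite /wf P0 F0 !mulr0 addr0.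
have f1 : wf1 a dl K rho j k z = 0 by rewrite /wf1 P0 F1 !mulr0 addr0.
have f2 : wf2 a dl K rho j k z = 0 by rewrite /wf2 P0 F2 !mulr0 addr0.
have g0 : wg N a dl K rho j k z = 0 by rewrite /wg f0 f1 mulr0 addr0.
have g1 : wg1 N a dl K rho j k z = 0 by rewrite /wg1 f0 f1 f2 !mulr0 !addr0.
have h0 : wh a dl K rho j k z = 0 by rewrite /wh P0 f0 mulr0 mul0r subr0.
have h1 : wh1 a dl K rho j k z = 0.
  by rewrite /wh1 P0 F0 f1 !mulr0 addr0 !mul0r subr0.
have l0 : wl N a dl K rho j k z = 0 by rewrite /wl P0 g0 mulr0 subr0.
have l1 : wl1 N a dl K rho j k z = 0 by rewrite /wl1 P0 F0 g1 !mulr0 addr0 subr0.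
rewrite /weight /weight1 /weightW1 /weightV /weightV1 P0 F0 g0 h0 h1 l0 l1.
by rewrite !mulr0 !addr0 !mulr0 !addr0.
Qed.

(* The part of the coefficient of [phi ^+ 2] that contains a derivative of the cutoff. *)
Section errors.
Variables (R : realType) (N : nat) (a dl K rho : R) (j k : nat).
Definition err0 (z : R) : R := let F := wF rho j k z in
  - (N%:R / 4) * F - wm N a dl K z / 2 * F + ws a dl K z * F
  - wF1 a dl K rho j k z / 2.
Definition err1 (z : R) : R :=
  let F := wF rho j k z in let F1 := wF1 a dl K rho j k z in
  let m := wm N a dl K z in
  - N%:R * (m * F + F1) - 2 * (m - 1) * (m * F + F1)
  + 4 * m * (ws a dl K z - 1) * F
  - 2 * (we1 dl K z * F + m * F1 + wF2 a dl K rho j k z).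
End errors.

(** The choice of [weightV] regroups the terms without derivatives of the cutoff into two squares;
    all other terms carry the factor [t]. Positivity comes from [s / 2 - a = K / (2u)]. The centre
    [s - 1] of the second square leaves in the [A1] coefficient of [phi ^+ 2] only terms with
    derivatives of [s]. *)
Lemma quadratic_form_weight (R : realType) (N : nat) (p dl K rho : R)
    (n j k : nat) (phi : 'rV[R]_N -> R) (d1 : 'I_N -> 'rV[R]_N -> R)
    (y : 'rV[R]_N) : let a := (p - 1)^-1 in
  (1 < n)%N -> 1 < p ->
  let z := sqn y in let D := dotg d1 y in
  let s := ws a dl K z in let m := wm N a dl K z in
  let A0 := wA dl K n 0 z in let A1 := wA dl K n 1 z in
  let P0 := wP rho j k 0 z in let F := wF rho j k z in let t := wtau rho j z in
  let e1 := we1 dl K z in let e2 := we2 dl K z in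
  quadratic_form p phi d1 (weight dl K rho n j k) (weight1 N a dl K rho n j k)
    (weightW a dl K rho n j k) (weightW1 N a dl K rho n j k)
    (weightV N a dl K rho n j k) (weightV1 N a dl K rho n j k) y =
  P0 * (A0 / 2 * (D + s * phi y) ^+ 2 + 2 * m * A1 * (D + (s - 1) * phi y) ^+ 2
    + (A0 * (s / 2 - a + e1 / 2) + A1 * (2 * m * e1 - 2 * e2)) * phi y ^+ 2)
  + 2 * A1 * t * F * D ^+ 2
  + t * (A0 * err0 N a dl K rho j k z + A1 * err1 N a dl K rho j k z) * phi y ^+ 2
  + A0 * (P0 * (2 * s / (p + 1) - s + 1) - t * F * (1 - 2 / (p + 1)))
    * (`|phi y| `^ (p - 1) * phi y ^+ 2).
Proof.
move=> a n1 p1 z D s m A0 A1 P0 F t e1 e2.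
have n0 : (0 < n)%N by exact: leq_trans n1.
have p1n : p + 1 != 0 by rewrite gt_eqF//; lra.
rewrite /quadratic_form /weightV1 -/z.
have A1E := wA_step dl K z n0; have A2E := wA_step dl K z n1.
rewrite /weight /weight1 /weightW /weightW1 /weightV.
rewrite /wl1 /wl /wh1 /wh /wg1 /wg /wf2 /wf1 /wf /err0 /err1.
rewrite -/D -/A0 -/A1 -/P0 -/F -/t -/e1 -/e2 -/m -/s.
rewrite /A0 A1E -/A1 /A1 A2E.
move: (wF1 a dl K rho j k z) (wF2 a dl K rho j k z) => F1 F2.
move: (`|phi y| `^ (p - 1)) (phi y) => f x.
have sE : s = m + N%:R / 2 by rewrite /m /wm -/s; ring.
rewrite sE -/a.
move: (wA dl K n 2 z) => A2.
by field.
Qed.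

(** The obstacle is that [m] may be negative. For [z <= 16 |ms| + 1] the smallness of [dl] gives
    [r >= 1/2], hence [m >= 0]. For larger [z] the term [2 m (X - x)^2] loses at most
    [4 |ms| (X^2 + x^2)], which is paid by [z X^2 / 4] and by [z K r x^2 / 16], the latter because
    [r (1 + z) >= 1] and [K] dominates [|ms|]. The derivatives of [s] cost another [z K r x^2 / 16],
    because [1 - r^2 <= dl z]; so the coefficient 1/4 drops to 3/16 and then to 1/8. *)
Lemma square_bound (R : realType) (ms m K dl r z X x e1 e2 h : R) :
  0 < dl -> 0 <= z -> 0 < r -> r <= 1 -> dl * z * r ^+ 2 = 1 - r ^+ 2 ->
  dl * (`|ms| + K + 1) <= 1 / 16 -> 128 * `|ms| + 1 <= K ->
  m = ms + K * r -> h = K * r / 2 -> e1 = - (K / 2) * (r * (1 - r ^+ 2)) ->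
  e2 = K / 4 * (r * (1 - r ^+ 2) * (1 - 3 * r ^+ 2)) ->
  z * (X ^+ 2 / 4 + K * r / 8 * x ^+ 2) <=
  z / 2 * X ^+ 2 + 2 * m * (X - x) ^+ 2
  + (z * (h + e1 / 2) + (2 * m * e1 - 2 * e2)) * x ^+ 2.
Proof.
move=> d0 z0 r0 r1 rel dK K0 mE hE e1E e2E.
have ms0 := normr_ge0 ms.
have nms : - `|ms| <= ms by have := ler_norm (- ms); rewrite normrN; lra.
have K1 : 1 <= K by lra.
have r2 : r ^+ 2 <= 1 by rewrite expr_le1// ltW.
have r20 : 0 < r ^+ 2 by rewrite exprn_gt0.
have Kr : 0 < K * r by rewrite mulr_gt0//; lra.
have dz0 : 0 <= dl * z by rewrite mulr_ge0// ltW.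
have cb : K * r * (1 - r ^+ 2) * (m + (1 - 3 * r ^+ 2) / 2) <= K * r * z / 16.
  have b1 : m + (1 - 3 * r ^+ 2) / 2 <= `|ms| + K + 1.
    have := ler_norm ms; have : K * r <= K * 1 by rewrite ler_pM2l//; lra.
    by rewrite mE; lra.
  have b2 : 1 - r ^+ 2 <= dl * z.
    by rewrite -rel; have := ler_wpM2l dz0 r2; lra.
  apply: (@le_trans _ _ (K * r * (1 - r ^+ 2) * (`|ms| + K + 1))).
    by apply: ler_wpM2l => //; rewrite mulr_ge0 ?(ltW Kr)// subr_ge0.
  apply: (@le_trans _ _ (K * r * (dl * z) * (`|ms| + K + 1))).
    by apply: ler_wpM2r; [lra|rewrite ler_pM2l].
  have -> : K * r * (dl * z) * (`|ms| + K + 1) = K * r * z * (dl * (`|ms| + K + 1)) by ring.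
  have -> : K * r * z / 16 = K * r * z * (1 / 16) by field.
  by apply: ler_wpM2l => //; rewrite mulr_ge0// ltW.
have r30 := mulr_ge0 z0 (mulr_ge0 (ltW Kr) (ltW r20)).
have cE : z * (K * r) * 3 / 16 <= z * (h + e1 / 2) + (2 * m * e1 - 2 * e2).
  rewrite hE e1E e2E.
  rewrite (_ : _ + _ = z * (K * r) / 4 + z * (K * r * r ^+ 2) / 4
     - K * r * (1 - r ^+ 2) * (m + (1 - 3 * r ^+ 2) / 2)); last by field.
  by clear -cb r30; lra.
have x20 := sqr_ge0 x; have X20 := sqr_ge0 X; have Xx0 := sqr_ge0 (X - x).
have cx := ler_wpM2r x20 cE.
have zX := mulr_ge0 z0 X20.
have zKx := mulr_ge0 (mulr_ge0 z0 (ltW Kr)) x20.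
have [zbig|zsmall] := leP (16 * `|ms| + 1) z.
- have mb : - `|ms| <= m by rewrite mE; clear -nms Kr; lra.
  have sq : (X - x) ^+ 2 <= 2 * X ^+ 2 + 2 * x ^+ 2.
    by have := sqr_ge0 (X + x); rewrite !sqrrD sqrrN mulrN; lra.
  have q1 : - (4 * `|ms| * X ^+ 2) - 4 * `|ms| * x ^+ 2 <= 2 * m * (X - x) ^+ 2.
    have a1 := ler_wpM2r Xx0 mb; have a2 := ler_wpM2l ms0 sq.
    by clear -a1 a2; lra.
  have q2 : 16 * `|ms| * X ^+ 2 <= z * X ^+ 2.
    by apply: ler_wpM2r => //; clear -zbig; lra.
  have rz : 1 <= r * (1 + z).
    have z1p : 0 <= 1 + z by clear -z0; lra.
    rewrite -(@ler_pXn2r _ 2)// ?nnegrE ?(mulr_ge0 (ltW r0) z1p)//.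
    rewrite expr1n exprMn.
    have d1 : dl <= 1.
      have t1 : 0 <= dl * (`|ms| + K) by apply: mulr_ge0; [exact: ltW|clear -ms0 K1; lra].
      by clear -dK t1; lra.
    have t2 : dl * z <= 1 * z by rewrite ler_wpM2r.
    have t3 : r ^+ 2 * (1 + dl * z) <= r ^+ 2 * (1 + z) ^+ 2.
      rewrite ler_pM2l//; have := sqr_ge0 z; have z00 := z0; clear -t2 z00; rewrite sqrrD; lra.
    by clear -rel t3; lra.
  have z1 : 1 <= z by clear -zbig ms0; lra.
  have q3 : 64 * `|ms| * x ^+ 2 <= z * (K * r) * x ^+ 2.
    apply: ler_wpM2r => //.
    have t1 : K * 1 <= K * (r * (1 + z)) by rewrite ler_pM2l//; clear -K1; lra.
    have t2 : K * r * 1 <= K * r * z by rewrite ler_pM2l.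
    by clear -t1 t2 K0; lra.
  clear -q1 q2 q3 cx zX zKx; lra.
- have dz : dl * z <= 1.
    have t1 : dl * z <= dl * (16 * `|ms| + 1) by rewrite ler_pM2l// ltW.
    have t2 : dl * (16 * `|ms| + 1) <= dl * (16 * (`|ms| + K + 1)) by rewrite ler_pM2l//; lra.
    by clear -t1 t2 dK; lra.
  have rh : 1 / 2 <= r.
    rewrite leNgt; apply/negP => rh.
    have t1 : r ^+ 2 < 1 / 4.
      by rewrite expr2; have := ltr_pM (ltW r0) (ltW r0) rh rh; clear; lra.
    have t2 : dl * z * r ^+ 2 <= 1 * r ^+ 2 by rewrite ler_wpM2r// ltW.
    by clear -t1 t2 rel; lra.
  have m0 : 0 <= m.
    have t1 : K * (1 / 2) <= K * r by rewrite ler_pM2l//; lra.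
    by rewrite mE; clear -t1 K0 ms0 nms; lra.
  have q := mulr_ge0 m0 Xx0.
  clear -q cx zX zKx; lra.
Qed.

(** Uniformity in [rho] is the point: the constants must survive the limit of large cutoff radius.
    The condition on [wtau] describes the support of the cutoff. *)
Definition ubound (R : realType) (j : nat) (f : R -> R -> R) : Prop :=
  exists C : R, forall rho z, 0 <= rho -> 0 <= z -> wtau rho j z <= 1 ->
    `|f rho z| <= C.

Lemma ubD (R : realType) (j : nat) (f g : R -> R -> R) : ubound j f -> ubound j g ->
  ubound j (fun rho z => f rho z + g rho z).
Proof.
move=> [C hC] [D hD]; exists (C + D) => rho z r0 z0 t1.
by apply: (le_trans (ler_normD _ _)); apply: lerD; [exact: hC|exact: hD].
Qed.

Lemma ubM (R : realType) (j : nat) (f g : R -> R -> R) : ubound j f -> ubound j g ->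
  ubound j (fun rho z => f rho z * g rho z).
Proof.
move=> [C hC] [D hD]; exists (C * D) => rho z r0 z0 t1.
by rewrite normrM; apply: ler_pM => //; [exact: hC|exact: hD].
Qed.

Lemma ubC (R : realType) (j : nat) (c : R) : ubound j (fun _ _ => c).
Proof. by exists `|c|. Qed.

Lemma ubN (R : realType) (j : nat) (f : R -> R -> R) : ubound j f ->
  ubound j (fun rho z => - f rho z).
Proof. by move=> [C hC]; exists C => rho z *; rewrite normrN hC. Qed.

Lemma ubB (R : realType) (j : nat) (f g : R -> R -> R) : ubound j f -> ubound j g ->
  ubound j (fun rho z => f rho z - g rho z).
Proof. by move=> hf /ubN; exact: ubD. Qed.

Lemma ubX2 (R : realType) (j : nat) (f : R -> R -> R) : ubound j f ->
  ubound j (fun rho z => f rho z ^+ 2).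
Proof. by move=> hf; exact: (ubM hf hf). Qed.

Lemma wr_le1 (R : realType) (dl z : R) : 0 < dl -> 0 <= z -> wr dl z <= 1.
Proof.
move=> d0 z0; rewrite /wr invf_le1 ?sqrtr_gt0 ?wu_gt0//.
rewrite -[leLHS]sqrtr1 ler_sqrt; last by rewrite ltW// wu_gt0.
by rewrite lerDl mulr_ge0// ltW.
Qed.

Lemma wtau_ge0 (R : realType) (rho z : R) (j : nat) : 0 <= rho -> 0 <= z ->
  0 <= wtau rho j z.
Proof. by move=> r0 z0; rewrite mulr_ge0// exprn_ge0. Qed.

Lemma wP_ge0 (R : realType) (rho z : R) (j k c : nat) : 0 <= wP rho j k c z.
Proof. by rewrite exprn_ge0// le_max lexx. Qed.

Lemma wP_le1 (R : realType) (rho z : R) (j k c : nat) : 0 <= rho -> 0 <= z ->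
  wP rho j k c z <= 1.
Proof.
move=> r0 z0; rewrite exprn_ile1 ?le_max ?lexx//.
by rewrite ge_max ler01 gerBl wtau_ge0.
Qed.

Lemma err_ubound (R : realType) (N : nat) (a dl K : R) (j k : nat) : 0 < dl ->
  ubound j (fun rho : R => err0 N a dl K rho j k) /\
  ubound j (fun rho : R => err1 N a dl K rho j k).
Proof.
move=> d0.
have br : ubound j (fun _ => wr dl).
  exists 1 => rho z r0 z0 _; rewrite ger0_norm ?wr_le1// ltW//; exact: wr_gt0.
have bt : ubound j (fun rho : R => wtau rho j).
  by exists 1 => rho z r0 z0 t1; rewrite ger0_norm// wtau_ge0.
have bP c : ubound j (fun rho : R => wP rho j k c).
  by exists 1 => rho z r0 z0 t1; rewrite ger0_norm ?wP_ge0// wP_le1.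
have c_ := @ubC R j.
have bs : ubound j (fun _ => ws a dl K) by exact: (ubD (c_ (2 * a)) (ubM (c_ K) br)).
have bm : ubound j (fun _ => wm N a dl K) by exact: (ubB bs (c_ (N%:R / 2))).
have be : ubound j (fun _ => we1 dl K).
  exact: (ubM (c_ (- (K / 2))) (ubM br (ubB (c_ 1) (ubX2 br)))).
have bF : ubound j (fun rho : R => wF rho j k) by exact: (ubM (c_ (- wkj R j k)) (bP 1%N)).
have bs1 := ubB bs (c_ 1).
have bs2 := ubD bs1 (c_ j%:R).
have kk := c_ (wkj R j k * ((k%:R - 1) * j%:R)).
have bF1 : ubound j (fun rho : R => wF1 a dl K rho j k).
  exact: (ubD (ubM (ubN (ubM (c_ (wkj R j k)) bs2)) (bP 1%N)) (ubM kk (ubM bt (bP 2%N)))).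
have bF2 : ubound j (fun rho : R => wF2 a dl K rho j k).
  exact: (ubB (ubD
    (ubM (ubN (ubM (c_ (wkj R j k)) (ubD (ubM (c_ 2) be) (ubM bs2 (c_ j%:R))))) (bP 1%N))
    (ubM (ubM kk (ubD bs1 (c_ (3 * j%:R)))) (ubM bt (bP 2%N))))
    (ubM (ubM kk (c_ ((k%:R - 2) * j%:R))) (ubM (ubX2 bt) (bP 3%N)))).
have bmF := ubD (ubM bm bF) bF1.
split.
  exact: (ubB (ubD (ubB (ubM (c_ (- (N%:R / 4))) bF) (ubM (ubM bm (c_ 2^-1)) bF))
    (ubM bs bF)) (ubM bF1 (c_ 2^-1))).
exact: (ubB (ubD (ubB (ubM (c_ (- N%:R)) bmF) (ubM (ubM (c_ 2) (ubB bm (c_ 1))) bmF))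
  (ubM (ubM (ubM (c_ 4) bm) bs1) bF))
  (ubM (c_ 2) (ubD (ubD (ubM be bF) (ubM bm bF1)) bF2))).
Qed.

(** A weight [k] orders below [wA 0]: what remains where the cutoff is too small to absorb its own
    derivative. *)
Definition wB (R : realType) (dl K : R) (n k : nat) (z : R) : R :=
  z ^+ (n - k) * wv dl K z.

Lemma wv_ge0 (R : realType) (dl K z : R) : 0 <= wv dl K z.
Proof. exact: powR_ge0. Qed.

Lemma wA_ge0 (R : realType) (dl K z : R) (n l : nat) : 0 <= z -> 0 <= wA dl K n l z.
Proof. by move=> z0; rewrite mulr_ge0 ?exprn_ge0 ?wv_ge0. Qed.

(** Let [Q = max(0, 1 - t)]. Where [z Q] exceeds a multiple of [t], the main term absorbs the
    derivative of the cutoff. Elsewhere [z Q] is bounded, and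
    [z^(n-1) Q^(k-1) = z^(n-k) (z Q)^(k-1)] trades powers of the cutoff for powers of [z]. *)
Lemma cutoff_bound (R : realType) (dl K rho z : R) (n j k : nat) :
  (1 < k)%N -> (k <= n)%N -> 0 <= rho -> 0 <= z -> wtau rho j z <= 1 ->
  - (4 * wkj R j k * wtau rho j z * ((16 * wkj R j k) ^+ k.-1 * wB dl K n k z)) <=
  wA dl K n 0 z * wP rho j k 0 z / 4
    - 4 * wkj R j k * wtau rho j z * wP rho j k 1 z * wA dl K n 1 z.
Proof.
move=> k1 kn r0 z0 t1.
have t0 := wtau_ge0 j r0 z0.
set t := wtau rho j z in t0 t1 *.
pose Q := Num.max 0 (1 - t).
have kj0 : 0 <= wkj R j k by rewrite mulr_ge0.
have Q0 : 0 <= Q by rewrite le_max lexx.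
have P0E : wP rho j k 0 z = Q * wP rho j k 1 z.
  rewrite /wP -/t -/Q subn0 subn1 -exprS prednK//; exact: ltn_trans k1.
have A0E : wA dl K n 0 z = z * wA dl K n 1 z.
  by apply: wA_step; apply: leq_trans kn; exact: ltn_trans k1.
have A1 := wA_ge0 dl K n 1 z0.
have P1 := wP_ge0 rho z j k 1.
have AP : wA dl K n 1 z * wP rho j k 1 z = wB dl K n k z * (z * Q) ^+ k.-1.
  rewrite /wA /wP /wB -/t -/Q !subn1 exprMn.
  have -> : (n.-1 = (n - k) + k.-1)%N.
    rewrite -subn1 -[in LHS](subnK kn) -addnBA ?subn1//; exact: ltn_trans k1.
  by rewrite exprD; ring.
have B0 : 0 <= wB dl K n k z by rewrite mulr_ge0 ?exprn_ge0 ?wv_ge0.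
rewrite P0E A0E.
rewrite (_ : _ - _ = wA dl K n 1 z * wP rho j k 1 z * (z * Q / 4 - 4 * wkj R j k * t)); last by ring.
have [h|h] := leP (16 * wkj R j k * t) (z * Q).
  apply: (@le_trans _ _ 0).
    rewrite oppr_le0; do 2 apply: mulr_ge0 => //.
      by rewrite mulr_ge0.
    by rewrite exprn_ge0// mulr_ge0.
  by apply: mulr_ge0; [exact: mulr_ge0|clear -h; lra].
rewrite AP.
have e1 : (z * Q) ^+ k.-1 <= (16 * wkj R j k) ^+ k.-1.
  rewrite lerXn2r ?nnegrE ?mulr_ge0//.
  apply: (le_trans (ltW h)).
  by rewrite ler_piMr// mulr_ge0.
have zQ0 := mulr_ge0 z0 Q0.
have e2 : 0 <= 4 * wkj R j k * t := mulr_ge0 (mulr_ge0 (ler0n R 4) kj0) t0.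
have e3 : wB dl K n k z * (z * Q) ^+ k.-1 <= wB dl K n k z * (16 * wkj R j k) ^+ k.-1.
  by rewrite ler_wpM2l.
have e4 := ler_wpM2r e2 e3.
have e5 : 0 <= wB dl K n k z * (z * Q) ^+ k.-1 * (z * Q / 4).
  apply: mulr_ge0; first by rewrite mulr_ge0 ?exprn_ge0.
  by clear -zQ0; lra.
by clear -e4 e5; lra.
Qed.

(** * The lower bound for the quadratic form *)

(** The arithmetic core of [quadratic_form_lower], with real numbers in place of the weights. The
    cutoff term in [D ^+ 2] is split by [D^2 <= 2 X^2 + 2 s^2 x^2]; its [X] part is handled by a
    quarter of the first square and the cutoff bound, its [x] part goes into the error. As
    [(p - 1)/(p + 1)] lies in [0, 1], the nonlinear coefficient is at least [- K r]. *)
Lemma lower_algebra (R : realType)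
    (A0 A1 P0 P1 B f E0 E1 t r s m q1 q2 b0 D x z K L M sm kj C0 C1 c p : R) :
  1 < p -> 0 <= A0 -> 0 <= A1 -> 0 <= P0 -> 0 <= P1 -> P1 <= 1 -> 0 <= B ->
  0 <= f -> 0 <= t -> 0 <= z -> 0 <= kj -> 0 <= c -> 0 <= L -> 0 < K * r ->
  A0 = z * A1 -> `|E0| <= C0 -> `|E1| <= C1 ->
  - (4 * kj * t * (c * B)) <= A0 * P0 / 4 - 4 * kj * t * P1 * A1 ->
  D ^+ 2 <= L * z -> x ^+ 2 <= M ^+ 2 -> s ^+ 2 <= sm ^+ 2 ->
  z * ((D + s * x) ^+ 2 / 4 + K * r / 8 * x ^+ 2) <=
  z / 2 * (D + s * x) ^+ 2 + 2 * m * ((D + s * x) - x) ^+ 2 +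
    (z * (b0 + q1 / 2) + (2 * m * q1 - 2 * q2)) * x ^+ 2 ->
  P0 * A0 * (K * r * (1 / 8 - f) * x ^+ 2)
  - (`|C0| + `|C1| + 4 * kj * sm ^+ 2
     + 4 * kj * c * (2 * L + 2 * sm ^+ 2 * M ^+ 2)) * t
      * ((A0 + A1) * x ^+ 2 + (1 + z) * B) <=
  P0 * (A0 / 2 * (D + s * x) ^+ 2 + 2 * m * A1 * (D + (s - 1) * x) ^+ 2 +
     (A0 * (b0 + q1 / 2) + A1 * (2 * m * q1 - 2 * q2)) * x ^+ 2) +
  2 * A1 * t * (- kj * P1) * D ^+ 2 +
  t * (A0 * E0 + A1 * E1) * x ^+ 2 +
  A0 * (P0 * ((p - 1) / (p + 1) * (1 - K * r)) - t * (- kj * P1) * (1 - 2 / (p + 1)))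
    * (f * x ^+ 2).
Proof.
move=> p1 A00 A10 P00 P10 P11 B0 f0 t0 z0 kj0 c10 L0 Kr0 A0E hE0 hE1 cut DL x2M s2 sq.
pose cX := 2 * L + 2 * sm ^+ 2 * M ^+ 2.
have cX0 : 0 <= cX.
  by rewrite addr_ge0// mulr_ge0 ?sqr_ge0// mulr_ge0 ?sqr_ge0.
pose C2 := `|C0| + `|C1| + 4 * kj * sm ^+ 2.
pose C3 := 4 * kj * c * cX.
have C20 : 0 <= C2 by rewrite !addr_ge0// mulr_ge0 ?sqr_ge0// mulr_ge0.
have C30 : 0 <= C3 by rewrite mulr_ge0// mulr_ge0// mulr_ge0.
set X := D + s * x in sq *.
have YE : D + (s - 1) * x = X - x by rewrite /X; ring.
have DE : D = X - s * x by rewrite /X; ring.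
rewrite YE.
have X20 := sqr_ge0 X; have x20 := sqr_ge0 x; have D20 := sqr_ge0 D.
have s20 := sqr_ge0 s.
have S1 : P0 * A0 * (X ^+ 2 / 4 + K * r / 8 * x ^+ 2) <=
    P0 * (A0 / 2 * X ^+ 2 + 2 * m * A1 * (X - x) ^+ 2 +
    (A0 * (b0 + q1 / 2) + A1 * (2 * m * q1 - 2 * q2)) * x ^+ 2).
  have h := ler_wpM2l (mulr_ge0 P00 A10) sq.
  by clear -h A0E; rewrite A0E; lra.
have sx : s ^+ 2 * x ^+ 2 <= sm ^+ 2 * x ^+ 2 by rewrite ler_wpM2r.
have S2 : 2 * A1 * t * kj * P1 * D ^+ 2 <=
    4 * kj * t * P1 * A1 * X ^+ 2 + 4 * kj * sm ^+ 2 * t * A1 * x ^+ 2.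
  have h : D ^+ 2 <= 2 * X ^+ 2 + 2 * (sm ^+ 2 * x ^+ 2).
    have q := sqr_ge0 (X + s * x); clear -q sx DE; rewrite DE; lra.
  have w0 : 0 <= 2 * A1 * t * kj * P1.
    by rewrite mulr_ge0// mulr_ge0// mulr_ge0// mulr_ge0.
  have h2 := ler_wpM2l w0 h.
  have w1 : 0 <= 4 * kj * sm ^+ 2 * t * A1 * x ^+ 2.
    apply: mulr_ge0 => //; apply: mulr_ge0 => //; apply: mulr_ge0 => //.
    by rewrite mulr_ge0 ?sqr_ge0// mulr_ge0.
  have h3 := ler_wpM2l w1 P11.
  by clear -h2 h3; lra.
have XM : X ^+ 2 <= cX * (1 + z).
  have q := sqr_ge0 (D - s * x).
  have h1 : sm ^+ 2 * x ^+ 2 <= sm ^+ 2 * M ^+ 2 by rewrite ler_wpM2l ?sqr_ge0.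
  have h2 : X ^+ 2 <= 2 * (L * z) + 2 * (sm ^+ 2 * M ^+ 2).
    by clear -q h1 sx DL; rewrite /X; lra.
  have h3 : 0 <= sm ^+ 2 * M ^+ 2 * z.
    by apply: mulr_ge0 => //; apply: mulr_ge0; exact: sqr_ge0.
  by clear -h2 h3 L0; rewrite /cX; lra.
have S3 : - (C3 * t * ((1 + z) * B)) <=
    P0 * A0 * X ^+ 2 / 4 - 4 * kj * t * P1 * A1 * X ^+ 2.
  have h1 := ler_wpM2r X20 cut.
  have w0 : 0 <= 4 * kj * t * (c * B).
    by apply: mulr_ge0; [apply: mulr_ge0 => //; exact: mulr_ge0|exact: mulr_ge0].
  have h2 := ler_wpM2l w0 XM.
  by clear -h1 h2; rewrite /C3; lra.
have S4 : - ((`|C0| + `|C1|) * t * ((A0 + A1) * x ^+ 2)) <=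
    t * (A0 * E0 + A1 * E1) * x ^+ 2.
  have g0 : - `|C0| <= E0 by move: hE0; rewrite ler_norml; have := ler_norm C0; clear; lra.
  have g1 : - `|C1| <= E1 by move: hE1; rewrite ler_norml; have := ler_norm C1; clear; lra.
  have tx : 0 <= t * x ^+ 2 by exact: mulr_ge0.
  have h0 := ler_wpM2l (mulr_ge0 tx A00) g0.
  have h1 := ler_wpM2l (mulr_ge0 tx A10) g1.
  have h2 := mulr_ge0 (mulr_ge0 tx A00) (normr_ge0 C1).
  have h3 := mulr_ge0 (mulr_ge0 tx A10) (normr_ge0 C0).
  by clear -h0 h1 h2 h3; lra.
have fx : 0 <= f * x ^+ 2 by exact: mulr_ge0.
pose th := (p - 1) / (p + 1).
have th0 : 0 <= th by rewrite divr_ge0//; clear -p1; lra.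
have th1 : th <= 1 by rewrite ler_pdivrMr; clear -p1; lra.
have S5 : - (K * r * (P0 * A0 * (f * x ^+ 2))) <=
    A0 * (P0 * (th * (1 - K * r))) * (f * x ^+ 2).
  have w0 : 0 <= P0 * A0 * (f * x ^+ 2) by rewrite mulr_ge0// mulr_ge0.
  have g : - (K * r) <= th * (1 - K * r).
    have := ler_wpM2r (ltW Kr0) th1; clear -th0; lra.
  have h := ler_wpM2r w0 g.
  by clear -h; lra.
have S6 : 0 <= A0 * (t * kj * P1 * (1 - 2 / (p + 1))) * (f * x ^+ 2).
  apply: mulr_ge0 => //; apply: mulr_ge0 => //; apply: mulr_ge0.
    by rewrite mulr_ge0// mulr_ge0.
  by rewrite subr_ge0 ler_pdivrMr; clear -p1; lra.
have S7 : 4 * kj * sm ^+ 2 * t * A1 * x ^+ 2 <=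
    4 * kj * sm ^+ 2 * t * ((A0 + A1) * x ^+ 2).
  have w0 : 0 <= 4 * kj * sm ^+ 2 * t * x ^+ 2 * A0.
    apply: mulr_ge0 => //; apply: mulr_ge0 => //; apply: mulr_ge0 => //.
    by rewrite mulr_ge0 ?sqr_ge0// mulr_ge0.
  by clear -w0; lra.
have S8 : 0 <= C3 * t * ((A0 + A1) * x ^+ 2).
  by apply: mulr_ge0; [exact: mulr_ge0|apply: mulr_ge0 => //; exact: addr_ge0].
have S9 : 0 <= C2 * t * ((1 + z) * B).
  apply: mulr_ge0; first exact: mulr_ge0.
  by apply: mulr_ge0 => //; clear -z0; lra.
rewrite -/th -/cX -/C3.
clear -S1 S2 S3 S4 S5 S6 S7 S8 S9; rewrite /C2 in S9 *; lra.
Qed.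

Lemma quadratic_form_lower (R : realType) (N : nat) (p dl K M L : R)
    (n j k : nat) (phi : 'rV[R]_N -> R) (d1 : 'I_N -> 'rV[R]_N -> R) :
  let a := (p - 1)^-1 in let ms := 2 * a - N%:R / 2 in
  (1 < k)%N -> (k <= n)%N -> 1 < p -> 0 < dl -> 0 <= L ->
  dl * (`|ms| + K + 1) <= 1 / 16 -> 128 * `|ms| + 1 <= K ->
  (forall y, `|phi y| <= M) -> (forall y, dotg d1 y ^+ 2 <= L * sqn y) ->
  exists2 C : R, 0 <= C & forall (rho : R) (y : 'rV[R]_N), 0 <= rho ->
    let z := sqn y in wtau rho j z <= 1 ->
    wP rho j k 0 z * wA dl K n 0 z *
      (K * wr dl z * (1 / 8 - `|phi y| `^ (p - 1)) * phi y ^+ 2)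
    - C * wtau rho j z * ((wA dl K n 0 z + wA dl K n 1 z) * phi y ^+ 2
        + (1 + z) * wB dl K n k z) <=
    quadratic_form p phi d1 (weight dl K rho n j k) (weight1 N a dl K rho n j k)
      (weightW a dl K rho n j k) (weightW1 N a dl K rho n j k)
      (weightV N a dl K rho n j k) (weightV1 N a dl K rho n j k) y.
Proof.
move=> a ms k1 kn p1 d0 L0 dK K0 phiM dL.
have a0 : 0 < a by rewrite invr_gt0 subr_gt0.
have ap : a * (p - 1) = 1 by rewrite /a mulVf// subr_eq0 gt_eqF.
have n1 : (1 < n)%N by exact: leq_trans kn.
have [[C0 hC0] [C1 hC1]] := err_ubound N a K j k d0.
have kj0 : 0 <= wkj R j k by rewrite mulr_ge0.
have M0 : 0 <= M by exact: le_trans (phiM 0).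
have ms0 := normr_ge0 ms.
have K1 : 1 <= K by lra.
pose sm := 2 * a + K.
have sm0 : 0 <= sm by rewrite /sm; lra.
pose c1 := 16 * wkj R j k.
have c10 : 0 <= c1 ^+ k.-1 by rewrite exprn_ge0// mulr_ge0.
pose cX := 2 * L + 2 * sm ^+ 2 * M ^+ 2.
have cX0 : 0 <= cX.
  by rewrite addr_ge0// mulr_ge0 ?sqr_ge0// mulr_ge0 ?sqr_ge0.
pose C2 := `|C0| + `|C1| + 4 * wkj R j k * sm ^+ 2.
pose C3 := 4 * wkj R j k * c1 ^+ k.-1 * cX.
have C20 : 0 <= C2 by rewrite !addr_ge0// mulr_ge0 ?sqr_ge0// mulr_ge0.
have C30 : 0 <= C3 by rewrite mulr_ge0// mulr_ge0// mulr_ge0.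
exists (C2 + C3); first exact: addr_ge0.
move=> rho y r0 z t1.
rewrite quadratic_form_weight//= -/a -/z.
have z0 : 0 <= z by exact: sqn_ge0.
have t0 := wtau_ge0 j r0 z0.
have rr0 := wr_gt0 d0 z0; have rr1 := wr_le1 d0 z0; have rel := wr_rel d0 z0.
have A0E : wA dl K n 0 z = z * wA dl K n 1 z by apply: wA_step; exact: ltnW n1.
have A1 := wA_ge0 dl K n 1 z0; have A0 := wA_ge0 dl K n 0 z0.
have P0 := wP_ge0 rho z j k 0; have P1 := wP_ge0 rho z j k 1.
have P11 := wP_le1 j k 1 r0 z0.
have B0 : 0 <= wB dl K n k z by rewrite mulr_ge0 ?exprn_ge0 ?wv_ge0.
have f0 := powR_ge0 `|phi y| (p - 1).
have E0 := hC0 rho z r0 z0 t1; have E1 := hC1 rho z r0 z0 t1.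
have cut := cutoff_bound dl K k1 kn r0 z0 t1.
have DL := dL y.
have x2M : phi y ^+ 2 <= M ^+ 2.
  by rewrite -(real_normK (num_real (phi y))) lerXn2r ?nnegrE.
have sE : ws a dl K z = 2 * a + K * wr dl z by [].
have KrK : K * wr dl z <= K by rewrite ler_piMr//; clear -K1; lra.
have Kr0 : 0 < K * wr dl z by rewrite mulr_gt0//; clear -K1; lra.
have sq := @square_bound R ms (wm N a dl K z) K dl (wr dl z) z
  (dotg d1 y + ws a dl K z * phi y) (phi y) (we1 dl K z) (we2 dl K z)
  (ws a dl K z / 2 - a) d0 z0 rr0 rr1 rel dK K0.
have {}sq := sq _ _ erefl erefl.
have e1 : wm N a dl K z = ms + K * wr dl z by rewrite /wm /ws /ms; ring.
have e2 : ws a dl K z / 2 - a = K * wr dl z / 2 by rewrite /ws; field.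
have {}sq := sq e1 e2.
have s2 : ws a dl K z ^+ 2 <= sm ^+ 2.
  by rewrite lerXn2r ?nnegrE// sE /sm; clear -a0 Kr0 KrK K1; lra.
rewrite /wF -/c1.
(* By [a * (p - 1) = 1] the constant part [2 * a] of [s] contributes exactly the positive term, so
   only the part in [K * wr] can be negative. *)
have sE2 : 2 * ws a dl K z / (p + 1) - ws a dl K z + 1 =
    (p - 1) / (p + 1) * (1 - K * wr dl z).
  have p1n : p + 1 != 0 by rewrite gt_eqF//; clear -p1; lra.
  rewrite (_ : 2 * ws a dl K z / (p + 1) - ws a dl K z + 1 =
    (p + 1 - ws a dl K z * (p - 1)) / (p + 1)); last by field.
  rewrite (_ : ws a dl K z * (p - 1) = 2 * (a * (p - 1)) + K * wr dl z * (p - 1)).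
    by rewrite ap; field.
  by rewrite sE; ring.
rewrite sE2.
exact: (lower_algebra p1 A0 A1 P0 P1 P11 B0 f0 t0 z0 kj0 c10 L0 Kr0 A0E E0 E1 cut
  DL x2M s2 sq).
Qed.

(** * Size of the weights and of the cutoff errors *)

Lemma powRD_pos (R : realType) (x r s : R) : 0 < x -> x `^ (r + s) = x `^ r * x `^ s.
Proof. by move=> x0; by rewrite powRD ?(gt_eqF x0) ?implybT. Qed.

Lemma wv_le1 (R : realType) (dl K z : R) : 0 <= K -> wv dl K z <= 1.
Proof.
move=> K0; rewrite /wv powRN invf_le1; last first.
  by rewrite powR_gt0// ltr_pwDl// sqrtr_ge0.
rewrite [leLHS](_ : 1 = 1 `^ (2 * K)); last by rewrite powR1.
apply: ge0_ler_powR; rewrite ?nnegrE ?mulr_ge0//.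
by rewrite lerDl sqrtr_ge0.
Qed.

Lemma wv_le (R : realType) (dl K z : R) : 0 < dl -> 0 <= K -> 0 < z ->
  wv dl K z <= dl `^ (- K) * z `^ (- K).
Proof.
move=> d0 K0 z0; have dz : 0 < dl * z by exact: mulr_gt0.
have u0 := wu_gt0 d0 (ltW z0).
have s0 := sqrtr_ge0 (1 + dl * z).
rewrite -(powRM _ (ltW d0) (ltW z0)) /wv.
set u := Num.sqrt _ in s0 *.
rewrite (_ : - (2 * K) = 2%:R * - K); last by ring.
rewrite powRrM powR_mulrn ?addr_ge0// !powRN lef_pV2 ?posrE ?powR_gt0//; last first.
  by rewrite exprn_gt0// ltr_pwDl.
apply: ge0_ler_powR => //; rewrite ?nnegrE; [exact: ltW|by rewrite exprn_ge0// addr_ge0|].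
have uE : u ^+ 2 = 1 + dl * z by rewrite sqr_sqrtr// ltW.
rewrite (_ : (1 + u) ^+ 2 = u ^+ 2 + (1 + 2 * u)); last by ring.
by rewrite uE; clear -s0; lra.
Qed.

Lemma wzv_le (R : realType) (dl K z ms : R) (n l : nat) : 0 < dl -> 0 <= K ->
  0 < z -> K = n%:R - ms -> (l <= n)%N ->
  z ^+ (n - l) * wv dl K z <= dl `^ (- K) * z `^ (ms - l%:R).
Proof.
move=> d0 K0 z0 KE ln.
have h := wv_le d0 K0 z0.
have zn : 0 <= z ^+ (n - l) by rewrite exprn_ge0// ltW.
apply: (le_trans (ler_wpM2l zn h)).
rewrite -(powR_mulrn _ (ltW z0)) mulrCA -powRD_pos// natrB//.
by rewrite (_ : _ + - K = ms - l%:R)// KE; ring.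
Qed.

(** Here [wtau] is [(z / x^2)^j]; being at most 1, with [j >= b], it is at most [(z / x^2)^b]. Decay
    in [z] is thereby converted into decay in the radius [x]. *)
Lemma wtau_powR_le (R : realType) (x z b : R) (j : nat) : 0 < x -> 0 < z ->
  (0 < j)%N -> 0 <= b -> b <= j%:R -> wtau (x ^- (2 * j)) j z <= 1 ->
  wtau (x ^- (2 * j)) j z * z `^ (- b) <= x `^ (- (2 * b)).
Proof.
move=> x0 z0 j0 b0 bj.
pose w := z / x ^+ 2.
have w0 : 0 < w by rewrite divr_gt0// exprn_gt0.
have tE : wtau (x ^- (2 * j)) j z = w ^+ j.
  by rewrite /wtau /w exprM expr_div_n mulrC.
rewrite tE => w1.
have {}w1 : w <= 1 by rewrite -(@expr_le1 _ j)// ltW.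
have h : w ^+ j <= w `^ b.
  by rewrite -(powR_mulrn _ (ltW w0)); apply: ger_powR => //; rewrite w0.
apply: (le_trans (ler_wpM2r (powR_ge0 _ _) h)).
rewrite (_ : z = w * x ^+ 2); last by rewrite /w divfK// gt_eqF// exprn_gt0.
rewrite (powRM _ (ltW w0) (ltW (exprn_gt0 2 x0))) mulrA -powRD_pos// subrr powRr0 mul1r.
by rewrite -(powR_mulrn _ (ltW x0)) -powRrM mulrN.
Qed.

(** Each of the three terms has its own reason to be small after integration over a cube of volume
    [(2r)^N]: the first is O(e), the last is O(r^-2), and the middle one vanishes by dominated
    convergence for fixed [e]. It matters that [c] is chosen before [e]. The bound on [k] brings
    [(1 + z) wB] down to order [z^(-N/2 - 1)]. *)
Lemma cutoff_error (R : realType) (N : nat) (a q dl K M C : R) (n j k : nat) :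
  let ms := 2 * a - N%:R / 2 in
  0 < dl -> 0 <= K -> K = n%:R - ms -> 0 < q -> a * q = N%:R / 2 ->
  2 * a + 2 <= k%:R -> (N + 2 <= 2 * j)%N -> (k <= n)%N -> (0 < n)%N -> 0 <= C ->
  exists2 c, 0 <= c & forall e, 0 < e -> exists2 Ce, 0 <= Ce &
  forall r z x, 1 <= r -> 0 <= z -> `|x| <= M -> (1 <= z -> `|x| * z `^ a <= C) ->
  let t := wtau (r ^- (2 * j)) j z in t <= 1 ->
  t * ((wA dl K n 0 z + wA dl K n 1 z) * x ^+ 2 + (1 + z) * wB dl K n k z) <=
  c * (e / r ^+ N) + Ce * (t * `|x| `^ q) + c / r ^+ (N + 2).
Proof.
move=> ms d0 K0 KE q0 aq ka jN kn n0 C0.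
pose d := dl `^ (- K); have dd0 : 0 <= d by exact: powR_ge0.
pose c := 2 * d + (2 * M ^+ 2 + 2).
have M20 := sqr_ge0 M.
exists c; first by rewrite /c; lra.
move=> e e0.
have Ce : 0 <= C ^+ 2 * e `^ (- (q / 2)) := mulr_ge0 (sqr_ge0 C) (powR_ge0 _ _).
have d2 : 0 <= 2 * d by exact: mulr_ge0.
exists (2 * d * (C ^+ 2 * e `^ (- (q / 2)))); first exact: mulr_ge0.
move=> r z x r1 z0 xM xC t t1.
have r0 : 0 < r by exact: lt_le_trans r1.
have rho0 : 0 <= r ^- (2 * j) by rewrite invr_ge0 exprn_ge0// ltW.
have t0 : 0 <= t by exact: wtau_ge0.
have x2M : x ^+ 2 <= M ^+ 2.
  by rewrite -(real_normK (num_real x)) lerXn2r ?nnegrE// (le_trans _ xM).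
have x20 := sqr_ge0 x.
have j0 : (0 < j)%N.
  by move: jN; case: (j) => //; rewrite muln0 addn2.
have rN : 0 <= e / r ^+ N by rewrite divr_ge0 ?exprn_ge0// ltW.
have rN2 : 0 <= (r ^+ (N + 2))^-1 by rewrite invr_ge0 exprn_ge0// ltW.
have xq := powR_ge0 `|x| q.
(* Below 1 the decay estimate says nothing, but there [t] itself is at most [r^(-2j)], hence at most
   [r^(-N-2)]. *)
have [z1|z1] := ltP z 1.
  have zw l : z ^+ l * wv dl K z <= 1.
    by apply: mulr_ile1; rewrite ?wv_ge0 ?exprn_ge0 ?wv_le1// exprn_ile1// ltW.
  have A0 := zw (n - 0)%N; have A1 := zw (n - 1)%N; have B := zw (n - k)%N.
  have B0 : 0 <= z ^+ (n - k) * wv dl K z by rewrite mulr_ge0 ?wv_ge0 ?exprn_ge0.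
  have h1 : (wA dl K n 0 z + wA dl K n 1 z) * x ^+ 2 + (1 + z) * wB dl K n k z <=
      2 * M ^+ 2 + 2.
    apply: lerD.
      apply: (@le_trans _ _ (2 * x ^+ 2)); last by clear -x2M; lra.
      by apply: ler_wpM2r => //; rewrite /wA; clear -A0 A1; lra.
    apply: (@le_trans _ _ (2 * 1)); last by rewrite mulr1.
    by apply: ler_pM => //; [clear -z0; lra|clear -z1; lra].
  have tr : t <= (r ^+ (N + 2))^-1.
    apply: (@le_trans _ _ (r ^- (2 * j))).
      by rewrite /t /wtau ler_piMr// exprn_ile1// ltW.
    by rewrite lef_pV2 ?posrE ?exprn_gt0// ler_weXn2l.
  have h2 := ler_wpM2l t0 h1.
  have M2 : 0 <= 2 * M ^+ 2 + 2 by clear -M20; lra.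
  have h3 := ler_wpM2r M2 tr.
  have h4 : 0 <= 2 * d * (r ^+ (N + 2))^-1 by apply: mulr_ge0 => //; exact: mulr_ge0.
  have h5 : 0 <= c * (e / r ^+ N) by apply: mulr_ge0 => //; rewrite /c; clear -dd0 M2; lra.
  have h6 : 0 <= 2 * d * (C ^+ 2 * e `^ (- (q / 2))) * (t * `|x| `^ q).
    by apply: mulr_ge0; exact: mulr_ge0.
  by clear -h2 h3 h4 h5 h6; rewrite /c in h5 *; lra.
have zp : 0 < z by exact: lt_le_trans z1.
have jb : N%:R / 2 + 1 <= j%:R :> R.
  have : (N + 2)%:R <= (2 * j)%:R :> R by rewrite ler_nat.
  by rewrite natrD natrM; clear; lra.
have Nge : 0 <= N%:R :> R by [].
have T1 : t * z `^ (- (N%:R / 2)) <= (r ^+ N)^-1.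
  rewrite -(powR_mulrn _ (ltW r0)) -powRN.
  rewrite [in leRHS](_ : N%:R = 2 * (N%:R / 2)); last by field.
  by apply: wtau_powR_le => //; clear -jb Nge; lra.
have T2 : t * z `^ (- (N%:R / 2 + 1)) <= (r ^+ (N + 2))^-1.
  rewrite -(powR_mulrn _ (ltW r0)) -powRN.
  rewrite [in leRHS](_ : (N + 2)%:R = 2 * (N%:R / 2 + 1)); last by rewrite natrD; field.
  by apply: wtau_powR_le => //; clear -jb Nge; lra.
have A0 : wA dl K n 0 z <= d * z `^ ms.
  by have := wzv_le d0 K0 zp KE (leq0n n); rewrite subr0.
have A1 : wA dl K n 1 z <= d * z `^ ms.
  apply: (le_trans (wzv_le d0 K0 zp KE n0)); apply: ler_wpM2l => //.
  by apply: ler_powR => //; rewrite gerBl.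
have B : (1 + z) * wB dl K n k z <= 2 * d * z `^ (- (N%:R / 2 + 1)).
  have B0 : 0 <= z ^+ (n - k) * wv dl K z by rewrite mulr_ge0 ?wv_ge0 ?exprn_ge0.
  apply: (@le_trans _ _ (2 * z * (d * z `^ (ms - k%:R)))).
    apply: ler_pM => //; [clear -z0; lra|clear -z1; lra|exact: wzv_le].
  rewrite (_ : 2 * z * _ = 2 * d * (z `^ 1 * z `^ (ms - k%:R))); last first.
    by rewrite powRr1//; ring.
  rewrite -powRD_pos//; apply: ler_wpM2l; first exact: mulr_ge0.
  by apply: ler_powR => //; rewrite /ms; clear -ka; lra.
(* In terms of the normalized size [Y <= C] both quantities have the same factor:
   [z^ms x^2 = z^(-N/2) Y^2] and [|x|^q = z^(-N/2) Y^q]. If [Y^2 <= e] the first error term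
   suffices; otherwise [1 <= e^(-q/2) Y^q] brings in the integrable one. *)
pose Y := `|x| * z `^ a.
have Y0 : 0 <= Y by rewrite mulr_ge0// powR_ge0.
have YC : Y <= C by exact: xC.
have YE : z `^ ms * x ^+ 2 = z `^ (- (N%:R / 2)) * Y ^+ 2.
  rewrite /Y exprMn (real_normK (num_real x)) -(powR_mulrn 2 (powR_ge0 z a)).
  rewrite -powRrM [RHS]mulrCA -powRD_pos// [RHS]mulrC.
  by rewrite (_ : - _ + a * 2%:R = ms)// /ms; ring.
have z20 := powR_ge0 z (- (N%:R / 2)).
have main : t * (z `^ ms * x ^+ 2) <= e / r ^+ N +
    C ^+ 2 * e `^ (- (q / 2)) * (t * `|x| `^ q).
  rewrite YE.
  have [Ye|Ye] := leP (Y ^+ 2) e.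
    have h1 := ler_wpM2l (mulr_ge0 t0 z20) Ye.
    have h2 := ler_wpM2r (ltW e0) T1.
    have h3 : 0 <= C ^+ 2 * e `^ (- (q / 2)) * (t * `|x| `^ q).
      by apply: mulr_ge0 => //; exact: mulr_ge0.
    by clear -h1 h2 h3; lra.
  have Yq : e `^ (q / 2) <= Y `^ q.
    rewrite [q in leRHS](_ : q = 2%:R * (q / 2)); last by field.
    rewrite [leRHS]powRrM powR_mulrn//; apply: ge0_ler_powR; rewrite ?nnegrE ?exprn_ge0//.
    - by rewrite divr_ge0// ltW.
    - exact: ltW.
    - exact: ltW.
  have xqE : `|x| `^ q = z `^ (- (N%:R / 2)) * Y `^ q.
    rewrite /Y powRM ?powR_ge0// -powRrM aq mulrCA -powRD_pos//.
    by rewrite addNr powRr0 mulr1.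
  have Y2 : Y ^+ 2 <= C ^+ 2 by rewrite lerXn2r ?nnegrE.
  have h1 : 1 <= e `^ (- (q / 2)) * Y `^ q.
    rewrite powRN mulrC ler_pdivlMr ?powR_gt0// mul1r//.
  have h2 := ler_wpM2l (mulr_ge0 t0 z20) Y2.
  have w0 : 0 <= t * z `^ (- (N%:R / 2)) * C ^+ 2.
    by apply: mulr_ge0; [exact: mulr_ge0|exact: sqr_ge0].
  have h3 := ler_wpM2l w0 h1.
  rewrite xqE.
  by clear -h2 h3 rN; lra.
have tA0 := ler_wpM2l (mulr_ge0 t0 x20) A0.
have tA1 := ler_wpM2l (mulr_ge0 t0 x20) A1.
have tB := ler_wpM2l t0 B.
have h1 := ler_wpM2l d2 main.
have h2 := ler_wpM2l d2 T2.
have M2 : 0 <= 2 * M ^+ 2 + 2 by clear -M20; lra.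
have h3 := mulr_ge0 M2 rN.
have h4 := mulr_ge0 M2 rN2.
by clear -tA0 tA1 tB h1 h2 h3 h4; rewrite /c; lra.
Qed.

(** * The contradiction *)

(** No unique continuation is invoked: at a farthest point where [|phi| >= e] the solution is
    nonzero, hence also at a slightly farther one. Lowering the threshold from [c] to [e] ensures
    that such points exist. *)
Lemma outer_point (R : realType) (N : nat) (phi : 'rV[R]_N -> R) (c : R) :
  (0 < N)%N -> continuous phi -> 0 < c -> (exists y, phi y <> 0) ->
  (forall e : R, 0 < e -> exists r : R, forall y, r <= sqn y -> `|phi y| <= e) ->
  exists y1 (z0 : R), [/\ 0 <= z0, z0 < sqn y1, phi y1 != 0 &
    forall y, z0 < sqn y -> `|phi y| <= c].
Proof.
move=> N0 cphi c0 [ys /eqP ys0] van.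
pose e := Num.min c `|phi ys|.
have e0 : 0 < e by rewrite lt_min c0 normr_gt0.
have e20 : 0 < e / 2 by rewrite divr_gt0.
have [r rP] := van _ e20.
have cn : continuous (fun y => `|phi y|) by apply: (cont_comp cphi); exact: norm_continuous.
pose S := [set y | e <= `|phi y|].
have S0 : S !=set0 by exists ys; rewrite /S /= ge_min lexx orbT.
have clS : closed S.
  rewrite (_ : S = (fun y => `|phi y|) @^-1` [set x | e <= x])//.
  by apply: preimage_closed; [move=> x _; exact: cn|exact: closed_ge].
have cS : compact S.
  apply: (subclosed_compact clS (@box_compact R N (`|r| + 1))) => y Sy i /=.
  rewrite leNgt; apply/negP => ri.
  have h := sqn_gt (addr_ge0 (normr_ge0 r) ler01) ri.
  have : `|phi y| <= e / 2.
    apply: rP; apply: le_trans (ltW h).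
    have := ler_norm r; have := normr_ge0 r; clear; nra.
  by move: Sy; rewrite /S /=; clear -e0; lra.
have [y0 y0S y0P] := compact_EVT_max S0 cS (continuous_subspaceT (@continuous_sqn R N)).
move: y0S; rewrite inE /S /= => y0S.
have phi0 : 0 < `|phi y0| by exact: lt_le_trans y0S.
have [d d0 dP] := near_coord y0 cphi phi0.
pose i0 := Ordinal N0.
(* The sign is chosen so that the displacement increases [sqn], even when the coordinate of [y0]
   vanishes. *)
pose s : R := if 0 <= y0 0 i0 then 1 else -1.
pose y1 : 'rV[R]_N := y0 + (s * (d / 2)) *: delta_mx 0 i0.
have s1 : `|s| = 1 by rewrite /s; case: ifP => _; rewrite ?normrN normr1.
have sy : 0 <= s * y0 0 i0.
  by rewrite /s; case: (leP 0 (y0 0 i0)) => h; rewrite ?mul1r// mulN1r; clear -h; lra.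
have ss : s ^+ 2 = 1 by rewrite -(real_normK (num_real s)) s1 expr1n.
have y1E : sqn y1 = sqn y0 + (s * y0 0 i0 * d + (d / 2) ^+ 2).
  rewrite /sqn (bigD1 i0)//= [in RHS](bigD1 i0)//=.
  under eq_bigr => i ii0 do rewrite /y1 !mxE (negbTE ii0) andbF mulr0 addr0.
  rewrite /y1 !mxE !eqxx mulr1.
  rewrite (_ : (y0 0 i0 + s * (d / 2)) ^+ 2 =
    y0 0 i0 ^+ 2 + s * y0 0 i0 * d + s ^+ 2 * (d / 2) ^+ 2); last by field.
  by rewrite ss; ring.
exists y1, (sqn y0); split; first exact: sqn_ge0.
- rewrite y1E ltrDl; apply: ltr_wpDl; first by rewrite mulr_ge0// ltW.
  by rewrite exprn_gt0// divr_gt0.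
- have : `|phi y1 - phi y0| < `|phi y0|.
    apply: dP => i; rewrite /y1 !mxE [y0 0 i + _]addrC addrK normrM normrM s1 mul1r.
    have dd : `|d / 2| < d by rewrite gtr0_norm ?divr_gt0//; clear -d0; lra.
    by case: (_ && _); rewrite /= ?normr0 ?normr1 ?mulr1 ?mulr0.
  by apply: contraTneq => ->; rewrite sub0r normrN ltxx.
- move=> y y0y; rewrite leNgt; apply/negP => cy.
  have Sy : y \in S by rewrite inE /S /= ge_min ltW.
  by have := y0P y Sy; rewrite leNgt y0y.
Qed.

Lemma box_around (R : realType) (N : nat) (phi : 'rV[R]_N -> R)
    (y1 : 'rV[R]_N) (z0 : R) : continuous phi -> z0 < sqn y1 -> phi y1 != 0 ->
  exists z1 z2 c d : R, [/\ z0 < z1, 0 < c, 0 < d &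
    forall y : 'rV[R]_N, (forall i, `|y 0 i - y1 0 i| <= d) ->
      z1 <= sqn y <= z2 /\ c <= `|phi y|].
Proof.
move=> cphi zy py.
have p0 : 0 < `|phi y1| / 2 by rewrite divr_gt0// normr_gt0.
have h0 : 0 < (sqn y1 - z0) / 2 by rewrite divr_gt0// subr_gt0.
have [d d0 dP] := near_coord y1 cphi p0.
have [d' d'0 d'P] := near_coord y1 (@continuous_sqn R N) h0.
pose m := Num.min d d' / 2.
have mm : 0 < Num.min d d' by rewrite lt_min d0.
exists ((z0 + sqn y1) / 2), (sqn y1 + (sqn y1 - z0) / 2), (`|phi y1| / 2), m.
split => //; [by clear -zy; lra|by rewrite divr_gt0|].
move=> y hy.
have l1 : Num.min d d' <= d by rewrite ge_min lexx.
have l2 : Num.min d d' <= d' by rewrite ge_min lexx orbT.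
have md : m < d by rewrite /m; clear -mm l1; lra.
have md' : m < d' by rewrite /m; clear -mm l2; lra.
have q1 : `|phi y - phi y1| < `|phi y1| / 2.
  by apply: dP => i; exact: le_lt_trans (hy i) md.
have q2 : `|sqn y - sqn y1| < (sqn y1 - z0) / 2.
  by apply: d'P => i; exact: le_lt_trans (hy i) md'.
split; first by move: q2; rewrite ltr_norml; clear; lra.
have := ler_normD (phi y) (phi y1 - phi y).
by rewrite addrC subrK distrC; clear -q1; lra.
Qed.

(** Adding [q], of integral zero, does not change the integral of [g]. Since [q] may change sign,
    additivity requires [g] to be integrable, and an infinite integral is set apart. *)
Lemma integral_le_balanced (d : measure_display) (T : measurableType d)
    (R : realType) (mu : {measure set T -> \bar R}) (f q g : T -> R) :
  mu.-integrable setT (EFin \o q) -> (\int[mu]_x (q x)%:E = 0)%E ->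
  measurable_fun setT f -> measurable_fun setT g ->
  (forall x, 0 <= f x) -> (forall x, 0 <= g x) -> (forall x, f x <= q x + g x) ->
  (\int[mu]_x (f x)%:E <= \int[mu]_x (g x)%:E)%E.
Proof.
move=> iq q0 mf mg f0 g0 fqg.
have [goo|goo] := ltP (\int[mu]_x (g x)%:E)%E +oo%E; last first.
  by apply: le_trans goo; rewrite leey.
have ig : mu.-integrable setT (EFin \o g).
  apply/integrableP; split; first exact/measurable_EFinP.
  apply: le_lt_trans goo; rewrite le_eqVlt; apply/orP; left; apply/eqP.
  by apply: eq_integral => x _ /=; rewrite ger0_norm.
have mq : measurable_fun setT q by have /measurable_int/measurable_EFinP := iq.
have E : (\int[mu]_x (q x + g x)%:E = \int[mu]_x (g x)%:E)%E.
  rewrite -[RHS]add0e -[in RHS]q0.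
  by under eq_integral do rewrite EFinD; exact: (integralD measurableT iq ig).
rewrite -E; apply: ge0_le_integral => //.
- by move=> x _; rewrite lee_fin.
- exact/measurable_EFinP.
- by apply/measurable_EFinP; exact: measurable_funD.
- by move=> x _; rewrite lee_fin.
Qed.

Lemma geometric_le (R : realType) (a b x y : R) (n0 : nat) : 0 < a -> 0 <= x -> x < y ->
  (forall n, (n0 <= n)%N -> a * y ^+ n <= b * x ^+ n) -> False.
Proof.
move=> a0 x0 xy h.
have y0 : 0 < y by exact: le_lt_trans xy.
have r0 : 0 <= x / y by rewrite divr_ge0// ltW.
have r1 : `|x / y| < 1 by rewrite ger0_norm// ltr_pdivrMr// mul1r.
have /cvgrPdist_lt lim := cvg_geometric b r1.
have [k _ kP] := lim a a0.
have := kP (maxn k n0) (leq_maxl _ _).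
have := h (maxn k n0) (leq_maxr _ _).
set n := maxn k n0.
rewrite -ler_pdivlMr ?exprn_gt0// -mulrA -expr_div_n => h1.
rewrite /= sub0r normrN /geometric /= => h2.
by have := lt_le_trans (le_lt_trans (ler_norm _) h2) h1; rewrite ltxx.
Qed.

Lemma wtau_inv_le (R : realType) (x z : R) (j : nat) : 1 <= x -> 0 <= z ->
  (0 < j)%N -> wtau (x ^- (2 * j)) j z <= z ^+ j / x.
Proof.
move=> x1 z0 j0; have x0 : 0 < x by exact: lt_le_trans x1.
rewrite /wtau mulrC; apply: ler_wpM2l; first exact: exprn_ge0.
rewrite lef_pV2 ?posrE ?exprn_gt0// -[leLHS]expr1 ler_weXn2l// muln_gt0.
exact: j0.
Qed.

Lemma wtau_gt1 (R : realType) (x z : R) (j : nat) : 0 < x -> 0 <= z ->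
  1 < wtau (x ^- (2 * j)) j z -> x ^+ 2 < z.
Proof.
move=> x0 z0; rewrite /wtau mulrC exprM ltr_pdivlMr ?mul1r ?exprn_gt0//.
move=> h; rewrite ltNge; apply/negP => zx; move: h; rewrite ltNge => /negP; apply.
by rewrite lerXn2r ?nnegrE// exprn_ge0// ltW.
Qed.

Lemma wtau_le1 (R : realType) (x z : R) (j : nat) : 0 < x -> 0 <= z -> (0 < j)%N ->
  wtau (x ^- (2 * j)) j z <= 1 -> z <= x ^+ 2.
Proof.
move=> x0 z0 j0; rewrite /wtau mulrC exprM ler_pdivrMr ?mul1r ?exprn_gt0//.
by rewrite ler_pXn2r ?nnegrE ?exprn_ge0 ?(ltW x0).
Qed.

(** Dominated convergence: the truncation at 1 makes [|phi|^q] a dominating function on the whole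
    space, and pointwise [wtau] is at most [z^j / (i + 1)]. *)
Lemma integral_cutoff_lt (R : realType) (N : nat) (q e : R) (j : nat)
    (phi : 'rV[R]_N -> R) : (0 < j)%N -> continuous phi -> in_Lq q phi -> 0 < e ->
  exists i0, forall i, (i0 <= i)%N -> (\int[lebesgueN R N]_t
    (Num.min 1 (wtau (i.+1%:R ^- (2 * j)) j (sqn (tuple_row t)))
      * `|phi (tuple_row t)| `^ q)%:E < e%:E)%E.
Proof.
move=> j0 cphi Lphi e0.
have mf : measurable_fun setT
    (fun t : N.-tuple (measurableTypeR R) => `|phi (tuple_row t)| `^ q).
  by apply: measurable_abs_powR; exact: measurable_continuous_row.
have tau0 i (t : N.-tuple (measurableTypeR R)) :
    0 <= wtau (i.+1%:R ^- (2 * j)) j (sqn (tuple_row t)) :> R.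
  by apply: wtau_ge0; [rewrite invr_ge0 exprn_ge0|exact: sqn_ge0].
apply: (dominated_integral_lt mf Lphi) => //.
- move=> i; apply: measurable_funM => //.
  apply: measurable_minr; first exact: measurable_cst.
  apply: (@measurable_continuous_row R N (fun y => wtau (i.+1%:R ^- (2 * j)) j (sqn y))).
  rewrite /wtau; apply: contM; first exact: contC.
  exact: (contX (@continuous_sqn R N)).
- move=> i t; have := powR_ge0 `|phi (tuple_row t)| q => h.
  rewrite mulr_ge0 ?le_min ?ler01 ?tau0//=.
  by rewrite ler_piMl// ge_min lexx.
- move=> t; set z := sqn _; set x := _ `^ q.
  apply: (@squeeze_cvgr _ _ _ _ (fun=> 0) (fun i => z ^+ j * x * harmonic i)).
  + near=> i; apply/andP; split.
      by rewrite mulr_ge0 ?powR_ge0// le_min ler01 tau0.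
    rewrite mulrAC; apply: ler_wpM2r; first exact: powR_ge0.
    rewrite ge_min; apply/orP; right; apply: wtau_inv_le => //.
      by rewrite ler1n.
    exact: sqn_ge0.
  + exact: cvg_cst.
  + rewrite -[X in _ --> X](mulr0 (z ^+ j * x)); apply: cvgM; first exact: cvg_cst.
    exact: cvg_harmonic.
Unshelve. all: end_near.
Qed.

(** Hides the limit of large radius: all cutoff errors are gathered in one nonnegative function [g]
    of integral at most [e], while the cutoff stays bounded below on [z <= z2]. *)
Lemma exists_cutoff (R : realType) (N : nat) (p q M L C dl K z2 e : R)
    (n j k : nat) (phi : 'rV[R]_N -> R) (d1 : 'I_N -> 'rV[R]_N -> R)
    (d2 : 'I_N -> 'I_N -> 'rV[R]_N -> R) :
  let a := (p - 1)^-1 in let ms := 2 * a - N%:R / 2 in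
  1 < p -> profile p phi d1 d2 -> (forall y, `|phi y| <= M) ->
  0 <= L -> (forall y, dotg d1 y ^+ 2 <= L * sqn y) ->
  0 <= C -> (forall y, 1 <= sqn y -> `|phi y| * sqn y `^ a <= C) ->
  0 < q -> a * q = N%:R / 2 -> in_Lq q phi ->
  0 < dl -> dl * (`|ms| + K + 1) <= 1 / 16 -> 128 * `|ms| + 1 <= K ->
  K = n%:R - ms -> 2 * a + 2 <= k%:R -> (5 <= k)%N -> (k <= n)%N ->
  (N + 2 <= 2 * j)%N -> 0 <= z2 -> 0 < e ->
  exists2 r : R, 1 <= r & exists (rho : R) (QF g : 'rV[R]_N -> R),
  [/\ 0 <= rho,
      wtau rho j z2 <= 1 / 2,
      (lebesgueN R N).-integrable setT (fun t => (QF (tuple_row t))%:E) /\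
        (\int[lebesgueN R N]_t (QF (tuple_row t))%:E = 0)%E,
      [/\ measurable_fun setT (fun t : N.-tuple (measurableTypeR R) => g (tuple_row t)),
        forall y, 0 <= g y & (\int[lebesgueN R N]_t (g (tuple_row t))%:E <= e%:E)%E] &
      forall y, wP rho j k 0 (sqn y) * wA dl K n 0 (sqn y) *
        (K * wr dl (sqn y) * (1 / 8 - `|phi y| `^ (p - 1)) * phi y ^+ 2) <= QF y + g y].
Proof.
move=> a ms p1 prf phiM L0 dL C0 decay q0 aq Lphi d0 dK K0 KE ka k5 kn jN z20 e0.
have k1 : (1 < k)%N by exact: leq_trans k5.
have n0 : (0 < n)%N by apply: leq_trans kn; exact: leq_trans k5.
have n4 : (4 <= n)%N by apply: leq_trans kn; exact: leq_trans k5.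
have j0 : (0 < j)%N by move: jN; case: (j) => //; rewrite muln0 addn2.
have ms0 := normr_ge0 ms.
have K1 : 0 <= K by clear -ms0 K0; lra.
have [C1 C10 low] := quadratic_form_lower j k1 kn p1 d0 L0 dK K0 phiM dL.
have [c' c'0 err] := cutoff_error M d0 K1 KE q0 aq ka jN kn n0 C0.
(* The power of 2 comes from the volume [(2r)^N] of the cube carrying the constant part of [g].
   Three contributions share [e] equally. *)
pose T := C1 * c' * 2 ^+ N.
have T0 : 0 <= T by rewrite !mulr_ge0.
pose eta := e / (3 * (T + 1)).
have T1 : 0 < 3 * (T + 1) by clear -T0; lra.
have eta0 : 0 < eta by rewrite divr_gt0.
have [Ce Ce0 {}err] := err eta eta0.
pose U := C1 * Ce; have U0 : 0 <= U by exact: mulr_ge0.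
have U1 : 0 < 3 * (U + 1) by clear -U0; lra.
have e'0 : 0 < e / (3 * (U + 1)) by rewrite divr_gt0.
have cphi := profile_c0 prf.
have [i0 i0P] := integral_cutoff_lt j0 cphi Lphi e'0.
have e3 : 0 <= 3 * T / e by rewrite divr_ge0 ?mulr_ge0// ltW.
have zj : 0 <= z2 ^+ j by exact: exprn_ge0.
(* The first summand forces [wtau <= 1/2] at [z2], the second makes [T / r^2] at most [e / 3]. *)
pose bd := 2 * z2 ^+ j + 3 * T / e.
have [i1 i1P] : exists i1 : nat, bd < i1%:R.
  exists (Num.bound bd); apply: archi_boundP.
  by apply: addr_ge0 => //; exact: mulr_ge0.
pose i := maxn i0 i1; pose r : R := i.+1%:R.
have r1 : 1 <= r by rewrite ler1n.
have r0 : 0 < r by exact: lt_le_trans r1.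
have rbd : bd < r.
  by apply: lt_trans i1P _; rewrite ltr_nat ltnS leq_maxr.
pose rho : R := r ^- (2 * j).
have rho0 : 0 <= rho by rewrite invr_ge0 exprn_ge0// ltW.
pose QF := quadratic_form p phi d1 (weight dl K rho n j k) (weight1 N a dl K rho n j k)
  (weightW a dl K rho n j k) (weightW1 N a dl K rho n j k)
  (weightV N a dl K rho n j k) (weightV1 N a dl K rho n j k).
have [cQF iQF] : csupp r QF /\ (\int[lebesgueN R N]_t (QF (tuple_row t))%:E = 0)%E.
  rewrite /QF; apply: (weighted_identity p1 (ltW r0) prf (weight_C1 rho j d0 KE n4 k5)
    (weightW_C1 rho j d0 KE n4 k5) (weightV_C1 rho j d0 KE n4 k5)).
    by move=> z; exact: weightW_eq.
  move=> z rz; apply: weights_eq0 => //.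
  rewrite /wtau /rho mulrC exprM ltr_pdivlMr ?mul1r ?exprn_gt0//.
  by rewrite ltr_pXn2r ?nnegrE ?exprn_ge0 ?(ltW r0)// ltW// (le_lt_trans _ rz)// exprn_ge0// ltW.
pose kap := C1 * c' * (eta / r ^+ N) + C1 * c' / r ^+ (N + 2).
have kap0 : 0 <= kap.
  have Cc : 0 <= C1 * c' by exact: mulr_ge0.
  have rn m : 0 <= (r ^+ m)^-1 by rewrite invr_ge0 exprn_ge0// ltW.
  by apply: addr_ge0; apply: mulr_ge0 => //; apply: mulr_ge0 => //; exact: ltW.
pose G (y : 'rV[R]_N) : R := Num.min 1 (wtau rho j (sqn y)) * `|phi y| `^ q.
pose g (y : 'rV[R]_N) : R :=
  kap * (\1_[set x : 'rV[R]_N | forall i, `|x 0 i| <= r] y) + U * G y.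
have tau0 y : 0 <= wtau rho j (sqn y) by apply: wtau_ge0 => //; exact: sqn_ge0.
have G0 y : 0 <= G y by rewrite mulr_ge0 ?powR_ge0// le_min ler01 tau0.
have g0 y : 0 <= g y.
  by apply: addr_ge0; apply: mulr_ge0.
have gE (t : N.-tuple (measurableTypeR R)) :
    g (tuple_row t) = kap * \1_(cube r) t + U * G (tuple_row t).
  rewrite /g /indic; congr (kap * (_ : bool)%:R + _).
  apply/idP/idP; rewrite !inE /= => h l; have := h l; by rewrite mxE.
have mG : measurable_fun setT (fun t : N.-tuple (measurableTypeR R) => G (tuple_row t)).
  apply: measurable_funM; last first.
    by apply: measurable_abs_powR; exact: measurable_continuous_row.
  apply: measurable_minr; first exact: measurable_cst.
  apply: (@measurable_continuous_row R N (fun y => wtau rho j (sqn y))).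
  by rewrite /wtau; apply: contM; [exact: contC|exact: (contX (@continuous_sqn R N))].
have m1 : measurable_fun setT (fun t : N.-tuple (measurableTypeR R) =>
    kap * \1_(cube r) t : R).
  apply: measurable_funM; first exact: measurable_cst.
  by apply: measurable_indic; exact: measurable_cube.
have m2 : measurable_fun setT (fun t : N.-tuple (measurableTypeR R) =>
    U * G (tuple_row t)) by apply: measurable_funM => //; exact: measurable_cst.
exists r => //.
exists rho, QF, g.
split => //.
- apply: (le_trans (wtau_inv_le r1 z20 j0)).
  by rewrite ler_pdivrMr//; clear -rbd e3; rewrite /bd in rbd; lra.
- by split => //; exact: csupp_integrable (ltW r0) cQF.
- split.
  + rewrite (_ : (fun t => _) = fun t => kap * \1_(cube r) t + U * G (tuple_row t)).
      exact: measurable_funD.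
    by apply/funext => t; exact: gE.
  + exact: g0.
  under eq_integral do rewrite gE EFinD.
  rewrite ge0_integralD//=; last 4 first.
  + by move=> t _; rewrite lee_fin mulr_ge0.
  + exact/measurable_EFinP.
  + by move=> t _; rewrite lee_fin mulr_ge0.
  + exact/measurable_EFinP.
  rewrite integral_scale_indic//; last exact: measurable_cube.
  rewrite /= (lebesgueN_cubeE _ (ltW r0)) -EFinM.
  under [X in (_ + X)%E]eq_integral do rewrite EFinM.
  rewrite ge0_integralZl_EFin//; last 2 first.
  + by move=> t _; rewrite lee_fin.
  + exact/measurable_EFinP.
  have h := ltW (i0P i (leq_maxl _ _)).
  have U0' : (0 <= U%:E)%E by rewrite lee_fin.
  apply: (le_trans (leeD2l _ (lee_wpmul2l U0' h))).
  rewrite -EFinM -EFinD lee_fin.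
  have h1 : U * (e / (3 * (U + 1))) <= e / 3.
    rewrite mulrA ler_pdivrMr//.
    by clear -U0 e0; lra.
  have h2 : kap * (2 * r) ^+ N = T * eta + T / r ^+ 2.
    rewrite /kap /T exprMn exprD.
    by field; rewrite gt_eqF//= expf_neq0// gt_eqF.
  have h3 : T * eta <= e / 3.
    rewrite /eta mulrA ler_pdivrMr//.
    by clear -T0 e0; lra.
  have h4 : T / r ^+ 2 <= e / 3.
    rewrite ler_pdivrMr ?exprn_gt0//.
    have h5 : 3 * T / e < r by clear -rbd zj; rewrite /bd in rbd; lra.
    have h6 : 3 * T < r * e by rewrite -ltr_pdivrMr.
    have h7 : r * e <= r ^+ 2 * e by rewrite ler_pM2r// expr2 ler_peMr// ltW.
    by clear -h6 h7; lra.
  rewrite h2; move: h1 h3 h4; move: (T * eta) (T / r ^+ 2) (U * (e / (3 * (U + 1)))).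
  by clear; move=> *; lra.
move=> y; set z := sqn y.
have z0 : 0 <= z by exact: sqn_ge0.
have [t1|t1] := leP (wtau rho j z) 1; last first.
  rewrite wP_eq0 ?mul0r//; last exact: leq_trans k5.
  rewrite cQF.2 ?add0r ?g0//.
  exact: (wtau_gt1 (j := j)).
have := low rho y rho0 t1; rewrite -/z -/a -/QF.
have := err r z (phi y) r1 z0 (phiM y) (decay y) t1.
have -> : g y = kap + U * (wtau rho j z * `|phi y| `^ q).
  rewrite /g /G -/z min_r// indicE mem_set ?mulr1// => l.
  have zr := wtau_le1 r0 z0 j0 t1.
  rewrite leNgt; apply/negP => h.
  by have := sqn_gt (ltW r0) h; rewrite ltNge zr.
rewrite -/rho.
set E := (_ + (1 + z) * _); set X := wP _ _ _ _ _ * _ * _.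
move=> h1 h2.
have h3 := ler_wpM2l C10 h1.
by clear -h2 h3; rewrite /kap /U; lra.
Qed.

Lemma dotg_le (R : realType) (N : nat) (L : R) (d1 : 'I_N -> 'rV[R]_N -> R) :
  (forall i y, `|d1 i y| <= L) -> forall y, dotg d1 y ^+ 2 <= (N%:R * L) ^+ 2 * sqn y.
Proof.
move=> dL y; have s0 := sqn_ge0 y.
have L0 (i : 'I_N) : 0 <= L by exact: le_trans (dL i y).
have h : `|dotg d1 y| <= N%:R * L * Num.sqrt (sqn y).
  apply: (le_trans (ler_norm_sum _ _ _)).
  apply: (@le_trans _ _ (\sum_(i < N) L * Num.sqrt (sqn y))); last first.
    by rewrite sumr_const card_ord -[leLHS]mulr_natl mulrA.
  apply: ler_sum => i _; rewrite normrM mulrC.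
  apply: ler_pM => //.
  by rewrite -sqrtr_sqr ler_sqrt// sqn_ge_coord.
rewrite -(real_normK (num_real (dotg d1 y))) -[in leRHS](sqr_sqrtr s0) -exprMn.
by rewrite lerXn2r ?nnegrE// (le_trans _ h).
Qed.

Lemma wr_ge (R : realType) (dl z x : R) : 0 < dl -> dl <= 1 -> 0 <= z -> z <= x ->
  (1 + x)^-1 <= wr dl z.
Proof.
move=> d0 d1 z0 zx; have u0 := wu_gt0 d0 z0.
have dz : dl * z <= x by apply: le_trans zx; rewrite ler_piMl.
have x0 : 0 <= x by exact: le_trans zx.
rewrite /wr lef_pV2 ?posrE ?sqrtr_gt0//; last by clear -x0; lra.
have x1 : 0 <= 1 + x by clear -x0; lra.
rewrite -(ger0_norm x1) -sqrtr_sqr ler_sqrt ?sqr_ge0//.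
have := mulr_ge0 x0 x0; clear -x0 dz; lra.
Qed.

Lemma wv_le_origin (R : realType) (dl K z : R) : 0 < dl -> 0 <= K -> 0 <= z ->
  wv dl K z <= 2 `^ (- (2 * K)).
Proof.
move=> d0 K0 z0; rewrite /wv !powRN lef_pV2 ?posrE ?powR_gt0//.
have s1 : 1 <= Num.sqrt (1 + dl * z).
  by rewrite -[leLHS]sqrtr1 ler_sqrt ?(ltW (wu_gt0 d0 z0))// lerDl mulr_ge0// ltW.
apply: ge0_ler_powR; rewrite ?nnegrE ?mulr_ge0//; clear -s1; lra.
Qed.

(** From [u <= 1 + dl x / 2] follows [1 + u <= 2 exp(dl x / 4)]. Raised to the power [2K], the
    exponential stays below [exp(x / 32)] because [dl * K <= 1/16]: the loss against [2^(-2K)] does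
    not depend on [n]. *)
Lemma wv_ge_exp (R : realType) (dl K z x : R) : 0 < dl -> 0 <= K -> dl * K <= 1 / 16 ->
  0 <= z -> z <= x -> 2 `^ (- (2 * K)) * expR (- (x / 32)) <= wv dl K z.
Proof.
move=> d0 K0 dK z0 zx; have u0 := wu_gt0 d0 z0.
have x0 : 0 <= x by exact: le_trans zx.
have s0 := sqrtr_ge0 (1 + dl * z).
have h : 1 + Num.sqrt (1 + dl * z) <= 2 * expR (dl * x / 4).
  have h1 : Num.sqrt (1 + dl * z) <= 1 + dl * x / 2.
    have y0 : 0 <= dl * x by rewrite mulr_ge0// ltW.
    have y1 : 0 <= 1 + dl * x / 2 by clear -y0; lra.
    rewrite -(ger0_norm y1) -sqrtr_sqr ler_sqrt ?sqr_ge0//.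
    have h2 : dl * z <= dl * x by rewrite ler_pM2l.
    by have := sqr_ge0 (dl * x); clear -y0 h2; lra.
  by have := expR_ge1Dx (dl * x / 4); clear -h1; lra.
have e0 := expR_gt0 (dl * x / 4).
have hK : (1 + Num.sqrt (1 + dl * z)) `^ (2 * K) <= (2 * expR (dl * x / 4)) `^ (2 * K).
  by apply: ge0_ler_powR; rewrite ?nnegrE ?mulr_ge0// ?addr_ge0// ltW.
have p2 : 0 < 2 `^ (2 * K) :> R by rewrite powR_gt0.
have eK : expR (dl * x / 4) `^ (2 * K) <= expR (x / 32).
  rewrite /powR gt_eqF// expRK ler_expR.
  by have := ler_wpM2l x0 dK; clear; lra.
rewrite /wv !powRN expRN -invfM lef_pV2 ?posrE ?mulr_gt0 ?expR_gt0 ?powR_gt0 ?ltr_pwDl//.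
apply: (le_trans hK); rewrite powRM ?(ltW e0)// ler_pM2l//.
Qed.

(** The integral of the form is zero. Beyond [z0] its lower bound is nonnegative, because
    [1/8 - 1/16 > 0], and on the box around [y1] it is at least [(1/2)^k k1]; inside [z0] it is at
    least [- k2]. The cutoff errors cost an arbitrary [e], hence nothing. *)
Lemma weight_comparison (R : realType) (N : nat) (p q M L C dl K : R)
    (n j k : nat) (phi : 'rV[R]_N -> R) (d1 : 'I_N -> 'rV[R]_N -> R)
    (d2 : 'I_N -> 'I_N -> 'rV[R]_N -> R) (y1 : 'rV[R]_N) (z0 z1 z2 c d k1 k2 : R) :
  let a := (p - 1)^-1 in let ms := 2 * a - N%:R / 2 in
  1 < p -> profile p phi d1 d2 -> (forall y, `|phi y| <= M) ->
  0 <= L -> (forall y, dotg d1 y ^+ 2 <= L * sqn y) ->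
  0 <= C -> (forall y, 1 <= sqn y -> `|phi y| * sqn y `^ a <= C) ->
  0 < q -> a * q = N%:R / 2 -> in_Lq q phi ->
  0 < dl -> dl * (`|ms| + K + 1) <= 1 / 16 -> 128 * `|ms| + 1 <= K ->
  K = n%:R - ms -> 2 * a + 2 <= k%:R -> (5 <= k)%N -> (k <= n)%N ->
  (N + 2 <= 2 * j)%N ->
  0 <= z0 -> (forall y, z0 < sqn y -> `|phi y| `^ (p - 1) <= 1 / 16) ->
  z0 < z1 -> 0 < c -> 0 < d ->
  (forall y : 'rV[R]_N, (forall i, `|y 0 i - y1 0 i| <= d) ->
    z1 <= sqn y <= z2 /\ c <= `|phi y|) ->
  0 <= k1 -> 0 <= k2 ->
  (forall z, z1 <= z <= z2 -> k1 <= wA dl K n 0 z * (K * wr dl z / 16 * c ^+ 2)) ->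
  (forall z, 0 <= z <= z0 -> wA dl K n 0 z * (K * (M `^ (p - 1) * M ^+ 2)) <= k2) ->
  (1 / 2) ^+ k * k1 * (2 * d) ^+ N <= k2 * (2 * (z0 + 1)) ^+ N.
Proof.
move=> a ms p1 prf phiM L0 dL C0 decay q0 aq Lphi d0 dK K0 KE ka k5 kn jN z00 out
  z01 c0 dd0 boxP k10 k20 k1P k2P.
have ms0 := normr_ge0 ms.
have K1 : 0 < K by clear -ms0 K0; lra.
have z20 : 0 <= z2.
  have [|/andP[h1 h2] _] := boxP y1; first by move=> i; rewrite subrr normr0 ltW.
  by clear -h1 h2 z00 z01; lra.
apply/ler_addgt0Pr => e e0.
have [r r1 [rho [QF [g [rho0 t2 [iQ iQ0] [mg g0 ig] low]]]]] :=
  exists_cutoff p1 prf phiM L0 dL C0 decay q0 aq Lphi d0 dK K0 KE ka k5 kn jN z20 e0.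
pose B : set (N.-tuple (measurableTypeR R)) :=
  [set t | forall i, y1 0 i - d <= tnth t i <= y1 0 i + d].
have mB : measurable B.
  apply: (@measurable_tuple_box R N (fun i => [set x : R | y1 0 i - d <= x <= y1 0 i + d])) => i.
  rewrite [X in measurable X](_ : _ = `[y1 0 i - d, y1 0 i + d]%classic).
    exact: measurable_itv.
  by apply/seteqP; split => x /=; rewrite in_itv.
have vB : lebesgueN R N B = ((2 * d) ^+ N)%:E.
  rewrite /B (lebesgueN_cube (a := fun i => y1 0 i - d) (b := fun i => y1 0 i + d)).
    congr (_%:E); rewrite (eq_bigr (fun=> 2 * d)) => [|i _]; last by ring.
    by rewrite prodr_const card_ord.
  by move=> i; clear -dd0; lra.
have z10 : 0 <= z0 + 1 by clear -z00; lra.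
have h20 : 0 <= (1 / 2) ^+ k * k1 by rewrite mulr_ge0 ?exprn_ge0 ?divr_ge0.
(* Half-side [z0 + 1] suffices to contain the region [sqn y <= z0], since [(z0 + 1)^2] exceeds
   [z0]. *)
have mA := @measurable_cube R N (z0 + 1).
have key (y : 'rV[R]_N) (t : N.-tuple (measurableTypeR R)) : y = tuple_row t ->
    (1 / 2) ^+ k * k1 * \1_B t <= QF y + (k2 * \1_(cube (z0 + 1)) t + g y).
  move=> yE.
  suff : (1 / 2) ^+ k * k1 * \1_B t <= wP rho j k 0 (sqn y) * wA dl K n 0 (sqn y) *
        (K * wr dl (sqn y) * (1 / 8 - `|phi y| `^ (p - 1)) * phi y ^+ 2)
        + k2 * \1_(cube (z0 + 1)) t.
    by have := low y; set u := wP _ _ _ _ _ * _ * _; clear; lra.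
  have zz0 := sqn_ge0 y; have P0 := wP_ge0 rho (sqn y) j k 0.
  have P1 := wP_le1 j k 0 rho0 zz0; have A0 := wA_ge0 dl K n 0 zz0.
  have r0 := wr_gt0 d0 zz0; have r1' := wr_le1 d0 zz0.
  have x20 := sqr_ge0 (phi y).
  have f0 := powR_ge0 `|phi y| (p - 1).
  have B_ : B t -> z1 <= sqn y <= z2 /\ c <= `|phi y|.
    move=> Bt; apply: boxP => i; rewrite yE mxE ler_distl.
    by have := Bt i; clear; lra.
  have [zz|zz] := leP (sqn y) z0.
    rewrite !indicE memNset; last first.
      by move/B_ => [/andP[h _] _]; have := le_lt_trans (le_trans h zz) z01; rewrite ltxx.
    rewrite mem_set; last first.
      move=> i; rewrite leNgt; apply/negP => h.
      have hh : `|y 0 i| = `|tnth t i| by rewrite yE mxE.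
      rewrite -hh in h; have := lt_trans h; have := sqn_gt z10 h.
      have := mulr_ge0 z00 z00; clear -zz z00; lra.
    rewrite mulr0 mulr1.
    have M0 : 0 <= M by exact: le_trans (phiM 0).
    have fF : `|phi y| `^ (p - 1) <= M `^ (p - 1).
      by apply: ge0_ler_powR; rewrite ?nnegrE// subr_ge0 ltW.
    have x2M : phi y ^+ 2 <= M ^+ 2.
      by rewrite -(real_normK (num_real (phi y))) lerXn2r ?nnegrE.
    have q1 : `|phi y| `^ (p - 1) * phi y ^+ 2 <= M `^ (p - 1) * M ^+ 2.
      by apply: ler_pM.
    have q2 : wP rho j k 0 (sqn y) * wr dl (sqn y) <= 1.
      by apply: mulr_ile1 => //; exact: ltW.
    have zin : 0 <= sqn y <= z0 by rewrite zz0.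
    have q3 := k2P _ zin.
    have AK : 0 <= wA dl K n 0 (sqn y) * K by rewrite mulr_ge0// ltW.
    have PR : 0 <= wP rho j k 0 (sqn y) * wr dl (sqn y) by rewrite mulr_ge0// ltW.
    have FM : 0 <= M `^ (p - 1) * M ^+ 2 by rewrite mulr_ge0 ?powR_ge0 ?sqr_ge0.
    have q4 := ler_wpM2l (mulr_ge0 AK PR) q1.
    have q5 := ler_wpM2r FM (ler_wpM2l AK q2).
    have q6 := mulr_ge0 (mulr_ge0 AK PR) x20.
    move: q3 q4 q5 q6.
    move: (`|phi y| `^ (p - 1)) (M `^ (p - 1)) (wA _ _ _ _ _) (wP _ _ _ _ _) (wr _ _).
    by clear => *; lra.
  have f16 := out y zz.
  have i0 : 0 <= k2 * \1_(cube (z0 + 1)) t by rewrite mulr_ge0.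
  have w0 : 0 <= wP rho j k 0 (sqn y) * wA dl K n 0 (sqn y) by exact: mulr_ge0.
  have w1 : 0 <= K * wr dl (sqn y) by rewrite mulr_ge0// ltW.
  have i1 : K * wr dl (sqn y) / 16 * phi y ^+ 2 <=
      K * wr dl (sqn y) * (1 / 8 - `|phi y| `^ (p - 1)) * phi y ^+ 2.
    apply: ler_wpM2r => //; apply: ler_wpM2l => //; clear -f16; lra.
  have i2 := ler_wpM2l w0 i1.
  rewrite -[leLHS]addr0; apply: lerD => //; apply: (le_trans _ i2).
  rewrite indicE; case: (boolP (t \in B)) => tB; last first.
    rewrite mulr0; apply: mulr_ge0 => //; apply: mulr_ge0 => //.
    by rewrite divr_ge0.
  rewrite mulr1; move: tB; rewrite inE => /B_ [zin cy].
  have tt : wtau rho j (sqn y) <= 1 / 2.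
    apply: le_trans t2; rewrite /wtau; apply: ler_wpM2l => //.
    by rewrite lerXn2r ?nnegrE//; case/andP: zin.
  have Pk : (1 / 2) ^+ k <= wP rho j k 0 (sqn y).
    rewrite /wP subn0 lerXn2r ?nnegrE ?le_max ?lexx ?divr_ge0//.
    by apply/orP; right; clear -tt; lra.
  have c2 : c ^+ 2 <= phi y ^+ 2.
    by rewrite -(real_normK (num_real (phi y))) lerXn2r ?nnegrE// ltW.
  rewrite -[leRHS]mulrA; apply: ler_pM => //.
  apply: (le_trans (k1P _ zin)); apply: ler_wpM2l => //.
  by apply: ler_wpM2l => //; rewrite divr_ge0.
have := @integral_le_balanced _ _ R (lebesgueN R N)
  (fun t => (1 / 2) ^+ k * k1 * \1_B t) (fun t => QF (tuple_row t))
  (fun t => k2 * \1_(cube (z0 + 1)) t + g (tuple_row t)) iQ iQ0.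
have m1 : measurable_fun setT (fun t : N.-tuple (measurableTypeR R) =>
    k2 * \1_(cube (z0 + 1)) t : R).
  by apply: measurable_funM; [exact: measurable_cst|exact: measurable_indic].
have i0 t : 0 <= k2 * \1_(@cube R N (z0 + 1)) t by rewrite mulr_ge0.
have mf : measurable_fun setT (fun t => (1 / 2) ^+ k * k1 * \1_B t : R).
  by apply: measurable_funM; [exact: measurable_cst|exact: measurable_indic].
have mh : measurable_fun setT (fun t => k2 * \1_(cube (z0 + 1)) t + g (tuple_row t)).
  exact: measurable_funD.
move=> /(_ mf mh) h.
have {}h : (\int[lebesgueN R N]_t ((1 / 2) ^+ k * k1 * \1_B t)%:E <=
    \int[lebesgueN R N]_t (k2 * \1_(cube (z0 + 1)) t + g (tuple_row t))%:E)%E.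
  apply: h => t; first by rewrite mulr_ge0.
  - by rewrite addr_ge0.
  - exact: key.
rewrite integral_scale_indic//= vB -EFinM in h.
rewrite -lee_fin; apply: (le_trans h).
under eq_integral do rewrite EFinD.
rewrite ge0_integralD//=.
- rewrite integral_scale_indic//= (lebesgueN_cubeE _ z10) -EFinM EFinD.
  exact: leeD2l.
- by move=> t _; rewrite lee_fin.
- exact/measurable_EFinP.
- by move=> t _; rewrite lee_fin.
- exact/measurable_EFinP.
Qed.

Lemma profile_not_in_Lq (R : realType) (N : nat) (p M : R)
    (phi : 'rV[R]_N -> R) (d1 : 'I_N -> 'rV[R]_N -> R)
    (d2 : 'I_N -> 'I_N -> 'rV[R]_N -> R) :
  (0 < N)%N -> 1 < p -> profile p phi d1 d2 -> (forall y, `|phi y| <= M) ->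
  (exists y, phi y <> 0) -> ~ in_Lq (N%:R * (p - 1) / 2) phi.
Proof.
move=> N0 p1 prf phiM nz Lphi.
pose q := N%:R * (p - 1) / 2; pose a := (p - 1)^-1; pose ms := 2 * a - N%:R / 2.
have NR : 0 < N%:R :> R by rewrite ltr0n.
have p10 : 0 < p - 1 by rewrite subr_gt0.
have q0 : 0 < q by rewrite divr_gt0// mulr_gt0.
have aq : a * q = N%:R / 2 by rewrite /a /q; field; rewrite gt_eqF.
have cphi := profile_c0 prf.
have [L L0 dL] := profile_gradient_bounded prf phiM p1.
have Lip := partial_lipschitz (profile_d1 prf) dL.
have van e : 0 < e -> exists r : R, forall y, r <= sqn y -> `|phi y| <= e.
  exact: in_Lq_vanishing q0 cphi Lip Lphi.
have [C C0 decay] := profile_decay p1 prf phiM van.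
have dotL := dotg_le dL.
have L20 : 0 <= (N%:R * L) ^+ 2 by exact: sqr_ge0.
(* The threshold whose power [p - 1] is 1/16, half of the 1/8 in the lower bound for the form. *)
have c16 : 0 < (1 / 16) `^ a :> R by rewrite powR_gt0// divr_gt0.
have [y1 [z0 [z00 z0y phi1 out]]] := outer_point N0 cphi c16 nz van.
have {}out y : z0 < sqn y -> `|phi y| `^ (p - 1) <= 1 / 16.
  move=> /out h; have h2 : 0 <= 1 / 16 :> R by rewrite divr_ge0.
  rewrite [leRHS](_ : 1 / 16 = ((1 / 16) `^ a) `^ (p - 1)).
    by apply: ge0_ler_powR; rewrite ?nnegrE ?powR_ge0// ltW.
  by rewrite -powRrM /a mulVf ?gt_eqF// powRr1.
have [z1 [z2 [c [d [z01 c0 d0 boxP]]]]] := box_around cphi z0y phi1.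
have M0 : 0 <= M by exact: le_trans (phiM 0).
pose F := M `^ (p - 1) * M ^+ 2.
have F0 : 0 <= F by rewrite mulr_ge0 ?powR_ge0 ?sqr_ge0.
have z12 : z1 <= z2.
  have [|/andP[h1 h2] _] := boxP y1; first by move=> i; rewrite subrr normr0 ltW.
  exact: le_trans h2.
have z20 : 0 <= z2 by clear -z00 z01 z12; lra.
have z10 : 0 <= z1 by clear -z00 z01; lra.
have [k k5 ka] : exists2 k : nat, (5 <= k)%N & 2 * a + 2 <= k%:R.
  exists (maxn 5 (Num.bound (2 * a + 2))); first exact: leq_maxl.
  apply: (le_trans (ltW (archi_boundP _))); last by rewrite ler_nat leq_maxr.
  by rewrite addr_ge0// mulr_ge0// invr_ge0 ltW.
have ms0 := normr_ge0 ms.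
pose bd := 128 * `|ms| + 1 + `|ms|.
have bd0 : 0 <= bd by rewrite /bd; clear -ms0; lra.
(* [A1] and [A2] must not depend on [n]. In particular [k], [d] and the box are fixed beforehand,
   and the factor [v * K], which does depend on [n], is divided out at the end. *)
pose A1 := (1 / 2) ^+ k * (2 * d) ^+ N * (expR (- (z2 / 32)) * ((1 + z2)^-1 / 16 * c ^+ 2)).
pose A2 := F * (2 * (z0 + 1)) ^+ N.
have z2p : 0 < 1 + z2 by clear -z20; lra.
have A10 : 0 < A1.
  apply: mulr_gt0.
    by apply: mulr_gt0; apply: exprn_gt0; [exact: divr_gt0|exact: mulr_gt0].
  apply: mulr_gt0; first exact: expR_gt0.
  apply: mulr_gt0; last exact: exprn_gt0.
  by rewrite divr_gt0// invr_gt0.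
apply: (@geometric_le R A1 A2 z0 z1 (maxn k (Num.bound bd)) A10 z00 z01) => n.
rewrite geq_max => /andP[kn bn].
pose K := n%:R - ms.
have K0 : 128 * `|ms| + 1 <= K.
  have h1 : bd <= n%:R.
    by apply: (le_trans (ltW (archi_boundP bd0))); rewrite ler_nat.
  by have := ler_norm ms; rewrite /K; rewrite /bd in h1; clear -h1; lra.
have Kp : 0 < K by clear -K0 ms0; lra.
have D0 : 0 < 16 * (`|ms| + K + 1) by clear -Kp ms0; lra.
(* As large as [square_bound] permits; being of order [1/n], it also keeps [dl * K] bounded, as
   [wv_ge_exp] requires. *)
pose dl := (16 * (`|ms| + K + 1))^-1.
have dl0 : 0 < dl by rewrite invr_gt0.
have dK : dl * (`|ms| + K + 1) <= 1 / 16.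
  rewrite /dl invfM -mulrA mulVf ?mulr1 ?div1r//.
  by rewrite gt_eqF//; clear -Kp ms0; lra.
have dlK : dl * K <= 1 / 16.
  apply: le_trans dK; rewrite ler_pM2l//; clear -ms0; lra.
have dl1 : dl <= 1.
  by rewrite invf_le1//; clear -Kp ms0; lra.
pose v := 2 `^ (- (2 * K)) : R.
have v0 : 0 < v by rewrite powR_gt0.
pose k1 := z1 ^+ n * (v * expR (- (z2 / 32))) * (K * (1 + z2)^-1 / 16 * c ^+ 2).
pose k2 := z0 ^+ n * v * (K * F).
have e0 := expR_gt0 (- (z2 / 32)).
have i0 : 0 < (1 + z2)^-1 by rewrite invr_gt0.
have Ki : 0 <= K * (1 + z2)^-1 / 16 * c ^+ 2.
  by rewrite mulr_ge0 ?sqr_ge0// divr_ge0// mulr_ge0// ltW.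
have k10 : 0 <= k1.
  by apply: mulr_ge0 => //; rewrite mulr_ge0 ?exprn_ge0// mulr_ge0// ltW.
have k20 : 0 <= k2.
  by apply: mulr_ge0; [rewrite mulr_ge0 ?exprn_ge0// ltW|rewrite mulr_ge0// ltW].
have jN : (N + 2 <= 2 * (N + 2))%N by rewrite leq_pmull.
have h : (1 / 2) ^+ k * k1 * (2 * d) ^+ N <= k2 * (2 * (z0 + 1)) ^+ N.
  apply: (@weight_comparison R N p q M ((N%:R * L) ^+ 2) C dl K n (N + 2) k phi d1 d2 y1
  z0 z1 z2 c d k1 k2 p1 prf phiM L20 dotL (ltW C0) decay q0 aq Lphi dl0 dK K0 erefl
  ka k5 kn jN z00 out z01 c0 d0 boxP k10 k20).
  - move=> z /andP[zz1 zz2]; have zp : 0 <= z by exact: le_trans zz1.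
    rewrite /wA subn0 /k1; apply: ler_pM => //.
    + by rewrite mulr_ge0 ?exprn_ge0// mulr_ge0// ltW.
    + apply: ler_pM; rewrite ?exprn_ge0//.
      * by rewrite mulr_ge0// ltW.
      * by rewrite lerXn2r ?nnegrE.
      * exact: wv_ge_exp dl0 (ltW Kp) dlK zp zz2.
    + apply: ler_wpM2r; first exact: sqr_ge0.
      by rewrite ler_pM2r// ler_pM2l//; exact: wr_ge.
  - move=> z /andP[zp zz0]; rewrite /k2 /wA subn0.
    apply: ler_wpM2r; first by rewrite mulr_ge0// ltW.
    apply: ler_pM; rewrite ?exprn_ge0 ?wv_ge0//.
      by rewrite lerXn2r ?nnegrE.
    exact: wv_le_origin (ltW Kp) zp.
rewrite /k1 /k2 in h.
have vK : 0 < v * K by exact: mulr_gt0.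
rewrite -(ler_pM2l vK) /A1 /A2.
by clear -h; lra.
Qed.

Theorem corollary2 (R : realType) (N : nat) (p : R) (phi : 'rV[R]_N -> R)
    (hN : (1 <= N)%N) (hp : 1 < p)
    (phi_C2 : class_C 2 phi)
    (phi_nontrivial : exists y, phi y <> 0)
    (phi_bounded : exists M : R, forall y, `|phi y| <= M)
    (phi_eq : forall y : 'rV[R]_N,
      laplacian phi y - 2^-1 * dot_grad phi y
        + `|phi y| `^ (p - 1) * phi y - (p - 1)^-1 * phi y = 0) :
  ~ in_Lq (N%:R * (p - 1) / 2) phi.
Proof.
have [M phiM] := phi_bounded.
have [cphi h1] := phi_C2.
apply: (@profile_not_in_Lq R N p M phi (fun i => partial i phi)
  (fun i j => partial i (partial j phi))) => //.
split => //.
- by move=> i y; apply: derivableP; exact: (h1 i).1.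
- by move=> i j y; apply: derivableP; exact: ((h1 j).2.2 i).1.
- by move=> i; exact: (h1 i).2.1.
- by move=> i j; exact: ((h1 j).2.2 i).2.1.
Qed.
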